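(* Let $I$ be a smooth function on an open interval. Then the space of almost Einstein scales of the conformal structure $c_I=[g_I]$ on $M_I$ (trivialized with respect to $g_I$) is exactly the $2$-dimensional space $\mathcal S$ of almost Ricci-flat scales given by the functions $\sigma=\sigma(x)$ that satisfy $$\sigma''-\tfrac13I\sigma=0 .$$ Consequently, the dimension of the conformal symmetry algebra $\mathfrak{aut}(c_I)$ is $$\dim\mathfrak{aut}(c_I)=\begin{cases}8,& I\text{ not constant},\\ 9,& I\text{ constant}.\end{cases}$$
   Context: $M_I=\{(x,y,p,q,z)\in\mathbb{R}^5:x\in\mathrm{dom}\,I\}$, and functions of $x$ are identified with their pullbacks to $M_I$. With $F_I=-\tfrac12[q^2+\tfrac{10}{3}Ip^2+(1+I^2-I'')y^2]$, $$\omega^1=dy-p\,dx,\quad\omega^2=dz-F_I\,dx-(\partial_qF_I)(dp-q\,dx),\quad\omega^3=dp-q\,dx,\quad\omega^4=dq,\quad\omega^5=dx.$$ The $2$-plane field $D_I=\ker\{\omega^1,\omega^2,\omega^3\}$ is generic and induces the (Nurowski) conformal structure $c_I=[g_I]$ with $$g_I=-3I(\omega^1)^2+3\,\omega^1\omega^4-10Ip\,\omega^1\omega^5-3\,\omega^2\omega^5-2(\omega^3)^2,\qquad\omega^i\omega^j=\tfrac12(\omega^i\otimes\omega^j+\omega^j\otimes\omega^i).$$ A smooth function $\sigma$ on $M_I$ with zero set $\Sigma$ (representing a weight-$1$ conformal density trivialized by $g_I$) is an almost Einstein scale of $c_I$ if $\sigma^{-2}g_I|_{M_I-\Sigma}$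 is Einstein, and an almost Ricci-flat scale if that metric is Ricci-flat; the zero function is included in both. $\mathfrak{aut}(c_I)$ is the Lie algebra of vector fields $\xi$ on $M_I$ with $\mathcal L_\xi g_I=\lambda g_I$ for some smooth function $\lambda$ (conformal Killing fields). *)

(* Defs.v *)
From HB Require Import structures.
From mathcomp Require Import all_boot all_order all_algebra.
From mathcomp Require Import all_classical all_reals all_analysis.
Set Implicit Arguments.
Unset Strict Implicit.
Unset Printing Implicit Defensive.
Import Order.TTheory GRing.Theory Num.Theory.
Import numFieldNormedType.Exports.
Local Open Scope ring_scope.
Local Open Scope classical_set_scope.

Section Calculus.
Variables (R : realType) (n : nat).
Local Notation V := 'rV[R]_n.+1.

Definition partial (i : 'I_n.+1) (f : V -> R) : V -> R :=
  fun u => 'D_(delta_mx 0 i) f u.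

Definition partials (s : seq 'I_n.+1) (f : V -> R) : V -> R :=
  foldr partial f s.

(* For open [U]: all iterated partial derivatives exist and are continuous
   on [U]. *)
Definition smooth_on (U : set V) (f : V -> R) : Prop :=
  forall (s : seq 'I_n.+1) (u : V), U u ->
    {for u, continuous (partials s f)} /\
    (forall i, derivable (partials s f) u (delta_mx 0 i)).

Definition smooth_field_on (U : set V) (xi : V -> V) : Prop :=
  forall i, smooth_on U (fun u => xi u 0 i).

End Calculus.

Definition smooth1_on (R : realType) (J : set R) (f : R -> R) : Prop :=
  forall (k : nat) (x : R), J x -> derivable (f^`(k)) x 1.

(* A symmetric 2-tensor field is given by its component matrix in the
   coordinates of [V]; everything below depends only on its germ at [u]. *)
Section Metrics.
Variables (R : realType) (n : nat).
Local Notation V := 'rV[R]_n.+1.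
Local Notation tensor2 := (V -> 'M[R]_n.+1).

(* Component Gamma^k_{ij} of the Levi-Civita connection of [g]. *)
Definition christoffel (g : tensor2) (k i j : 'I_n.+1) : V -> R := fun u =>
  2^-1 * \sum_(l < n.+1) invmx (g u) k l *
    (partial i (fun v => g v j l) u + partial j (fun v => g v i l) u
     - partial l (fun v => g v i j) u).

Definition ricci (g : tensor2) : tensor2 := fun u =>
  \matrix_(i, j)
    (\sum_(k < n.+1) (partial k (christoffel g k i j) u
                      - partial j (christoffel g k i k) u)
     + \sum_(k < n.+1) \sum_(l < n.+1)
         (christoffel g k k l u * christoffel g l i j u
          - christoffel g k j l u * christoffel g l i k u)).

Definition einstein_on (U : set V) (g : tensor2) : Prop :=
  exists lambda : R, forall u, U u -> ricci g u = lambda *: g u.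

Definition ricci_flat_on (U : set V) (g : tensor2) : Prop :=
  forall u, U u -> ricci g u = 0.

Definition rescale (sigma : V -> R) (g : tensor2) : tensor2 :=
  fun u => (sigma u) ^- 2 *: g u.

Definition off_zeros (M : set V) (sigma : V -> R) : set V :=
  [set u | M u /\ sigma u != 0].

Definition almost_einstein_scales (M : set V) (g : tensor2) : set (V -> R) :=
  [set sigma | smooth_on M sigma /\
               einstein_on (off_zeros M sigma) (rescale sigma g)].

Definition almost_ricci_flat_scales (M : set V) (g : tensor2) : set (V -> R) :=
  [set sigma | smooth_on M sigma /\
               ricci_flat_on (off_zeros M sigma) (rescale sigma g)].

Definition lie_derivative (xi : V -> V) (g : tensor2) : tensor2 := fun u =>
  \matrix_(i, j) \sum_(k < n.+1)
    (xi u 0 k * partial k (fun v => g v i j) u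
     + g u k j * partial i (fun v => xi v 0 k) u
     + g u i k * partial j (fun v => xi v 0 k) u).

Definition conformal_killing_fields (M : set V) (g : tensor2) : set (V -> V) :=
  [set xi | smooth_field_on M xi /\
     exists2 lambda : V -> R, smooth_on M lambda &
       forall u, M u -> lie_derivative xi g u = lambda u *: g u].

End Metrics.

(* Functions on [M] are represented by total functions, of which only the
   restriction to [M] is meaningful: [S], viewed as a set of functions on [M],
   is the span of [d] linearly independent elements, i.e. a subspace of
   dimension [d]. *)
Definition has_dim_on (R : realType) (T : Type) (W : lmodType R) (M : set T)
    (S : set (T -> W)) (d : nat) : Prop :=
  exists b : 'I_d -> T -> W,
    (forall c : 'I_d -> R,
       (forall u, M u -> \sum_(i < d) c i *: b i u = 0) -> forall i, c i = 0) /\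
    (forall f : T -> W,
       S f <-> exists c : 'I_d -> R,
                 forall u, M u -> f u = \sum_(i < d) c i *: b i u).

Section NurowskiMetric.
Variables (R : realType) (I : R -> R).
Local Notation V := 'rV[R]_5.

Definition ix : 'I_5 := @Ordinal 5 0 isT.
Definition iy : 'I_5 := @Ordinal 5 1 isT.
Definition ip : 'I_5 := @Ordinal 5 2 isT.
Definition iq : 'I_5 := @Ordinal 5 3 isT.
Definition iz : 'I_5 := @Ordinal 5 4 isT.

(* M_I, for dom I = [J]; the coordinates are (x, y, p, q, z). *)
Definition M_of (J : set R) : set V := [set u | J (u 0 ix)].

Definition F_of (u : V) : R :=
  let x := u 0 ix in let y := u 0 iy in let p := u 0 ip in let q := u 0 iq in
  - 2^-1 * (q ^+ 2 + 10 / 3 * I x * p ^+ 2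
            + (1 + I x ^+ 2 - (I^`(2))%classic x) * y ^+ 2).

(* Covectors are row vectors of coefficients with respect to the dual basis
   dx, dy, dp, dq, dz. *)
Definition dcoord (i : 'I_5) : V := delta_mx 0 i.

Definition omega3 (u : V) : V := dcoord ip - u 0 iq *: dcoord ix.
Definition omega1 (u : V) : V := dcoord iy - u 0 ip *: dcoord ix.
Definition omega2 (u : V) : V :=
  dcoord iz - F_of u *: dcoord ix - partial iq F_of u *: omega3 u.
Definition omega4 (u : V) : V := dcoord iq.
Definition omega5 (u : V) : V := dcoord ix.

Definition symprod (a b : V) : 'M[R]_5 := 2^-1 *: (a^T *m b + b^T *m a).

Definition g_of (u : V) : 'M[R]_5 :=
  (- 3 * I (u 0 ix)) *: symprod (omega1 u) (omega1 u)
  + 3 *: symprod (omega1 u) (omega4 u)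
  - (10 * I (u 0 ix) * u 0 ip) *: symprod (omega1 u) (omega5 u)
  - 3 *: symprod (omega2 u) (omega5 u)
  - 2 *: symprod (omega3 u) (omega3 u).

Definition scale_solutions (J : set R) : set (V -> R) :=
  [set sigma | exists s : R -> R,
     [/\ smooth1_on J s,
         forall x, J x -> (s^`(2))%classic x - 3^-1 * I x * s x = 0 &
         forall u, M_of J u -> sigma u = s (u 0 ix)]].

End NurowskiMetric.

(* Main.v *)
(** In the coordinates (x, y, p, q, z) the metric g_I is a plane wave: d/dz is
    null and parallel, g_I does not depend on z, and its Ricci tensor is
    - I dx^2.  For sigma nonvanishing, sigma^-2 g_I is Einstein up to a factor
    (a priori a function) iff 3 Hess sigma + sigma Ric is a multiple of g_I.
    This is a linear overdetermined system for sigma; it also holds across the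
    zeros of sigma, by continuity on the closure of {sigma <> 0} and trivially
    on the interior of {sigma = 0}.  Its integrability conditions force sigma
    to depend on x only and then sigma'' = I sigma / 3, in which case the
    rescaled metric is Ricci-flat.

    In the same way the integrability conditions of the conformal Killing
    equation force
      xi = c0 d/dx + c1 (y d/dy + p d/dp + q d/dq + 2 z d/dz) + c2 d/dz
           + b d/dy + c d/dp + d d/dq + (e1 y + e2 p + e3 q) d/dz
    with constants c0, c1, c2 such that c0 I' = 0, and with functions
    b, c, d, e1, e2, e3 of x that solve a linear first-order system of rank 6.
    Hence the dimension is 6 + 2, or 6 + 3 when I is constant.

    All manipulations of partial differential equations are done on formal
    differential polynomials: an integrability condition is accepted once it is
    checked, by computation, to be a combination of derivatives of the given
    equations. *)

Require Import Defs.
From HB Require Import structures.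
From Stdlib Require QArith_base Qreduction.
From mathcomp Require Import all_boot all_order all_algebra.
From mathcomp Require Import all_classical all_reals all_analysis.
From mathcomp Require Import ssrZ ring lra.
Set Implicit Arguments.
Unset Strict Implicit.
Unset Printing Implicit Defensive.
Import Order.TTheory GRing.Theory Num.Theory.
Import numFieldNormedType.Exports.
Local Open Scope ring_scope.
Local Open Scope classical_set_scope.

(** * Partial derivatives of smooth functions *)

(** Two obstacles shape the proof. The Ricci tensor of the rescaled metric contains the reciprocal
    of the scale, whereas the equations must also be used at its zeros. The scale therefore enters
    twice: as function 0, whose reciprocal is an atom, in the Ricci computation, and as function 1
    in the linear equations, where function 0 may then be replaced by the constant 1. And the
    dimension counts need solutions of linear systems on the whole interval, although the
    coefficients may be unbounded near its ends; Picard's series is estimated on compact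
    subintervals around a fixed base point.

    The count of symmetries has a geometric meaning: the six-dimensional solution space and d/dz
    span the Heisenberg algebra carried by a plane wave in dimension five, [c1] belongs to its
    homothety, and [c0] to the translation in x, which is a symmetry only if the profile of the wave
    does not depend on x. As dx is null, a scale that depends on x only contributes neither a
    Laplacian nor a squared gradient to the conformal change of the Ricci tensor; this is why all
    almost Einstein scales are almost Ricci-flat. *)

Section Lines.
Variables (R : realType) (n : nat).
Local Notation V := 'rV[R]_n.+1.
Implicit Types (f g : V -> R) (u v : V).

(** Lets one-variable theorems such as the mean value theorem act on directional derivatives: the
    two difference quotients are the same function of [h]. *)
Lemma derivable_line f u v t : derivable f (t *: v + u) v ->
  is_derive t 1 (fun s : R => f (s *: v + u)) ('D_v f (t *: v + u)).
Proof.
have E : (fun h : R => h^-1 *: (f (h *: v + (t *: v + u)) - f (t *: v + u))) =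
   (fun h : R => h^-1 *: (f ((h *: 1 + t) *: v + u) - f (t *: v + u))).
  by apply/funext => h; rewrite [h *: 1]mulr1 scalerDl addrA.
move=> df; split; last by rewrite /derive /= -[in RHS]/(shift _ _) /= E.
by rewrite /derivable/= -E.
Qed.

Lemma eq_partial (U : set V) f g i u : open U -> U u ->
  (forall v, U v -> f v = g v) -> partial i f u = partial i g u.
Proof.
move=> oU Uu fg; apply: near_eq_derive.
by near=> v; apply: fg; near: v; exact: open_nbhs_nbhs.
Unshelve. all: by end_near. Qed.

Lemma eq_derivable (U : set V) f g v u : open U -> U u ->
  (forall v, U v -> f v = g v) -> derivable f u v -> derivable g u v.
Proof.
move=> oU Uu fg; apply: near_eq_derivable.
by near=> w; apply: fg; near: w; exact: open_nbhs_nbhs.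
Unshelve. all: by end_near. Qed.

Lemma eq_continuous_at (U : set V) f g u : open U -> U u ->
  (forall v, U v -> f v = g v) -> {for u, continuous f} ->
  {for u, continuous g}.
Proof.
move=> oU Uu fg cf; rewrite /prop_for /continuous_at -(fg _ Uu).
have fg' : \forall v \near u, f v = g v.
  by near=> w; apply: fg; near: w; exact: open_nbhs_nbhs.
exact: cvg_trans (near_eq_cvg fg') cf.
Unshelve. all: by end_near. Qed.

Lemma smooth_partial (U : set V) f i : smooth_on U f -> smooth_on U (partial i f).
Proof.
move=> sf s u Uu; have := sf (rcons s i) u Uu.
by rewrite /partials foldr_rcons.
Qed.

Lemma smooth_partials (U : set V) f s : smooth_on U f -> smooth_on U (partials s f).
Proof. by move=> sf; elim: s => [|i s IHs]; [exact: sf | exact: smooth_partial]. Qed.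

Lemma smooth_derivable (U : set V) f i u :
  smooth_on U f -> U u -> derivable f u (delta_mx 0 i : V).
Proof. by move=> sf Uu; have [_] := sf [::] u Uu; exact. Qed.

Lemma smooth_continuous (U : set V) f u :
  smooth_on U f -> U u -> {for u, continuous f}.
Proof. by move=> sf Uu; have [] := sf [::] u Uu. Qed.

(** By induction on the list, each iterated partial agrees on [U] with a member of [C]; since [U] is
    open, continuity and derivability carry over. Smoothness then follows from one closure property
    of [C], in place of an induction on lists for each function. *)
Lemma smooth_coind (U : set V) (C : (V -> R) -> Prop) : open U ->
  (forall f, C f -> forall u, U u -> {for u, continuous f}) ->
  (forall f (i : 'I_n.+1), C f ->
     (forall u, U u -> derivable f u (delta_mx 0 i : V)) /\
     exists2 h, C h & forall u, U u -> partial i f u = h u) ->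
  forall f, C f -> smooth_on U f.
Proof.
move=> oU Cc Cd f Cf s.
suff [h Ch hE] : exists2 h, C h & forall u, U u -> partials s f u = h u.
  move=> u Uu; split=> [|i].
    apply: (eq_continuous_at oU Uu) (Cc _ Ch _ Uu) => v Uv.
    by rewrite hE.
  apply: (eq_derivable oU Uu) ((Cd _ i Ch).1 _ Uu) => v Uv.
  by rewrite hE.
elim: s => [|i s [h Ch hE]]; first by exists f.
have [_ [k Ck kE]] := Cd _ i Ch; exists k => // u Uu.
by rewrite -kE//; apply: (eq_partial i oU Uu).
Qed.

Lemma eq_smooth (U : set V) f g : open U -> (forall u, U u -> f u = g u) ->
  smooth_on U f -> smooth_on U g.
Proof.
move=> oU fg sf.
pose C h := exists2 k, smooth_on U k & forall u, U u -> h u = k u.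
apply: (@smooth_coind _ C) => //; last by exists f => // u Uu; rewrite fg.
- move=> h [k sk hk] u Uu; apply: (eq_continuous_at oU Uu) (smooth_continuous sk Uu).
  by move=> v Uv; rewrite hk.
- move=> h i [k sk hk]; split=> [u Uu|].
    by apply: (eq_derivable oU Uu _ (smooth_derivable sk Uu)) => v Uv; rewrite hk.
  exists (partial i k); last by move=> u Uu; apply: (eq_partial i oU Uu).
  exists (partial i k); [exact: smooth_partial | by []].
Qed.

Lemma smooth_subset (U U' : set V) f : U `<=` U' -> smooth_on U' f -> smooth_on U f.
Proof. by move=> UU sf s u /UU; exact: sf. Qed.

End Lines.

(** * Symmetry of mixed partial derivatives *)

Section Schwarz.
Variables (R : realType) (n : nat).
Local Notation V := 'rV[R]_n.+1.
Implicit Types (f g : V -> R) (u v : V) (U : set V).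

Lemma mvt_line f u v (h : R) : 0 < h ->
  (forall t, 0 <= t <= h -> derivable f (t *: v + u) v) ->
  exists2 t, 0 <= t <= h & f (h *: v + u) - f u = h * 'D_v f (t *: v + u).
Proof.
move=> h0 df.
have ds t : t \in `[0, h]%R -> is_derive t 1 (fun s => f (s *: v + u)) ('D_v f (t *: v + u)).
  by move=> th; apply: derivable_line; apply: df; move: th; rewrite in_itv.
have [|t th E] := MVT h0 (fun t th => ds t (subset_itv_oo_cc th)).
  by apply: derivable_within_continuous => t /ds[].
exists t; last by move: E; rewrite scale0r add0r subr0 mulrC.
by have := subset_itv_oo_cc th; rewrite in_itv.
Qed.

Lemma row_ball_line u (e h s t : R) (i j : 'I_n.+1) : 0 <= s <= h -> 0 <= t <= h ->
  h < e / 2 -> ball u e (s *: delta_mx 0 i + (t *: delta_mx 0 j + u)).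
Proof.
move=> /andP[s0 sh] /andP[t0 th] he; rewrite -ball_normE/= addrA opprD addrCA subrr addr0.
rewrite normrN; apply: le_lt_trans (ler_normD _ _) _.
have nd (k : 'I_n.+1) : `|delta_mx 0 k : V| <= 1.
  rewrite /Num.norm/= mx_normrE; apply: bigmax_le => // -[a b] _ /=.
  by rewrite !mxE; case: (_ && _); rewrite ?normr1 ?normr0.
rewrite (splitr e); apply: ltrD; rewrite normrZ ger0_norm//.
  by apply: le_lt_trans he; apply: le_trans sh; rewrite ler_piMr.
by apply: le_lt_trans he; apply: le_trans th; rewrite ler_piMr.
Qed.

(** The mean value theorem is applied twice: to the increment [g] of [f] along [j], as a function
    along [i], and then to [partial i f] along [j]. The left side is symmetric in [i] and [j], which
    is what [partialC] exploits. *)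
Lemma second_difference f u (e h : R) (i j : 'I_n.+1) : 0 < h -> h < e / 2 ->
  (forall v, ball u e v -> derivable f v (delta_mx 0 i : V)) ->
  (forall v, ball u e v -> derivable (partial i f) v (delta_mx 0 j : V)) ->
  exists2 v, ball u e v &
    f (h *: delta_mx 0 i + (h *: delta_mx 0 j + u)) - f (h *: delta_mx 0 i + u)
    - (f (h *: delta_mx 0 j + u) - f u) = h ^+ 2 * partial j (partial i f) v.
Proof.
move=> h0 he di dji; have hh : 0 <= h <= h by rewrite lexx ltW.
pose g v := f (h *: delta_mx 0 j + v) - f v.
have shift_der (w : V) (v : V) (k : 'I_n.+1) : derivable f (w + v) (delta_mx 0 k : V) ->
    is_derive v (delta_mx 0 k : V) (fun x => f (w + x)) (partial k f (w + v)).
  move=> df.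
  have E : (fun t : R => t^-1 *: (f (t *: delta_mx 0 k + (w + v)) - f (w + v))) =
   (fun t : R => t^-1 *: (f (w + (t *: delta_mx 0 k + v)) - f (w + v))).
    by apply/funext => t; rewrite addrCA.
  by split; rewrite ?/partial /derivable /derive/= -E.
have dg (t : R) : 0 <= t <= h -> is_derive (t *: delta_mx 0 i + u) (delta_mx 0 i : V) g
    (partial i f (h *: delta_mx 0 j + (t *: delta_mx 0 i + u)) - partial i f (t *: delta_mx 0 i + u)).
  move=> th; apply: is_deriveB.
    by apply: shift_der; apply: di; apply: (@row_ball_line u e h).
  apply: DeriveDef => //; apply: di.
  have := @row_ball_line u e h t 0 i i th; rewrite scale0r add0r; apply => //.
  by rewrite lexx ltW.
have [|t th E1] := @mvt_line g u (delta_mx 0 i) h h0.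
  by move=> t th; have [] := dg t th.
have [|s sh E2] := @mvt_line (partial i f) (t *: delta_mx 0 i + u) (delta_mx 0 j) h h0.
  by move=> s sh; apply: dji; apply: (@row_ball_line u e h).
exists (s *: delta_mx 0 j + (t *: delta_mx 0 i + u)); first by apply: (@row_ball_line u e h).
rewrite addrCA [LHS](_ : _ = g (h *: delta_mx 0 i + u) - g u); last first.
  by rewrite /g; congr (_ - _).
by rewrite E1 (@derive_val _ _ _ _ _ _ _ (dg t th)) E2 mulrA -expr2.
Qed.

(** Made for mixed partials, whose values are known to coincide only at two different points near
    [u]. A positive gap at [u] would be smaller than the sum of two halves of itself. *)
Lemma eq_at_of_close (a b : V -> R) u :
  {for u, continuous a} -> {for u, continuous b} ->
  (forall e : R, 0 < e -> exists2 v, ball u e v & exists2 w, ball u e w & b v = a w) ->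
  a u = b u.
Proof.
move=> ca cb ab; apply/eqP/negPn/negP => neq.
have e0 : 0 < `|a u - b u| / 2 by rewrite divr_gt0// normr_gt0 subr_eq0.
have /cvgrPdist_lt/(_ _ e0)/nbhs_ballP[e1 /= e1_gt0 B1] := ca.
have /cvgrPdist_lt/(_ _ e0)/nbhs_ballP[e2 /= e2_gt0 B2] := cb.
have e12 : 0 < Num.min e1 e2 by rewrite lt_min e1_gt0.
have [v Bv [w Bw bv]] := ab _ e12.
have A1 : `|a u - a w| < `|a u - b u| / 2.
  by apply: B1; apply: le_ball Bw; rewrite ge_min lexx.
have A2 : `|b u - b v| < `|a u - b u| / 2.
  by apply: B2; apply: le_ball Bv; rewrite ge_min lexx orbT.
have : `|a u - b u| < `|a u - b u|.
  rewrite [ltRHS]splitr [ltLHS](_ : _ = `|(a u - a w) + (b v - b u)|); last first.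
    by rewrite bv addrA addrNK.
  by apply: le_lt_trans (ler_normD _ _) _; rewrite ltrD// distrC.
by rewrite ltxx.
Qed.

Lemma partialC (U : set V) f i j u : open U -> smooth_on U f -> U u ->
  partial i (partial j f) u = partial j (partial i f) u.
Proof.
move=> oU sf Uu.
have s1 k : smooth_on U (partial k f) by apply: smooth_partial; exact: sf.
have s2 k l : smooth_on U (partial k (partial l f)).
  by apply: smooth_partial; exact: s1.
apply: eq_at_of_close.
- by apply: smooth_continuous Uu; exact: s2.
- by apply: smooth_continuous Uu; exact: s2.
move=> e e_gt0.
have /nbhs_ballP[d /= d_gt0 Bd] := open_nbhs_nbhs (conj oU Uu).
pose r := Num.min d e; have r0 : 0 < r by rewrite lt_min d_gt0.
have rU v : ball u r v -> U v.
  by move=> /(@le_ball _ _ u r d) H; apply: Bd; apply: H; rewrite ge_min lexx.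
have re v : ball u r v -> ball u e v.
  by apply: le_ball; rewrite ge_min lexx orbT.
(* [second_difference] requires a step below half the radius, so that moving along both directions
   stays in the ball. *)
have h0 : 0 < r / 4 by rewrite divr_gt0.
have hr : r / 4 < r / 2 by rewrite ltr_pM2l// ltf_pV2 ?posrE// ltr_nat.
have df k v : ball u r v -> derivable f v (delta_mx 0 k : V).
  by move=> /rU; exact: (smooth_derivable sf).
have ddf k l v : ball u r v -> derivable (partial k f) v (delta_mx 0 l : V).
  by move=> /rU; exact: (smooth_derivable (s1 k)).
have [v Bv E] := second_difference h0 hr (df i) (ddf i j).
have [w Bw F] := second_difference h0 hr (df j) (ddf j i).
exists v; first exact: re.
exists w; first exact: re.
have hN : (r / 4) ^+ 2 != 0 by rewrite expf_neq0// gt_eqF.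
apply: (mulfI hN); apply: etrans (esym E) _; apply: etrans F.
by rewrite (addrCA (_ *: delta_mx 0 j)); ring.
Qed.

End Schwarz.

(** * Differential polynomials *)

(** Identities between terms are decided by computation, so the coefficients are fractions of binary
    integers; [qR] interprets them in [R]. *)
Notation ratQ := QArith_base.Q.
Notation mkQ := QArith_base.Qmake.

Section RationalCoefficients.
Variable R : realType.
Implicit Types p q : ratQ.

Definition zR (z : BinNums.Z) : R := (int_of_Z z)%:~R.
Definition qR q : R := zR (QArith_base.Qnum q) / zR (BinNums.Zpos (QArith_base.Qden q)).

Lemma zRM (a b : BinNums.Z) : zR (a * b)%R = zR a * zR b.
Proof. by rewrite /zR rmorphM rmorphM. Qed.

Lemma zRD (a b : BinNums.Z) : zR (a + b)%R = zR a + zR b.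
Proof. by rewrite /zR rmorphD rmorphD. Qed.

Lemma zR_pos_neq0 (d : BinNums.positive) : zR (BinNums.Zpos d) != 0.
Proof.
rewrite /zR intr_eq0; apply/eqP => /(congr1 Z_of_int).
by rewrite int_of_ZK.
Qed.

Lemma eq_qR p q : QArith_base.Qeq p q -> qR p = qR q.
Proof.
rewrite /QArith_base.Qeq /qR => E; apply/eqP.
rewrite eqr_div ?zR_pos_neq0//; apply/eqP.
by rewrite -2!zRM; congr zR.
Qed.

Lemma qRD p q : qR (Qreduction.Qred (QArith_base.Qplus p q)) = qR p + qR q.
Proof.
rewrite (eq_qR (Qreduction.Qred_correct _)) /QArith_base.Qplus /qR /=.
rewrite -[zR (BinNums.Zpos _)]/(zR (BinNums.Zpos _ * BinNums.Zpos _)%R).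
rewrite -[BinInt.Z.add _ _]/(_ + _ : BinNums.Z).
rewrite -[BinInt.Z.mul (QArith_base.Qnum p) _]/(_ * _ : BinNums.Z).
rewrite -[BinInt.Z.mul (QArith_base.Qnum q) _]/(_ * _ : BinNums.Z).
rewrite zRD !zRM addf_div ?zR_pos_neq0//.
Qed.

Lemma qRM p q : qR (Qreduction.Qred (QArith_base.Qmult p q)) = qR p * qR q.
Proof.
rewrite (eq_qR (Qreduction.Qred_correct _)) /QArith_base.Qmult /qR /=.
rewrite -[zR (BinNums.Zpos _)]/(zR (BinNums.Zpos _ * BinNums.Zpos _)%R).
rewrite -[BinInt.Z.mul (QArith_base.Qnum p) _]/(_ * _ : BinNums.Z).
by rewrite !zRM mulf_div.
Qed.

Lemma qR_num0 q : QArith_base.Qnum q = BinNums.Z0 -> qR q = 0.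
Proof. by rewrite /qR => ->; rewrite /zR mul0r. Qed.

End RationalCoefficients.

Lemma zR1 (R : realType) : zR R (BinNums.Zpos BinNums.xH) = 1.
Proof. by rewrite /zR. Qed.

Lemma qR1 (R : realType) : qR R (mkQ (BinNums.Zpos BinNums.xH) BinNums.xH) = 1.
Proof. by rewrite /qR/= zR1 divr1. Qed.

(* Atoms stand for: the coordinate i; the m-th derivative of the k-th given
   function of one distinguished coordinate; the iterated partial derivative
   along the sorted list s of the k-th given function of all coordinates; the
   reciprocal of the 0-th such function, which is required not to vanish. *)
Inductive atom (n : nat) :=
  | Crd of 'I_n.+1
  | Fx of nat & nat
  | Jet of nat & seq 'I_n.+1
  | Rcp.
Arguments Fx {n}.
Arguments Rcp {n}.
Arguments Jet {n}.
Arguments Crd {n}.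

Inductive dterm (n : nat) :=
  | Cst of ratQ
  | At of atom n
  | Add of dterm n & dterm n
  | Mul of dterm n & dterm n.
Arguments Cst {n}.
Arguments At {n}.
Arguments Add {n}.
Arguments Mul {n}.

(** * Formal derivatives, normal forms and values of terms *)

Section Terms.
Variables (n : nat) (i0 : 'I_n.+1).
Local Notation dterm := (dterm n).
Local Notation atom := (atom n).

Definition qz : ratQ := mkQ BinNums.Z0 BinNums.xH.
Definition q1 : ratQ := mkQ (BinNums.Zpos BinNums.xH) BinNums.xH.
Definition qm1 : ratQ := mkQ (BinNums.Zneg BinNums.xH) BinNums.xH.

(** Mixed partials commute, so a jet is stored under its sorted index list; equal jets are then
    syntactically equal and cancel in normal forms. *)
Fixpoint jins (i : 'I_n.+1) (s : seq 'I_n.+1) : seq 'I_n.+1 :=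
  if s is j :: s' then if (i <= j)%N then i :: s else j :: jins i s' else [:: i].

Definition datom (i : 'I_n.+1) (a : atom) : dterm :=
  match a with
  | Crd j => Cst (if i == j then q1 else qz)
  | Fx k m => if i == i0 then At (Fx k m.+1) else Cst qz
  | Jet k s => At (Jet k (jins i s))
  | Rcp => Mul (Cst qm1) (Mul (Mul (At Rcp) (At Rcp)) (At (Jet 0 [:: i])))
  end.

Fixpoint dD (i : 'I_n.+1) (e : dterm) : dterm :=
  match e with
  | Cst _ => Cst qz
  | At a => datom i a
  | Add e1 e2 => Add (dD i e1) (dD i e2)
  | Mul e1 e2 => Add (Mul (dD i e1) e2) (Mul e1 (dD i e2))
  end.

Definition dDs (s : seq 'I_n.+1) (e : dterm) : dterm := foldr dD e s.

(** An injective code. Which order it induces is immaterial: it has to bring equal monomials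
    together in [poly_ins]. *)
Definition atom_code (a : atom) : seq nat :=
  match a with
  | Crd i => [:: 0%N; nat_of_ord i]
  | Fx k m => [:: 1%N; k; m]
  | Jet k s => 2%N :: k :: map (@nat_of_ord _) s
  | Rcp => [:: 3%N]
  end.

Fixpoint lexcmp (T : Type) (c : T -> T -> comparison) (s t : seq T) : comparison :=
  match s, t with
  | [::], [::] => Eq
  | [::], _ => Lt
  | _, [::] => Gt
  | x :: s', y :: t' => match c x y with Eq => lexcmp c s' t' | o => o end
  end.

Definition atom_cmp (a b : atom) := lexcmp Nat.compare (atom_code a) (atom_code b).
Definition mon_cmp := lexcmp atom_cmp.

Fixpoint mon_ins (a : atom) (m : seq atom) : seq atom :=
  if m is b :: m' then if atom_cmp a b is Gt then b :: mon_ins a m' else a :: m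
  else [:: a].

Definition mon_mul (m m' : seq atom) := foldr mon_ins m' m.

Definition is_q0 (c : ratQ) := if QArith_base.Qnum c is BinNums.Z0 then true else false.

Definition poly_cons (m : seq atom) (c : ratQ) (p : seq (seq atom * ratQ)) :=
  if is_q0 c then p else (m, c) :: p.

Fixpoint poly_ins (m : seq atom) (c : ratQ) (p : seq (seq atom * ratQ)) :=
  if p is (m', c') :: p' then
    match mon_cmp m m' with
    | Eq => poly_cons m' (Qreduction.Qred (QArith_base.Qplus c c')) p'
    | Lt => poly_cons m c p
    | Gt => (m', c') :: poly_ins m c p'
    end
  else poly_cons m c [::].

Definition poly_add (p q : seq (seq atom * ratQ)) :=
  foldr (fun t => poly_ins t.1 t.2) q p.

Definition poly_mulm (m : seq atom) (c : ratQ) (p q : seq (seq atom * ratQ)) :=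
  foldr (fun t => poly_ins (mon_mul m t.1) (Qreduction.Qred (QArith_base.Qmult c t.2))) q p.

Definition poly_mul (p q : seq (seq atom * ratQ)) :=
  foldr (fun t => poly_mulm t.1 t.2 q) [::] p.

Fixpoint norm (e : dterm) : seq (seq atom * ratQ) :=
  match e with
  | Cst c => poly_cons [::] c [::]
  | At a => [:: ([:: a], q1)]
  | Add e1 e2 => poly_add (norm e1) (norm e2)
  | Mul e1 e2 => poly_mul (norm e1) (norm e2)
  end.

Definition mon_term (m : seq atom) : dterm := foldr (fun a => Mul (At a)) (Cst q1) m.

(** Keeps Christoffel symbols short before they are differentiated. Terms built with it are
    justified by a [deq] test against the unsimplified definition. *)
Definition simp (e : dterm) : dterm :=
  foldr (fun t => Add (Mul (Cst t.2) (mon_term t.1))) (Cst qz) (norm e).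

Definition deq (e1 e2 : dterm) : bool := nilp (norm (Add e1 (Mul (Cst qm1) e2))).

Variables (R : realType).
Local Notation V := 'rV[R]_n.+1.
Variables (fx : nat -> R -> R) (fj : nat -> V -> R).

Definition aeval (a : atom) (u : V) : R :=
  match a with
  | Crd i => u 0 i
  | Fx k m => derive1n m (fx k) (u 0 i0)
  | Jet k s => partials s (fj k) u
  | Rcp => (fj 0 u)^-1
  end.

Fixpoint deval (e : dterm) (u : V) : R :=
  match e with
  | Cst c => qR R c
  | At a => aeval a u
  | Add e1 e2 => deval e1 u + deval e2 u
  | Mul e1 e2 => deval e1 u * deval e2 u
  end.

Definition meval (m : seq atom) (u : V) : R := foldr (fun a => *%R (aeval a u)) 1 m.
Definition peval (p : seq (seq atom * ratQ)) (u : V) : R :=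
  foldr (fun t => +%R (qR R t.2 * meval t.1 u)) 0 p.

Lemma lexcmp_eq (T : Type) (c : T -> T -> comparison) :
  (forall x y, c x y = Eq -> x = y) -> forall s t, lexcmp c s t = Eq -> s = t.
Proof.
move=> cE; elim=> [|x s IHs] [|y t] //=; case E: (c x y) => //.
by move=> /IHs ->; rewrite (cE _ _ E).
Qed.

Lemma atom_cmp_eq (a b : atom) : atom_cmp a b = Eq -> a = b.
Proof.
move=> /(@lexcmp_eq _ _ PeanoNat.Nat.compare_eq).
case: a b => [i|k m|k s|] [j|l m'|l t|] //=.
- by move=> [/val_inj ->].
- by move=> [-> ->].
- by move=> [-> /(inj_map (@ord_inj _)) ->].
Qed.

Lemma mon_cmp_eq m m' : mon_cmp m m' = Eq -> m = m'.
Proof. exact: lexcmp_eq atom_cmp_eq m m'. Qed.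

Lemma meval_ins a m u : meval (mon_ins a m) u = aeval a u * meval m u.
Proof.
elim: m => //= b m IHm; case: atom_cmp => //=.
by rewrite IHm mulrCA.
Qed.

Lemma meval_mul m m' u : meval (mon_mul m m') u = meval m u * meval m' u.
Proof.
elim: m => [|a m IHm] /=; first by rewrite mul1r.
by rewrite meval_ins IHm mulrA.
Qed.

Lemma peval_cons m c p u : peval (poly_cons m c p) u = qR R c * meval m u + peval p u.
Proof.
rewrite /poly_cons; case: ifP => //.
rewrite /is_q0; case E: (QArith_base.Qnum c) => // _.
by rewrite qR_num0// mul0r add0r.
Qed.

Lemma peval_ins m c p u : peval (poly_ins m c p) u = qR R c * meval m u + peval p u.
Proof.
elim: p => [|[m' c'] p IHp] /=; first by rewrite peval_cons.
case E: (mon_cmp m m') => /=.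
- by rewrite peval_cons qRD (mon_cmp_eq E) mulrDl addrA.
- by rewrite peval_cons.
- by rewrite IHp addrCA.
Qed.

Lemma peval_add p q u : peval (poly_add p q) u = peval p u + peval q u.
Proof.
elim: p => [|[m c] p IHp] /=; first by rewrite add0r.
by rewrite peval_ins IHp addrA.
Qed.

Lemma peval_mulm m c p q u :
  peval (poly_mulm m c p q) u = qR R c * meval m u * peval p u + peval q u.
Proof.
elim: p => [|[m' c'] p IHp] /=; first by rewrite mulr0 add0r.
by rewrite peval_ins meval_mul qRM IHp mulrDr addrA mulrACA.
Qed.

Lemma peval_mul p q u : peval (poly_mul p q) u = peval p u * peval q u.
Proof.
elim: p => [|[m c] p IHp] /=; first by rewrite mul0r.
by rewrite peval_mulm IHp mulrDl.
Qed.

Lemma qRz : qR R qz = 0. Proof. exact: qR_num0. Qed.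

Lemma qRm1 : qR R qm1 = -1.
Proof. by rewrite /qR /zR/= divr1. Qed.

Lemma peval_norm e u : peval (norm e) u = deval e u.
Proof.
elim: e => [c|a|e1 IH1 e2 IH2|e1 IH1 e2 IH2] /=.
- by rewrite peval_cons /= addr0 mulr1.
- by rewrite qR1 mul1r mulr1 addr0.
- by rewrite peval_add IH1 IH2.
- by rewrite peval_mul IH1 IH2.
Qed.

(** A term and its normal form have the same value, so an empty normal form of the difference forces
    equal values for every choice of the functions. [norm] treats [Rcp] and function 0 as
    independent atoms, so the relation that their product is 1 has to be supplied separately. *)
Lemma deval_eq e1 e2 : deq e1 e2 -> forall u, deval e1 u = deval e2 u.
Proof.
move=> /nilP E u; apply/eqP; rewrite -subr_eq0; apply/eqP.
have := peval_norm (Add e1 (Mul (Cst qm1) e2)) u.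
by rewrite E /= qRm1 mulN1r.
Qed.

End Terms.

(* [(q, m, s, k)] stands for q times the monomial m times the derivative along s
   of the k-th equation. *)
Definition cert_item (n : nat) : Type := ratQ * seq (atom n) * seq 'I_n.+1 * nat.

Section Derivations.
Variables (n : nat) (i0 : 'I_n.+1).

Definition lincomb (eqs : seq (dterm n)) (c : seq (cert_item n)) : dterm n :=
  foldr (fun t e => let: (q, m, s, k) := t in
    Add (Mul (Mul (Cst q) (mon_term m)) (dDs i0 s (nth (Cst qz) eqs k))) e) (Cst qz) c.

(* Each step may use the given equations and all previous steps, numbered
   consecutively. *)
Fixpoint derivation (eqs : seq (dterm n)) (steps : seq (dterm n * seq (cert_item n))) : bool :=
  if steps is (t, c) :: steps' then
    deq t (lincomb eqs c) && derivation (rcons eqs t) steps'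
  else true.

(** For functions given by explicit terms: zero, a function of x, or the general symmetry. [Rcp] is
    left in place, since the reciprocal of a term need not be a term. *)
Fixpoint jsubst (S : nat -> dterm n) (e : dterm n) : dterm n :=
  match e with
  | At (Jet k s) => dDs i0 s (S k)
  | Add e1 e2 => Add (jsubst S e1) (jsubst S e2)
  | Mul e1 e2 => Mul (jsubst S e1) (jsubst S e2)
  | _ => e
  end.

(** Recognizes terms whose value ignores function 0. It allows the same Einstein equation to be read
    with function 0 equal to the scale, off its zeros, and with function 0 equal to 1 everywhere. *)
Fixpoint jet0_free (e : dterm n) : bool :=
  match e with
  | Cst _ => true
  | At Rcp => false
  | At (Jet k _) => k != 0%N
  | At _ => true
  | Add e1 e2 => jet0_free e1 && jet0_free e2
  | Mul e1 e2 => jet0_free e1 && jet0_free e2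
  end.

Lemma deval_jet0_free (R : realType) (fx : nat -> R -> R) (fj fj' : nat -> 'rV[R]_n.+1 -> R) e u :
  (forall k, k != 0%N -> fj k = fj' k) -> jet0_free e ->
  deval i0 fx fj e u = deval i0 fx fj' e u.
Proof.
move=> fE; elim: e => [c|[j|k m|k s|]|e1 IH1 e2 IH2|e1 IH1 e2 IH2] //=.
- by move=> /fE ->.
- by move=> /andP[/IH1 -> /IH2 ->].
- by move=> /andP[/IH1 -> /IH2 ->].
Qed.

End Derivations.

(** * Soundness of the formal calculus *)

Section Soundness.
Variables (R : realType) (n : nat) (i0 : 'I_n.+1).
Local Notation V := 'rV[R]_n.+1.
Variables (fx : nat -> R -> R) (fj : nat -> V -> R) (J : set R) (U : set V).
Hypotheses (oU : open U) (UJ : forall u, U u -> J (u 0 i0)).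
Hypothesis fx_smooth : forall k, smooth1_on J (fx k).
Hypothesis fj_smooth : forall k, smooth_on U (fj k).
Hypothesis fj0_neq0 : forall u, U u -> fj 0 u != 0.
Local Notation aeval := (aeval i0 fx fj).
Local Notation deval := (deval i0 fx fj).
Local Notation dD := (dD i0).
Local Notation e_ i := (delta_mx 0 i : V).

Lemma is_derive_coord (i j : 'I_n.+1) (u : V) :
  is_derive u (e_ i) (fun v : V => v 0 j) (i == j)%:R.
Proof.
have E : (fun h : R => h^-1 *: ((h *: e_ i + u) 0 j - u 0 j)) @ 0^' --> ((i == j)%:R : R).
  apply: cvg_near_cst; near=> h.
  have h0 : h != 0 by near: h; exact: nbhs_dnbhs_neq.
  by rewrite !mxE eqxx /= addrK [_ *: _]mulrA mulVf// mul1r eq_sym.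
by split; [apply/cvg_ex; exists (i == j)%:R | exact: cvg_lim E].
Unshelve. all: by end_near. Qed.

Lemma is_derive_comp_coord (i : 'I_n.+1) (phi : R -> R) (u : V) :
  derivable phi (u 0 i0) 1 ->
  is_derive u (e_ i) (fun v : V => phi (v 0 i0))
    (if i == i0 then phi^`()%classic (u 0 i0) else 0).
Proof.
move=> dphi; have [->|ne] := eqVneq i i0.
  have E : (fun h : R => h^-1 *: (phi ((h *: e_ i0 + u) 0 i0) - phi (u 0 i0))) =
      (fun h : R => h^-1 *: (phi (h *: 1 + u 0 i0) - phi (u 0 i0))).
    by apply/funext => h; rewrite !mxE !eqxx.
  split; first by rewrite /derivable /= E.
  by rewrite /derive /= E derive1E.
have E : (fun h : R => h^-1 *: (phi ((h *: e_ i + u) 0 i0) - phi (u 0 i0))) @ 0^' --> (0 : R).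
  apply: cvg_near_cst; near=> h.
  by rewrite !mxE eqxx /= eq_sym (negbTE ne) mulr0 add0r subrr scaler0.
by split; [apply/cvg_ex; exists 0 | exact: cvg_lim E].
Unshelve. all: by end_near. Qed.

(** Sorting a jet is harmless by symmetry of mixed partials; this is the point where [partialC]
    enters the calculus. *)
Lemma partials_jins i s f u : smooth_on U f -> U u ->
  partials (jins i s) f u = partial i (partials s f) u.
Proof.
move=> sf; elim: s u => [|j s IHs] u Uu //=; case: ifP => //= _.
apply: etrans (eq_partial j oU Uu IHs) _; apply: (partialC _ _ oU _ Uu).
by apply: smooth_partials; exact: sf.
Qed.

Lemma is_derive_deval e i u : U u -> is_derive u (e_ i) (deval e) (deval (dD i e) u).
Proof.
move=> Uu; elim: e => [c|a|e1 IH1 e2 IH2|e1 IH1 e2 IH2] /=.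
- by rewrite qRz; exact: is_derive_cst.
- case: a => [j|k m|k s|] /=.
  + by have := is_derive_coord i j u; case: eqP => _; rewrite ?qR1 ?qRz.
  + have := @is_derive_comp_coord i _ u (@fx_smooth k m _ (UJ Uu)).
    by case: eqP => _ /=; rewrite ?derive1nS// qRz.
  + rewrite partials_jins//; apply: DeriveDef => //.
    by apply: smooth_derivable Uu; exact: smooth_partials.
  + have df : derivable (fj 0) u (e_ i) by apply: smooth_derivable Uu; exact: fj_smooth.
    apply: DeriveDef; first by apply: derivableV df; exact: fj0_neq0.
    rewrite deriveV//; last exact: fj0_neq0.
    by rewrite qRm1 -exprVn expr2 mulNr mul1r [LHS]mulNr.
- exact: is_deriveD.
- apply: is_derive_eq (is_deriveM IH1 IH2) _.
  by rewrite addrC; congr (_ + _); rewrite [LHS]mulrC.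
Qed.

Lemma deval_continuous e u : U u -> {for u, continuous (deval e)}.
Proof.
move=> Uu; elim: e => [c|a|e1 IH1 e2 IH2|e1 IH1 e2 IH2] /=.
- exact: cst_continuous.
- case: a => [j|k m|k s|] /=.
  + exact: coord_continuous.
  + apply: (@continuous_comp _ _ _ (fun v : V => v 0 i0) (derive1n m (fx k))).
      exact: coord_continuous.
    apply: differentiable_continuous; apply/derivable1_diffP.
    exact: (@fx_smooth k m _ (UJ Uu)).
  + by apply: smooth_continuous Uu; exact: smooth_partials.
  + have c0 : {for u, continuous (fj 0)}.
      by apply: smooth_continuous Uu; exact: fj_smooth.
    exact: cvgV (fj0_neq0 Uu) c0.
- exact: (cvgD IH1 IH2).
- exact: (cvgM IH1 IH2).
Qed.

Lemma partial_deval e i u : U u -> partial i (deval e) u = deval (dD i e) u.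
Proof. by move=> Uu; rewrite /partial (@derive_val _ _ _ _ _ _ _ (is_derive_deval e i Uu)). Qed.

(** Values of terms are continuous and have values of terms as partials, which is the closure
    property asked for by [smooth_coind]. *)
Lemma deval_smooth e : smooth_on U (deval e).
Proof.
apply: (@smooth_coind R n U (fun f => exists e, f = deval e)) => //.
- by move=> _ [{}e ->] u Uu; exact: deval_continuous.
- move=> _ i [{}e ->]; split.
    by move=> u Uu; case: (is_derive_deval e i Uu).
  exists (deval (dD i e)); first by exists (dD i e).
  by move=> u Uu; exact: partial_deval.
- by exists e.
Qed.

Lemma partials_deval s f e u : U u -> (forall v, U v -> f v = deval e v) ->
  partials s f u = deval (dDs i0 s e) u.
Proof.
move=> Uu fe; elim: s u Uu => [|i s IHs] u Uu /=; first exact: fe.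
by rewrite -partial_deval// (eq_partial i oU Uu IHs).
Qed.

Lemma deval_jsubst S e u : (forall k v, U v -> fj k v = deval (S k) v) -> U u ->
  deval (jsubst i0 S e) u = deval e u.
Proof.
move=> fS Uu; elim: e => [c|[j|k m|k s|]|e1 IH1 e2 IH2|e1 IH1 e2 IH2] //=.
- by rewrite (partials_deval s Uu (fS k)).
- by rewrite IH1 IH2.
- by rewrite IH1 IH2.
Qed.

Definition holds e := forall u, U u -> deval e u = 0.

Lemma holds_dDs s e : holds e -> holds (dDs i0 s e).
Proof.
move=> He; elim: s => // i s IHs u Uu /=.
rewrite -partial_deval// (eq_partial i oU Uu IHs) /partial.
exact: derive_cst.
Qed.

Definition holds_all (eqs : seq (dterm n)) : Prop :=
  foldr (fun e P => holds e /\ P) True eqs.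

Lemma holds_nth eqs k : holds_all eqs -> holds (nth (Cst qz) eqs k).
Proof.
(* An index beyond the list selects the default [Cst qz], which evaluates to 0. *)
elim: eqs k => [|e eqs IHe] [|k] /=; do ?by move=> _ u _ /=; rewrite qRz.
  by case.
by case=> _ /IHe.
Qed.

Lemma holds_rcons eqs t : holds_all eqs -> holds t -> holds_all (rcons eqs t).
Proof. by move=> + Ht; elim: eqs => [|e eqs IHe] //= [He /IHe]. Qed.

Lemma holds_lincomb eqs c : holds_all eqs -> holds (lincomb i0 eqs c).
Proof.
move=> He; elim: c => [|[[[q m] s] k] c IHc] u Uu /=; first by rewrite qRz.
by rewrite IHc// (holds_dDs s (holds_nth k He))// mulr0 addr0.
Qed.

Lemma holds_derivation eqs steps : holds_all eqs -> derivation i0 eqs steps ->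
  holds_all (map fst steps).
Proof.
elim: steps eqs => [|[t c] steps IHs] eqs He //= /andP[tc st].
have Ht : holds t.
  by move=> u Uu; rewrite (deval_eq i0 fx fj tc) (holds_lincomb c He).
by split=> //; apply: IHs st; exact: holds_rcons.
Qed.

End Soundness.

(** * Linear differential equations on an open interval *)

Section IntervalCalculus.
Variables (R : realType) (J : set R).
Hypotheses (oJ : open J) (iJ : is_interval J).
Implicit Types (f g : R -> R) (x y z c d : R).

Lemma itv_sub c d x : J c -> J d -> c <= x <= d -> J x.
Proof. by move=> Jc Jd; apply: iJ. Qed.

Lemma lt_point x : J x -> exists2 c, J c & c < x.
Proof.
move=> Jx; have /nbhs_ballP[e /= e0 Be] := open_nbhs_nbhs (conj oJ Jx).
exists (x - e / 2); last by rewrite ltrBlDr ltrDl divr_gt0.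
by apply: Be; rewrite /ball/= opprB addrC subrK gtr0_norm ?divr_gt0// ltr_pdivrMr// ltr_pMr// ltr1n.
Qed.

Lemma gt_point x : J x -> exists2 c, J c & x < c.
Proof.
move=> Jx; have /nbhs_ballP[e /= e0 Be] := open_nbhs_nbhs (conj oJ Jx).
exists (x + e / 2); last by rewrite ltrDl divr_gt0.
apply: Be; rewrite /ball/= opprD addrA subrr add0r normrN gtr0_norm ?divr_gt0//.
by rewrite ltr_pdivrMr// ltr_pMr// ltr1n.
Qed.

Lemma derive_continuous f g x : is_derive x 1 f (g x) -> {for x, continuous f}.
Proof.
by case=> df _; apply: differentiable_continuous; apply/derivable1_diffP.
Qed.

Lemma mvt_le f g x y : (forall z, J z -> is_derive z 1 f (g z)) ->
  J x -> J y -> x <= y -> exists2 z, x <= z <= y & f y - f x = g z * (y - x).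
Proof.
move=> fg Jx Jy xy.
have fg' z : z \in `[x, y]%R -> is_derive z 1 f (g z).
  by rewrite in_itv => zxy; apply: fg; exact: itv_sub zxy.
have cf : {within `[x, y], continuous f}.
  by apply: derivable_within_continuous => z /fg'[].
have [z + E] := MVT_segment xy (fun z zxy => fg' z (subset_itv_oo_cc zxy)) cf.
by rewrite in_itv => zxy; exists z.
Qed.

Lemma derive0_cst f x y : (forall z, J z -> is_derive z 1 f 0) ->
  J x -> J y -> f x = f y.
Proof.
move=> f0; wlog xy : x y / x <= y.
  by move=> H Jx Jy; case: (leP x y) => [/H->//|/ltW/H->].
move=> Jx Jy; have [z _] := mvt_le (g := cst 0) f0 Jx Jy xy.
by rewrite mul0r => /eqP; rewrite subr_eq0 => /eqP.
Qed.

Lemma within_itv_continuous f c d : (forall x, J x -> {for x, continuous f}) ->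
  J c -> J d -> {within `[c, d], continuous f}.
Proof.
move=> cf Jc Jd; apply: continuous_in_subspaceT => x; rewrite inE/= in_itv/= => xcd.
by apply: cf; exact: itv_sub xcd.
Qed.

Lemma itv_bounded f c d : (forall x, J x -> {for x, continuous f}) ->
  J c -> J d -> c <= d -> exists2 M : R, 0 <= M & forall x, c <= x <= d -> `|f x| <= M.
Proof.
move=> cf Jc Jd cd; have fc := within_itv_continuous cf Jc Jd.
have [m mcd Hm] := EVT_min cd fc; have [M Mcd HM] := EVT_max cd fc.
exists (`|f m| + `|f M|); first by rewrite addr_ge0.
move=> x xcd; have xin : x \in `[c, d]%R by rewrite in_itv.
have := Hm _ xin; have := HM _ xin; rewrite ler_norml => h1 h2; apply/andP; split.
  by rewrite opprD lerBlDr (le_trans _ (ler_wpDr _ h2))// lerNl (le_trans (ler_norm _))// normrN.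
by rewrite (le_trans h1)// ler_wpDl// ler_norm.
Qed.

Section Antiderivative.
Variable x0 : R.
Hypothesis Jx0 : J x0.
Local Notation mu := (@lebesgue_measure R).

(** The oriented integral of [f] from [x0] to [x]. *)
Definition primitive f x : R :=
  if x0 <= x then \int[mu]_(t in `]x0, x]) f t else - \int[mu]_(t in `]x, x0]) f t.

Lemma primitive0 f : primitive f x0 = 0.
Proof. by rewrite /primitive lexx set_itvoc0 Rintegral_set0. Qed.

(** With a base point [c] to the left of both [x] and [x0], the two branches of [primitive] become
    the single formula [G t - G x0]. The fundamental theorem of calculus for [G] then also covers
    [x = x0], where the branches meet. *)
Lemma is_derive_primitive f x : (forall y, J y -> {for y, continuous f}) -> J x ->
  is_derive x 1 (primitive f) (f x).
Proof.
move=> cf Jx.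
have [c Jc] : exists2 c, J c & c < Num.min x x0.
  by apply: lt_point; rewrite /Num.min; case: ifP.
rewrite lt_min => /andP[cx cx0].
have [d Jd] : exists2 d, J d & Num.max x x0 < d.
  by apply: gt_point; rewrite /Num.max; case: ifP.
rewrite gt_max => /andP[xd x0d].
have icd y : J y -> mu.-integrable `[c, y] (EFin \o f).
  move=> Jy; apply: continuous_compact_integrable; first exact: segment_compact.
  exact: within_itv_continuous.
pose G t := \int[mu]_(s in `[c, t]) f s.
have FG t : c < t < d -> primitive f t = G t - G x0.
  move=> /andP[ct td]; have Jt : J t by apply: (itv_sub Jc Jd); rewrite !ltW.
  rewrite /primitive; case: ifPn => [x0t|].
    by rewrite /G Rintegral_itvB ?bnd_simp//; [exact: icd|exact: ltW].
  rewrite -ltNge => tx0.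
  by rewrite /G -opprB Rintegral_itvB ?bnd_simp//; [exact: icd|exact: ltW|exact: ltW].
have [dG G'] := continuous_FTC1_closed xd (icd _ Jd) cx (cf _ Jx).
have dGc : is_derive x 1 (fun t => G t - G x0) (f x).
  have H : is_derive x 1 G (f x) by split; [exact: dG | rewrite -derive1E; exact: G'].
  by apply: is_derive_eq (is_deriveB H (is_derive_cst (G x0) x 1)) _; rewrite subr0.
apply: near_eq_is_derive dGc.
near=> t; rewrite FG//; apply/andP; split; near: t.
  exact: lt_nbhsr.
exact: lt_nbhsl.
Unshelve. all: by end_near. Qed.

End Antiderivative.

End IntervalCalculus.

(** * Geometric estimates for series *)

Section HalvingBounds.
Variable R : realType.

Lemma cvg_halves (C : R) : (fun k => C / 2 ^+ k) @ \oo --> (0 : R).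
Proof.
have -> : (fun k => C / 2 ^+ k) = geometric C 2^-1.
  by apply/funext => k; rewrite /geometric/= exprVn.
by apply: cvg_geometric; rewrite ger0_norm// invf_lt1// ltr1n.
Qed.

Lemma le0_halves (a C : R) : (forall k, a <= C / 2 ^+ k) -> a <= 0.
Proof.
by move=> aC; apply: (cvgr_to_ge (cvg_halves C)); near=> k; exact: aC.
Unshelve. all: by end_near. Qed.

(** The bound is the geometric tail in telescoped form: [C / 2 ^+ l] is the difference of
    [2 * C / 2 ^+ l] and [2 * C / 2 ^+ l.+1], so each induction step only shifts the last term. *)
Lemma halves_partial (a : nat -> R) (C : R) : (forall k, `|a k| <= C / 2 ^+ k) ->
  forall k m, `|series a (k + m)%N - series a k| <= 2 * C / 2 ^+ k - 2 * C / 2 ^+ (k + m).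
Proof.
move=> aC k; elim=> [|m IHm]; first by rewrite addn0 !subrr normr0.
rewrite addnS /series/= big_nat_recr//= addrAC.
apply: le_trans (ler_normD _ _) _.
apply: le_trans (lerD IHm (aC _)) _.
have -> : C / 2 ^+ (k + m) = 2 * C / 2 ^+ (k + m) - 2 * C / 2 ^+ (k + m).+1.
  by rewrite exprS; field; rewrite expf_neq0.
by rewrite addrA subrK.
Qed.

Lemma halves_lim (a : nat -> R) (C : R) : (forall k, `|a k| <= C / 2 ^+ k) ->
  forall k, `|limn (series a) - series a k| <= 2 * C / 2 ^+ k.
Proof.
move=> aC k.
have C0 : 0 <= C by have := aC 0%N; rewrite expr0 divr1; exact: le_trans.
have ca : cvgn (series a).
  apply: normed_cvg; apply: (@series_le_cvg _ _ (geometric C 2^-1)).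
  - by move=> l /=; exact: normr_ge0.
  - by move=> l; rewrite /geometric/= mulr_ge0// exprn_ge0.
  - by move=> l; rewrite /geometric/= exprVn.
  - by apply: is_cvg_geometric_series; rewrite ger0_norm// invf_lt1// ltr1n.
have cd : (fun m => `|series a (m + k)%N - series a k|) @ \oo --> `|limn (series a) - series a k|.
  by apply: cvg_norm; apply: cvgB; [rewrite cvg_shiftn | exact: cvg_cst].
apply: (cvgr_to_le cd); near=> m; rewrite addnC.
apply: le_trans (halves_partial aC k m) _.
by rewrite gerBl divr_ge0 ?mulr_ge0 ?exprn_ge0.
Unshelve. all: by end_near. Qed.

End HalvingBounds.

(** * Existence and uniqueness for linear systems *)

Section LinearODE.
Variables (R : realType) (J : set R).
Hypotheses (oJ : open J) (iJ : is_interval J).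
Variables (n : nat) (A : 'I_n -> 'I_n -> R -> R) (x0 : R).
Hypotheses (cA : forall i j x, J x -> {for x, continuous (A i j)}) (Jx0 : J x0).

Implicit Types (x y z : R).

Definition lin (Y : 'I_n -> R -> R) (i : 'I_n) (x : R) := \sum_(j < n) A i j x * Y j x.

Definition ode_solution (Y : 'I_n -> R -> R) : Prop :=
  forall i x, J x -> is_derive x 1 (Y i) (lin Y i x).

Section Weight.
Variable m : R.
Hypothesis m0 : 0 < m.

(* The exponential weight makes the Picard operator a contraction with factor
   1/2 on a whole compact interval, on both sides of x0. *)
Definition weight x := expR (m * (x - x0)) + expR (- (m * (x - x0))).
Definition weight_int x := m^-1 * (expR (m * (x - x0)) - expR (- (m * (x - x0)))).

Lemma weight_ge1 x : 1 <= weight x.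
Proof.
rewrite /weight; have [h|h] := leP 0 (m * (x - x0)).
  by rewrite ler_wpDr ?expR_ge0// (le_trans _ (expR_ge1Dx _))// lerDl.
by rewrite ler_wpDl ?expR_ge0// (le_trans _ (expR_ge1Dx _))// lerDl oppr_ge0 ltW.
Qed.

Lemma is_derive_expR_affine (k x : R) :
  is_derive x 1 (fun y : R => expR (k * (y - x0))) (expR (k * (x - x0)) * k).
Proof.
have dh : is_derive x 1 (fun y : R => k * (y - x0)) k.
  have := is_deriveZ k (is_deriveB (@is_derive_id R R x 1) (@is_derive_cst R R R x0 x 1)).
  by rewrite subr0 [_ *: 1]mulr1.
exact: (@is_derive1_comp _ expR _ x _ _ (is_derive_expR (k * (x - x0))) dh).
Qed.

Lemma weight_continuous x : {for x, continuous weight}.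
Proof.
have E : weight = (fun y => expR (m * (y - x0))) + (fun y => expR (- m * (y - x0))).
  by apply/funext => y; rewrite /weight -mulNr.
rewrite E; have H := is_deriveD (is_derive_expR_affine m x) (is_derive_expR_affine (- m) x).
exact: (derive_continuous (g := cst _) H).
Qed.

Lemma is_derive_weight_int (x : R) : is_derive x 1 weight_int (weight x).
Proof.
have E : weight_int = m^-1 *: ((fun y => expR (m * (y - x0))) - (fun y => expR (- m * (y - x0)))).
  by apply/funext => y; rewrite /weight_int -mulNr.
rewrite E; have H := is_deriveB (is_derive_expR_affine m x) (is_derive_expR_affine (- m) x).
apply: (is_derive_eq (is_deriveZ m^-1 H)); rewrite /weight mulrN opprK -mulrDl mulNr.
by rewrite [_ *: _]mulrC mulfK// gt_eqF.
Qed.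

Lemma weight_int0 : weight_int x0 = 0.
Proof. by rewrite /weight_int subrr mulr0 oppr0 subrr mulr0. Qed.

Lemma weight_int_le x : `|weight_int x| <= m^-1 * weight x.
Proof.
rewrite /weight_int normrM gtr0_norm ?invr_gt0// ler_pM2l ?invr_gt0//.
by rewrite (le_trans (ler_normB _ _))// !ger0_norm ?expR_ge0.
Qed.

(** Comparison of [f] with [B * weight_int]: the derivatives of [B * weight_int - f] and
    [B * weight_int + f] are nonnegative and both functions vanish at [x0]. Hence [f] is bounded by
    [B] times the absolute value of [weight_int], on either side of [x0], and [weight_int_le]
    supplies the gain [1 / m]. *)
Lemma weight_bound (f g : R -> R) (B c d : R) : 0 <= B -> J c -> J d -> c <= x0 <= d ->
  (forall x, J x -> is_derive x 1 f (g x)) -> f x0 = 0 ->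
  (forall x, c <= x <= d -> `|g x| <= B * weight x) ->
  forall x, c <= x <= d -> `|f x| <= B / m * weight x.
Proof.
move=> B0 Jc Jd /andP[cx0 x0d] fg f0 gB x /andP[cx xd].
have Jx : J x by apply: (itv_sub iJ Jc Jd); rewrite cx.
have dBW y : is_derive y 1 (fun z => B * weight_int z) (B * weight y).
  exact: is_deriveZ (is_derive_weight_int y).
suff H : `|f x| <= B * `|weight_int x|.
  by apply: le_trans H _; rewrite -mulrA ler_wpM2l// weight_int_le.
have dm y : J y -> is_derive y 1 (fun z => B * weight_int z - f z) (B * weight y - g y).
  by move=> Jy; apply: is_deriveB (dBW y) (fg _ Jy).
have dp y : J y -> is_derive y 1 (fun z => B * weight_int z + f z) (B * weight y + g y).
  by move=> Jy; apply: is_deriveD (dBW y) (fg _ Jy).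
have [x0x|/ltW xx0] := leP x0 x.
- have [y /andP[h1 h2] E1] := mvt_le iJ dm Jx0 Jx x0x.
  have [z /andP[h3 h4] E2] := mvt_le iJ dp Jx0 Jx x0x.
  have yB : `|g y| <= B * weight y by apply: gB; rewrite (le_trans cx0)// (le_trans _ xd).
  have zB : `|g z| <= B * weight z by apply: gB; rewrite (le_trans cx0)// (le_trans _ xd).
  move: yB zB E1 E2; rewrite !ler_norml weight_int0 f0 mulr0 !(subr0, addr0).
  move=> /andP[y1 y2] /andP[z1 z2] E1 E2.
  have F1 : 0 <= B * weight_int x - f x by rewrite E1 mulr_ge0 ?subr_ge0.
  have F2 : 0 <= B * weight_int x + f x.
    by rewrite E2 mulr_ge0 ?subr_ge0// addrC -lerBlDr sub0r.
  have F3 : B * weight_int x <= B * `|weight_int x| by rewrite ler_wpM2l// ler_norm.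
  by apply/andP; split; lra.
- have [y /andP[h1 h2] E1] := mvt_le iJ dm Jx Jx0 xx0.
  have [z /andP[h3 h4] E2] := mvt_le iJ dp Jx Jx0 xx0.
  have yB : `|g y| <= B * weight y by apply: gB; rewrite (le_trans cx)// (le_trans h2).
  have zB : `|g z| <= B * weight z by apply: gB; rewrite (le_trans cx)// (le_trans h4).
  move: yB zB E1 E2; rewrite !ler_norml weight_int0 f0 mulr0 !(subr0, addr0, sub0r).
  move=> /andP[y1 y2] /andP[z1 z2] E1 E2.
  have F1 : 0 <= - (B * weight_int x - f x) by rewrite E1 mulr_ge0 ?subr_ge0.
  have F2 : 0 <= - (B * weight_int x + f x).
    by rewrite E2 mulr_ge0 ?subr_ge0// addrC -lerBlDr sub0r.
  have F3 : B * - weight_int x <= B * `|weight_int x| by rewrite ler_wpM2l// -normrN ler_norm.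
  by apply/andP; split; lra.
Qed.

End Weight.

Lemma ode_solution_continuous Y i x : ode_solution Y -> J x -> {for x, continuous (Y i)}.
Proof. by move=> sY Jx; exact: derive_continuous (sY i x Jx). Qed.

Lemma lin_continuous Y i x : (forall j, {for x, continuous (Y j)}) -> J x ->
  {for x, continuous (lin Y i)}.
Proof.
move=> cY Jx.
have -> : lin Y i = \sum_(j < n) (fun y => A i j y * Y j y).
  by apply/funext => y; rewrite fct_sumE.
elim/big_ind: _ => [|f g cf cg|j _].
- exact: cst_continuous.
- exact: (cvgD cf cg).
- exact: (cvgM (@cA i j x Jx) (cY j)).
Qed.

Lemma matrix_bound c d : J c -> J d -> c <= d ->
  exists2 M : R, 0 < M & forall Y i x, c <= x <= d -> forall B : R, (forall j, `|Y j x| <= B) ->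
     `|lin Y i x| <= M * B.
Proof.
move=> Jc Jd cd.
have /choice[b Hb] : forall ij : 'I_n * 'I_n, exists M,
    0 <= M /\ forall x, c <= x <= d -> `|A ij.1 ij.2 x| <= M.
  by move=> [i j]; have [M M0 HM] := itv_bounded iJ (@cA i j) Jc Jd cd; exists M.
pose M := 1 + \sum_(ij : 'I_n * 'I_n) b ij.
have b0 ij : 0 <= b ij by case: (Hb ij).
(* [M *+ n] bounds the sum of [n] terms; the additional [M] keeps the constant positive for
   [n = 0]. *)
exists (M + M *+ n); first by rewrite ltr_pwDl ?mulrn_wge0// /M ?addr_ge0 ?sumr_ge0// ltr_pwDl// sumr_ge0.
move=> Y i x xcd B YB.
have bM j : `|A i j x| <= M.
  have [_ H] := Hb (i, j); apply: le_trans (H _ xcd) _.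
  rewrite /M (bigD1 (i, j))//= addrCA lerDl addr_ge0//.
  exact: sumr_ge0.
have M0 : 0 <= M by rewrite addr_ge0// sumr_ge0.
have step : `|lin Y i x| <= \sum_(j < n) M * B.
  rewrite /lin (le_trans (ler_norm_sum _ _ _))//; apply: ler_sum => j _.
  by rewrite normrM ler_pM.
apply: le_trans step _; rewrite sumr_const card_ord [(M + _) * B]mulrDl mulrnAl lerDr mulr_ge0//.
by apply: le_trans (YB i).
Qed.

(** With the rate [m = 2 * M], inserting a bound [B * weight] into the equation returns it with the
    factor [M / (2 * M)], one half. The bound can thus be halved indefinitely; it holds initially
    because [weight] is at least 1. *)
Lemma ode_unique Y : ode_solution Y -> (forall i, Y i x0 = 0) ->
  forall i x, J x -> Y i x = 0.
Proof.
move=> sY Y0 i x Jx.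
pose c := Num.min x x0; pose d := Num.max x x0.
have Jc : J c by rewrite /c /Num.min; case: ifP.
have Jd : J d by rewrite /d /Num.max; case: ifP.
have cx0d : c <= x0 <= d by rewrite ge_min le_max lexx !orbT.
have cxd : c <= x <= d by rewrite ge_min le_max lexx.
have cd : c <= d by case/andP: cxd => /le_trans; apply.
have [M M0 HM] := matrix_bound Jc Jd cd.
have /choice[b Hb] : forall j, exists M, 0 <= M /\ forall x, c <= x <= d -> `|Y j x| <= M.
  move=> j; have [B B0 HB] := itv_bounded iJ (fun x => @ode_solution_continuous Y j x sY) Jc Jd cd.
  by exists B.
pose B := \sum_j b j.
have b0 j : 0 <= b j by case: (Hb j).
have B0 : 0 <= B by rewrite sumr_ge0.
have m0 : 0 < 2 * M by rewrite mulr_gt0.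
have key k : forall j y, c <= y <= d -> `|Y j y| <= B / 2 ^+ k * weight (2 * M) y.
  elim: k => [|k IHk] j y ycd.
    rewrite expr0 divr1; apply: le_trans (ler_peMr B0 (weight_ge1 _ _)).
    have [_ H] := Hb j; apply: le_trans (H _ ycd) _.
    by rewrite /B (bigD1 j)//= lerDl sumr_ge0.
  have E : B / 2 ^+ k.+1 = M * (B / 2 ^+ k) / (2 * M).
    by rewrite exprS; field; rewrite expf_neq0 ?gt_eqF.
  rewrite E; apply: (weight_bound m0 _ Jc Jd cx0d (sY j) (Y0 j)) => //.
    by rewrite mulr_ge0 ?divr_ge0 ?exprn_ge0// ltW.
  move=> z zcd; rewrite -mulrA; apply: HM => // l; exact: IHk.
apply/eqP; rewrite -normr_le0; apply: (@le0_halves _ _ (B * weight (2 * M) x)) => k.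
by rewrite mulrAC; exact: key.
Qed.

Section Existence.
Variable v : 'I_n -> R.

(** The increments of Picard's iteration: the k-fold integral operator applied to the constant [v].
    The iterates themselves are the partial sums, so convergence becomes summability of these
    terms. *)
Fixpoint picard_term (k : nat) (i : 'I_n) : R -> R :=
  if k is k'.+1 then primitive x0 (lin (picard_term k') i) else cst (v i).

Lemma picard_term_continuous k i x : J x -> {for x, continuous (picard_term k i)}.
Proof.
elim: k i x => [|k IHk] i x Jx; first exact: cst_continuous.
apply: (@derive_continuous _ _ (lin (picard_term k) i)).
apply: (is_derive_primitive oJ iJ Jx0 _ Jx) => y Jy.
by apply: lin_continuous => // j; exact: IHk.
Qed.

Lemma is_derive_picard_term k i x : J x ->
  is_derive x 1 (picard_term k.+1 i) (lin (picard_term k) i x).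
Proof.
move=> Jx; apply: (is_derive_primitive oJ iJ Jx0 _ Jx) => y Jy.
by apply: lin_continuous => // j; exact: picard_term_continuous.
Qed.

(** The halving of [ode_unique] again, now from one term to the next; the weight is finally absorbed
    into [C] by its bound on the compact interval. *)
Lemma picard_term_bound c d : J c -> J d -> c <= x0 <= d ->
  exists C : R, forall k i x, c <= x <= d -> `|picard_term k i x| <= C / 2 ^+ k.
Proof.
move=> Jc Jd cx0d.
have cd : c <= d by case/andP: cx0d => /le_trans; apply.
have [M M0 HM] := matrix_bound Jc Jd cd.
have m0 : 0 < 2 * M by rewrite mulr_gt0.
pose B := \sum_j `|v j|.
have B0 : 0 <= B by rewrite sumr_ge0.
have key k : forall j y, c <= y <= d -> `|picard_term k j y| <= B / 2 ^+ k * weight (2 * M) y.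
  elim: k => [|k IHk] j y ycd.
    rewrite expr0 divr1; apply: le_trans (ler_peMr B0 (weight_ge1 _ _)).
    by rewrite /B (bigD1 j)//= lerDl sumr_ge0.
  have E : B / 2 ^+ k.+1 = M * (B / 2 ^+ k) / (2 * M).
    by rewrite exprS; field; rewrite expf_neq0 ?gt_eqF.
  rewrite E; apply: (weight_bound m0 _ Jc Jd cx0d (is_derive_picard_term k j) (primitive0 x0 _)) => //.
    by rewrite mulr_ge0 ?divr_ge0 ?exprn_ge0// ltW.
  by move=> z zcd; rewrite -mulrA; apply: HM => // l; exact: IHk.
have cw x : J x -> {for x, continuous (weight (2 * M))} by move=> _; exact: weight_continuous.
have [W W0 HW] := itv_bounded iJ cw Jc Jd cd.
exists (B * W) => k i x xcd; apply: le_trans (key k i x xcd) _.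
by rewrite mulrAC ler_wpM2r ?invr_ge0 ?exprn_ge0// ler_wpM2l// (le_trans (ler_norm _))// HW.
Qed.

Definition picard_sol (i : 'I_n) (x : R) : R := limn (series (fun k => picard_term k i x)).

Lemma picard_sol_approx c d : J c -> J d -> c <= x0 <= d ->
  exists C : R, forall k i x, c <= x <= d ->
    `|picard_sol i x - series (fun k => picard_term k i x) k| <= C / 2 ^+ k.
Proof.
move=> Jc Jd cx0d; have [C HC] := picard_term_bound Jc Jd cx0d.
by exists (2 * C) => k i x xcd; apply: halves_lim => l; exact: HC.
Qed.

Lemma around x : J x -> exists c d, [/\ J c, J d, c < x < d & c < x0 < d].
Proof.
move=> Jx.
have [c Jc] : exists2 c, J c & c < Num.min x x0.
  by apply: lt_point => //; rewrite /Num.min; case: ifP.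
rewrite lt_min => /andP[cx cx0].
have [d Jd] : exists2 d, J d & Num.max x x0 < d.
  by apply: gt_point => //; rewrite /Num.max; case: ifP.
by rewrite gt_max => /andP[xd x0d]; exists c, d; rewrite cx cx0.
Qed.

Lemma picard_series_continuous k i x : J x ->
  {for x, continuous (fun y => series (fun l => picard_term l i y) k)}.
Proof.
move=> Jx; elim: k => [|k IHk].
  rewrite (_ : (fun y => _) = cst 0); first exact: cst_continuous.
  by apply/funext => y; rewrite /series/= big_geq.
rewrite (_ : (fun y => _) = (fun y => series (fun l => picard_term l i y) k) + picard_term k i).
  exact: (cvgD IHk (@picard_term_continuous k i x Jx)).
by apply/funext => y; rewrite /series/= big_nat_recr.
Qed.

(** Uniform limit of continuous functions on a neighbourhood of [x], by the usual argument with
    [e / 3]. *)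
Lemma picard_sol_continuous i x : J x -> {for x, continuous (picard_sol i)}.
Proof.
move=> Jx; have [c [d [Jc Jd /andP[cx xd] /andP[cx0 x0d]]]] := around Jx.
have [|C HC] := picard_sol_approx Jc Jd; first by rewrite !ltW.
apply/cvgrPdist_lt => e e0.
have e3 : 0 < e / 3 by rewrite divr_gt0.
have [k kC] : exists k, C / 2 ^+ k < e / 3.
  have /cvgrPdist_lt/(_ _ e3)[k _ Hk] := cvg_halves C.
  by exists k; have := Hk k (leqnn k); rewrite /= sub0r normrN; apply: le_lt_trans; exact: ler_norm.
have /cvgrPdist_lt/(_ _ e3) Hs := @picard_series_continuous k i x Jx.
near=> t.
have tcd : c <= t <= d.
  by apply/andP; split; apply: ltW; near: t; [exact: lt_nbhsr | exact: lt_nbhsl].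
have xcd : c <= x <= d by rewrite !ltW.
have h1 : `|series (fun l => picard_term l i x) k - series (fun l => picard_term l i t) k| < e / 3.
  by near: t.
have h2 := HC k i x xcd; have h3 := HC k i t tcd.
rewrite (_ : picard_sol i x - picard_sol i t =
  (picard_sol i x - series (fun l => picard_term l i x) k) +
  (series (fun l => picard_term l i x) k - series (fun l => picard_term l i t) k) -
  (picard_sol i t - series (fun l => picard_term l i t) k)); last by ring.
apply: le_lt_trans (ler_normB _ _) _.
have h4 := ler_normD (picard_sol i x - series (fun l => picard_term l i x) k)
  (series (fun l => picard_term l i x) k - series (fun l => picard_term l i t) k).
lra.
Unshelve. all: by end_near. Qed.

Lemma is_derive_picard_series k i x : J x ->
  is_derive x 1 (fun y => series (fun l => picard_term l i y) k.+1)
    (lin (fun j y => series (fun l => picard_term l j y) k) i x).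
Proof.
move=> Jx; elim: k => [|k IHk].
  rewrite (_ : (fun y => _) = cst (v i)).
    rewrite (_ : lin _ _ _ = 0); first exact: is_derive_cst.
    by rewrite /lin big1// => j _; rewrite /series/= big_geq// mulr0.
  by apply/funext => y; rewrite /series/= big_nat1.
rewrite (_ : (fun y => _) = (fun y => series (fun l => picard_term l i y) k.+1) + picard_term k.+1 i).
  apply: (is_derive_eq (is_deriveD IHk (is_derive_picard_term k i Jx))).
  rewrite /lin -big_split/=; apply: eq_bigr => j _.
  by rewrite /series/= big_nat_recr//= mulrDr.
by apply/funext => y; rewrite /series/= big_nat_recr.
Qed.

(** Passing to the integral equation avoids differentiating the series. The difference between the
    right side and the partial sum [S k.+1] has derivative [lin] of [picard_sol - S k], which is of
    order [2 ^- k]; [weight_bound] transfers this order to the difference itself. *)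
Lemma picard_solE i x : J x -> picard_sol i x = v i + primitive x0 (lin picard_sol i) x.
Proof.
move=> Jx; have [c [d [Jc Jd /andP[cx xd] /andP[cx0 x0d]]]] := around Jx.
have cx0d : c <= x0 <= d by rewrite !ltW.
have xcd : c <= x <= d by rewrite !ltW.
have [C HC] := picard_sol_approx Jc Jd cx0d.
have [|M M0 HM] := matrix_bound Jc Jd; first by rewrite (le_trans (ltW cx) (ltW xd)).
pose S k j y := series (fun l => picard_term l j y) k.
have C0 k : 0 <= C / 2 ^+ k by apply: le_trans (HC k i x xcd).
have dP k y : J y -> is_derive y 1 (fun y => v i + primitive x0 (lin picard_sol i) y - S k.+1 i y)
    (lin (fun j z => picard_sol j z - S k j z) i y).
  move=> Jy; have d1 : is_derive y 1 (primitive x0 (lin picard_sol i)) (lin picard_sol i y).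
    apply: (is_derive_primitive oJ iJ Jx0 _ Jy) => z Jz.
    by apply: lin_continuous => // j; exact: picard_sol_continuous.
  apply: (is_derive_eq (is_deriveB (is_deriveD (is_derive_cst (v i : R) y 1) d1)
    (is_derive_picard_series k i Jy))).
  rewrite add0r /lin -sumrB; apply: eq_bigr => j _.
  by rewrite mulrBr.
have Sx0 k : S k.+1 i x0 = v i.
  elim: k => [|k IHk]; rewrite /S /series/=; first by rewrite big_nat1.
  by rewrite big_nat_recr//= -[X in X + _]/(S k.+1 i x0) IHk primitive0 addr0.
(* The rate 1 is enough: no contraction is sought here, the decay in [k] is already in the bound on
   the derivative. *)
have key k : `|v i + primitive x0 (lin picard_sol i) x - S k.+1 i x| <= M * (C / 2 ^+ k) / 1 * weight 1 x.
  apply: (weight_bound ltr01 _ Jc Jd cx0d (dP k)) => //.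
  - by rewrite mulr_ge0// ltW.
  - by rewrite primitive0 addr0 Sx0 subrr.
  move=> y ycd; apply: (@le_trans _ _ (M * (C / 2 ^+ k))).
    by apply: HM => // j; exact: HC.
  by rewrite ler_peMr ?weight_ge1// mulr_ge0// ltW.
apply/eqP; rewrite eq_sym -subr_eq0 -normr_le0.
apply: (@le0_halves _ _ (M * C * weight 1 x + C)) => k.
have h1 := key k; have h2 := HC k.+1 i x xcd.
rewrite (_ : v i + primitive x0 (lin picard_sol i) x - picard_sol i x =
  (v i + primitive x0 (lin picard_sol i) x - S k.+1 i x) - (picard_sol i x - S k.+1 i x)); last by ring.
apply: le_trans (ler_normB _ _) _; apply: le_trans (lerD h1 h2) _.
rewrite mulrDl; apply: lerD.
  by rewrite divr1 mulrA mulrAC.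
have := C0 k; have -> : C / 2 ^+ k.+1 = (C / 2 ^+ k) / 2.
  by rewrite exprS; field; rewrite expf_neq0.
by lra.
Qed.

Lemma picard_sol_solution : ode_solution picard_sol.
Proof.
move=> i x Jx.
have d1 : is_derive x 1 (primitive x0 (lin picard_sol i)) (lin picard_sol i x).
  apply: (is_derive_primitive oJ iJ Jx0 _ Jx) => z Jz.
  by apply: lin_continuous => // j; exact: picard_sol_continuous.
have d2 : is_derive x 1 (fun y => v i + primitive x0 (lin picard_sol i) y) (lin picard_sol i x).
  by apply: (is_derive_eq (is_deriveD (is_derive_cst (v i : R) x 1) d1)); rewrite add0r.
apply: near_eq_is_derive d2; near=> y; rewrite picard_solE//.
by near: y; apply: open_nbhs_nbhs.
Unshelve. all: by end_near. Qed.

Lemma picard_sol_init i : picard_sol i x0 = v i.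
Proof. by rewrite picard_solE// primitive0 addr0. Qed.

End Existence.

Definition fundamental (k : 'I_n) : 'I_n -> R -> R := picard_sol (fun i => (i == k)%:R).

Lemma ode_solution_sum d (k : 'I_d -> R) (Y : 'I_d -> 'I_n -> R -> R) :
  (forall i, ode_solution (Y i)) -> ode_solution (fun l x => \sum_i k i * Y i l x).
Proof.
move=> sY l x Jx.
have ds : is_derive x 1 (\sum_i (k i *: (Y i l : R -> R))) (\sum_i k i * lin (Y i) l x).
  by apply: is_derive_sum => i; apply: is_deriveZ; exact: sY.
have -> : (fun x => \sum_i k i * Y i l x) = \sum_i (k i *: (Y i l : R -> R)).
  by apply/funext => y; rewrite fct_sumE.
apply: (is_derive_eq ds); rewrite /lin.
under [in RHS]eq_bigr do rewrite mulr_sumr.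
rewrite exchange_big/=; apply: eq_bigr => i _.
by rewrite mulr_sumr; apply: eq_bigr => j _; rewrite mulrCA.
Qed.

Lemma ode_solution0 : ode_solution (fun _ _ => 0).
Proof.
move=> i x _; rewrite /lin big1 => [|j _]; last by rewrite mulr0.
exact: is_derive_cst.
Qed.

Lemma fundamental_init k i : fundamental k i x0 = (i == k)%:R.
Proof. exact: picard_sol_init. Qed.

(** Both sides solve the system and agree at [x0], so the values at [x0] are coordinates on the
    solution space. *)
Lemma ode_solution_span Y : ode_solution Y -> forall i x, J x ->
  Y i x = \sum_k Y k x0 * fundamental k i x.
Proof.
move=> sY i x Jx; apply/eqP; rewrite -subr_eq0; apply/eqP.
have sS := @ode_solution_sum n (fun k => Y k x0) fundamental
  (fun k => picard_sol_solution (fun i => (i == k)%:R)).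
apply: (@ode_unique (fun j y => Y j y - \sum_k Y k x0 * fundamental k j y)) => // [{Jx}j {}x Jx|j].
  apply: (is_derive_eq (is_deriveB (sY j x Jx) (sS j x Jx))).
  by rewrite /lin -sumrB; apply: eq_bigr => k _; rewrite mulrBr.
rewrite (bigD1 j)//= fundamental_init eqxx mulr1 big1 ?addr0 ?subrr// => k kj.
by rewrite fundamental_init eq_sym (negbTE kj) mulr0.
Qed.

End LinearODE.

(** * Smooth functions of one variable *)

Section Smooth1.
Variables (R : realType) (J : set R).
Hypothesis oJ : open J.
Implicit Types (f g : R -> R) (x : R) (k : nat).

(** Derivability [k] times on [J]. Sums and products can be handled by induction on this order,
    because the derivative of a product involves the factors and their derivatives with one order
    less. *)
Definition derivable_upto k f := forall j, (j < k)%N ->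
  forall x, J x -> derivable (derive1n j f) x 1.

Lemma near_J (f g : R -> R) x : (forall y, J y -> f y = g y) -> J x ->
  \forall y \near x, f y = g y.
Proof.
by move=> fg Jx; near=> y; apply: fg; near: y; exact: open_nbhs_nbhs.
Unshelve. all: by end_near. Qed.

Lemma eq_derive1n f g j x : (forall y, J y -> f y = g y) -> J x ->
  derive1n j f x = derive1n j g x.
Proof.
move=> fg; elim: j x => [|j IHj] x Jx; first exact: fg.
by rewrite !derive1nS !derive1E; apply: near_eq_derive; exact: near_J.
Qed.

Lemma upto_step f g k : (forall x, J x -> is_derive x 1 f (g x)) ->
  derivable_upto k g -> derivable_upto k.+1 f.
Proof.
move=> fg gk [_ x Jx|j jk x Jx]; first by case: (fg x Jx).
have E y : J y -> f^`()%classic y = g y.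
  by move=> Jy; rewrite derive1E; case: (fg y Jy).
rewrite derive1Sn; apply: near_eq_derivable (gk j jk x Jx).
apply: near_J => // y Jy; apply: eq_derive1n => // z Jz.
by rewrite E.
Qed.

Lemma upto_derive f k : derivable_upto k.+1 f -> derivable_upto k f^`()%classic.
Proof. by move=> fk j jk x Jx; rewrite -derive1Sn; exact: fk. Qed.

Lemma upto_is_derive f k x : derivable_upto k.+1 f -> J x ->
  is_derive x 1 f (f^`()%classic x).
Proof. by move=> fk Jx; split; [exact: (fk 0%N) | rewrite derive1E]. Qed.

Lemma upto_leq f k l : (l <= k)%N -> derivable_upto k f -> derivable_upto l f.
Proof. by move=> lk fk j jl; apply: fk; exact: leq_trans lk. Qed.

Lemma upto_add f g k : derivable_upto k f -> derivable_upto k g -> derivable_upto k (f + g).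
Proof.
elim: k f g => [|k IHk] f g fk gk; first by move=> j; rewrite ltn0.
apply: (@upto_step _ (f^`()%classic + g^`()%classic)).
  by move=> x Jx; exact: (is_deriveD (upto_is_derive fk Jx) (upto_is_derive gk Jx)).
by apply: IHk; [exact: (upto_derive fk) | exact: (upto_derive gk)].
Qed.

Lemma upto_mul f g k : derivable_upto k f -> derivable_upto k g -> derivable_upto k (f * g).
Proof.
elim: k f g => [|k IHk] f g fk gk; first by move=> j; rewrite ltn0.
apply: (@upto_step _ (f * g^`()%classic + g * f^`()%classic)).
  by move=> x Jx; exact: (is_deriveM (upto_is_derive fk Jx) (upto_is_derive gk Jx)).
apply: upto_add; apply: IHk.
- exact: upto_leq (leqnSn k) fk.
- exact: upto_derive gk.
- exact: upto_leq (leqnSn k) gk.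
- exact: upto_derive fk.
Qed.

Lemma smooth1_upto f : smooth1_on J f <-> forall k, derivable_upto k f.
Proof.
by split=> [sf k j _|sf k x]; [exact: sf | exact: (sf k.+1 k)].
Qed.

Lemma upto_cst (c : R) k : derivable_upto k (cst c).
Proof.
elim: k c => [|k IHk] c; first by move=> j; rewrite ltn0.
by apply: (@upto_step _ (cst 0)); exact: IHk.
Qed.

Lemma smooth1_cst (c : R) : smooth1_on J (cst c).
Proof. by apply/smooth1_upto; exact: upto_cst. Qed.

Lemma smooth1_add f g : smooth1_on J f -> smooth1_on J g -> smooth1_on J (f + g).
Proof. by move=> /smooth1_upto sf /smooth1_upto sg; apply/smooth1_upto => k; exact: upto_add. Qed.

Lemma smooth1_mul f g : smooth1_on J f -> smooth1_on J g -> smooth1_on J (f * g).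
Proof. by move=> /smooth1_upto sf /smooth1_upto sg; apply/smooth1_upto => k; exact: upto_mul. Qed.

Lemma smooth1_derive1n f k : smooth1_on J f -> smooth1_on J (derive1n k f).
Proof.
move=> sf j x Jx; have := sf (j + k)%N x Jx.
by rewrite /derive1n iterD.
Qed.

Lemma smooth1_is_derive f k x : smooth1_on J f -> J x ->
  is_derive x 1 (derive1n k f) (derive1n k.+1 f x).
Proof. by move=> sf Jx; split; [exact: sf | rewrite derive1nS derive1E]. Qed.

Lemma smooth1_continuous f x : smooth1_on J f -> J x -> {for x, continuous f}.
Proof.
by move=> sf Jx; exact: (derive_continuous (smooth1_is_derive 0 sf Jx)).
Qed.

(** Bootstrapping: if all components are [k] times derivable, so is the right side of the system,
    and the components gain one order. *)
Lemma ode_solution_smooth n (A : 'I_n -> 'I_n -> R -> R) Y :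
  (forall i j, smooth1_on J (A i j)) -> ode_solution J A Y ->
  forall i, smooth1_on J (Y i).
Proof.
move=> sA sY i; apply/smooth1_upto => k; elim: k i => [|k IHk] i; first by move=> j; rewrite ltn0.
apply: (upto_step (sY i)).
have -> : lin A Y i = \sum_j (A i j * Y j).
  by apply/funext => x; rewrite /lin fct_sumE.
elim/big_ind: _ => [|f g|j _]; first exact: upto_cst.
  exact: upto_add.
by apply: upto_mul (IHk j); have /smooth1_upto := sA i j; exact.
Qed.

End Smooth1.

(** * The metric and its Ricci tensor *)

Definition fq (a b : nat) : ratQ := mkQ (BinInt.Z.of_nat a) (BinPos.Pos.of_nat b).
Definition nq (a b : nat) : ratQ :=
  mkQ (BinInt.Z.opp (BinInt.Z.of_nat a)) (BinPos.Pos.of_nat b).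
Definition fr (a b : nat) : dterm 4 := Cst (fq a b).
Definition nf (a b : nat) : dterm 4 := Cst (nq a b).

Declare Scope dterm_scope.
Delimit Scope dterm_scope with DT.
Local Notation dterm5 := (dterm 4).
Notation "e1 + e2" := (Add e1 e2) : dterm_scope.
Notation "e1 * e2" := (Mul e1 e2) : dterm_scope.
Notation "- e" := (Mul (Cst qm1) e) : dterm_scope.
Notation "e1 - e2" := (Add e1 (Mul (Cst qm1) e2)) : dterm_scope.
Notation "\I^ m" := (At (Fx 0 m)) (at level 8, m at level 2) : dterm_scope.
Notation "\crd i" := (At (Crd i)) (at level 8, i at level 2) : dterm_scope.
Notation "\jet k s" := (At (Jet k s)) (at level 8, k at level 2, s at level 2) : dterm_scope.

Definition ords5 : seq 'I_5 := [:: ix; iy; ip; iq; iz].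
Definition dsum (F : 'I_5 -> dterm5) : dterm5 :=
  (F ix + (F iy + (F ip + (F iq + F iz))))%DT.

Lemma ord5_ind (P : 'I_5 -> Prop) : P ix -> P iy -> P ip -> P iq -> P iz -> forall i, P i.
Proof.
move=> Px Py Pp Pq Pz [[|[|[|[|[|//]]]]] lt];
  by rewrite (bool_irrelevance lt isT).
Qed.

Lemma mem_ords5 i : i \in ords5.
Proof. by elim/ord5_ind: i. Qed.

Lemma sum5 (V : nmodType) (F : 'I_5 -> V) :
  \sum_(k < 5) F k = F ix + (F iy + (F ip + (F iq + F iz))).
Proof.
rewrite !big_ord_recl big_ord0 addr0.
by do 4?[congr (_ + _)]; congr F; apply: val_inj.
Qed.

Definition check2 (P : 'I_5 -> 'I_5 -> bool) := all (fun i => all (P i) ords5) ords5.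

Lemma check2P P : check2 P -> forall i j, P i j.
Proof. by move=> /allP H i j; apply: (allP (H i _)); exact: mem_ords5. Qed.

Section MetricTerms.
Local Open Scope dterm_scope.
Local Notation y := (\crd iy).
Local Notation p := (\crd ip).
Local Notation q := (\crd iq).
Local Notation I := (\I^ 0%N).
Local Notation K := (fr 1 1 + I * I - \I^ 2%N).

(** The coframe multiplied out, with [- q] for the derivative of F in q. Note that [\I^ m] is the
    m-th derivative of I, whereas squares are written as products; [K] is the coefficient of
    [y ^+ 2] in F, up to the factor -1/2. *)
Definition g_term (i j : 'I_5) : dterm5 :=
  match nat_of_ord i, nat_of_ord j with
  | 0%N, 0%N => fr 2 1 * (I * (p * p)) - fr 1 2 * (q * q) - fr 3 2 * (K * (y * y))
  | 0%N, 1%N | 1%N, 0%N => - (fr 2 1 * (I * p))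
  | 0%N, 2%N | 2%N, 0%N => fr 1 2 * q
  | 0%N, 3%N | 3%N, 0%N => - (fr 3 2 * p)
  | 0%N, 4%N | 4%N, 0%N => nf 3 2
  | 1%N, 1%N => - (fr 3 1 * I)
  | 1%N, 3%N | 3%N, 1%N => fr 3 2
  | 2%N, 2%N => nf 2 1
  | _, _ => Cst qz
  end.

Definition ginv_term (i j : 'I_5) : dterm5 :=
  match nat_of_ord i, nat_of_ord j with
  | 0%N, 4%N | 4%N, 0%N => nf 2 3
  | 1%N, 3%N | 3%N, 1%N => fr 2 3
  | 1%N, 4%N | 4%N, 1%N => - (fr 2 3 * p)
  | 2%N, 2%N => nf 1 2
  | 2%N, 4%N | 4%N, 2%N => - (fr 1 6 * q)
  | 3%N, 3%N => fr 4 3 * I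
  | 3%N, 4%N | 4%N, 3%N => - (fr 20 9 * (I * p))
  | 4%N, 4%N => fr 20 9 * (I * (p * p)) + fr 1 6 * (q * q) + fr 2 3 * (K * (y * y))
  | _, _ => Cst qz
  end.

Definition F_term : dterm5 :=
  - (fr 1 2) * (q * q + fr 10 3 * I * (p * p) + K * (y * y)).

Definition christoffel_term (k i j : 'I_5) : dterm5 :=
  simp (fr 1 2 * dsum (fun l => ginv_term k l *
    (dD ix i (g_term j l) + dD ix j (g_term i l) - dD ix l (g_term i j)))).

Local Notation tau := (At Rcp).
Local Notation sigma := (\jet 0%N [::]).

(** The conformal change of the Levi-Civita connection: with f = log sigma, the symbols change by
    minus the sum of d_i f delta^k_j and d_j f delta^k_i, plus g_ij times the gradient of f. Here
    [tau] stands for the reciprocal of [sigma]. *)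
Definition rescaled_christoffel_term (k i j : 'I_5) : dterm5 :=
  christoffel_term k i j - tau * simp (dsum (fun l => ginv_term k l *
    (\jet 0%N [:: i] * g_term j l + \jet 0%N [:: j] * g_term i l - \jet 0%N [:: l] * g_term i j))).

(* Unlike [rescaled_christoffel_term], this follows the definition of the
   Christoffel symbols literally; the two differ by powers of
   [sigma * tau] = 1. *)
Definition rescaled_christoffel_def_term (k i j : 'I_5) : dterm5 :=
  let h a b := tau * tau * g_term a b in
  fr 1 2 * dsum (fun l => sigma * sigma * ginv_term k l *
    (dD ix i (h j l) + dD ix j (h i l) - dD ix l (h i j))).

Definition ricci_of (G : 'I_5 -> 'I_5 -> 'I_5 -> dterm5) (i j : 'I_5) : dterm5 :=
  dsum (fun k => dD ix k (G k i j) - dD ix j (G k i k))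
  + dsum (fun k => dsum (fun l => G k k l * G l i j - G k j l * G l i k)).

Definition hessian_term (m : nat) (i j : 'I_5) : dterm5 :=
  \jet m (jins i [:: j]) - dsum (fun k => christoffel_term k i j * \jet m [:: k]).

Definition ricci_term (i j : 'I_5) : dterm5 :=
  match nat_of_ord i, nat_of_ord j with 0%N, 0%N => - I | _, _ => Cst qz end.

(** Together with [rescaled_ricci_term] this is the classical law for the Ricci tensor of sigma^-2 g
    in dimension n, with n = 5: the factor of the Hessian is n - 2 = 3, that of the squared gradient
    is n - 1 = 4. *)
Definition conformal_trace_term : dterm5 :=
  dsum (fun i => dsum (fun j => ginv_term i j *
    (tau * hessian_term 0 i j - fr 4 1 * (tau * tau * (\jet 0%N [:: i] * \jet 0%N [:: j]))))).

Definition rescaled_ricci_term (i j : 'I_5) : dterm5 :=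
  ricci_term i j + fr 3 1 * (tau * hessian_term 0 i j) + conformal_trace_term * g_term i j.

Lemma ginv_term_check :
  check2 (fun i j => deq (dsum (fun k => g_term i k * ginv_term k j))
                         (Cst (if i == j then q1 else qz))).
Proof. by vm_compute. Qed.

Lemma rescaled_christoffel_check k :
  check2 (fun i j => deq (rescaled_christoffel_def_term k i j)
    (sigma * sigma * (tau * tau) * rescaled_christoffel_term k i j)).
Proof. by elim/ord5_ind: k; vm_compute. Qed.

Lemma rescaled_ricci_check :
  check2 (fun i j => deq (ricci_of rescaled_christoffel_term i j) (rescaled_ricci_term i j)).
Proof. by vm_compute. Qed.

End MetricTerms.

Lemma zR_of_nat (R : realType) (a : nat) : zR R (BinInt.Z.of_nat a) = a%:R.
Proof. by rewrite /zR -[BinInt.Z.of_nat a]/(Z_of_int a) Z_of_intK. Qed.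

Lemma zR_opp (R : realType) z : zR R (BinInt.Z.opp z) = - zR R z.
Proof. by rewrite /zR -[BinInt.Z.opp z]/(- z) !rmorphN. Qed.

Lemma zR_pos (R : realType) (b : nat) :
  zR R (BinNums.Zpos (BinPos.Pos.of_nat b.+1)) = b.+1%:R.
Proof. by rewrite -BinPos.Pos.of_nat_succ -zR_of_nat. Qed.

Lemma deval_fr (R : realType) fx fj (u : 'rV[R]_5) (a b : nat) :
  deval ix fx fj (fr a b.+1) u = a%:R / b.+1%:R.
Proof. by rewrite /= /qR [QArith_base.Qden _]/= [QArith_base.Qnum _]/= zR_of_nat zR_pos. Qed.

Lemma deval_nf (R : realType) fx fj (u : 'rV[R]_5) (a b : nat) :
  deval ix fx fj (nf a b.+1) u = - (a%:R / b.+1%:R).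
Proof.
by rewrite /= /qR [QArith_base.Qden _]/= [QArith_base.Qnum _]/= zR_opp zR_of_nat zR_pos mulNr.
Qed.

Lemma devalE (R : realType) fx fj (u : 'rV[R]_5) :
  (forall e1 e2, deval ix fx fj (Add e1 e2) u = deval ix fx fj e1 u + deval ix fx fj e2 u) *
  (forall e1 e2, deval ix fx fj (Mul e1 e2) u = deval ix fx fj e1 u * deval ix fx fj e2 u) *
  (forall i, deval ix fx fj (At (Crd i)) u = u 0 i) *
  (forall k m, deval ix fx fj (At (Fx k m)) u = derive1n m (fx k) (u 0 ix)) *
  (forall k s, deval ix fx fj (At (Jet k s)) u = partials s (fj k) u) *
  (deval ix fx fj (At Rcp) u = (fj 0 u)^-1) *
  (deval ix fx fj (Cst qz) u = 0) *
  (deval ix fx fj (Cst q1) u = 1) *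
  (deval ix fx fj (Cst qm1) u = -1).
Proof. by do 8?split => //=; rewrite ?qRz ?qR1 ?qRm1. Qed.

Section Symprod.
Variable R : realType.
Local Notation V := 'rV[R]_5.

Lemma symprodE (a b : V) i j : symprod a b i j = 2^-1 * (a 0 i * b 0 j + b 0 i * a 0 j).
Proof. by rewrite !mxE !big_ord1 !mxE. Qed.

End Symprod.

#[local] Arguments deval : simpl never.

(** * The geometric tensors as values of terms *)

Section Links.
Variables (R : realType) (I : R -> R) (J : set R) (U : set 'rV[R]_5).
Local Notation V := 'rV[R]_5.
Variables (fx : nat -> R -> R) (fj : nat -> V -> R).
Hypotheses (oU : open U) (UJ : forall u, U u -> J (u 0 ix)).
Hypothesis fx_smooth : forall k, smooth1_on J (fx k).
Hypothesis fj_smooth : forall k, smooth_on U (fj k).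
Hypothesis fj0_neq0 : forall u, U u -> fj 0 u != 0.
Hypothesis fx0 : fx 0 = I.
Local Notation deval := (deval ix fx fj).

Lemma F_of_term u : F_of I u = deval F_term u.
Proof.
rewrite /F_of /F_term !(devalE, deval_fr, deval_nf) fx0 /derive1n/=.
by field.
Qed.

Lemma partial_q_F_of u : U u -> partial iq (F_of I) u = - u 0 iq.
Proof.
move=> Uu; have -> : F_of I = deval F_term by apply/funext => v; exact: F_of_term.
rewrite (partial_deval oU UJ fx_smooth fj_smooth fj0_neq0)//.
have E : deq (dD ix iq F_term) (Mul (Cst qm1) (At (Crd iq))) by vm_compute.
by rewrite (deval_eq ix fx fj E u) !devalE mulN1r.
Qed.

Lemma g_of_term u i j : U u -> g_of I u i j = deval (g_term i j) u.
Proof.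
move=> Uu.
have o1 k : omega1 u 0 k = (k == iy)%:R - u 0 ip * (k == ix)%:R by rewrite !mxE !eqxx.
have o3 k : omega3 u 0 k = (k == ip)%:R - u 0 iq * (k == ix)%:R by rewrite !mxE !eqxx.
have o2 k : omega2 I u 0 k = (k == iz)%:R - F_of I u * (k == ix)%:R
    + u 0 iq * ((k == ip)%:R - u 0 iq * (k == ix)%:R).
  have -> : omega2 I u 0 k = dcoord R iz 0 k - F_of I u * dcoord R ix 0 k
      - partial iq (F_of I) u * omega3 u 0 k.
    by rewrite /omega2; move: (dcoord _ _) (dcoord _ _) (omega3 u) => A B C; rewrite !mxE.
  by rewrite o3 partial_q_F_of// !mxE !eqxx mulNr opprK.
have o4 k : omega4 u 0 k = (k == iq)%:R by rewrite !mxE eqxx.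
have o5 k : omega5 u 0 k = (k == ix)%:R by rewrite !mxE eqxx.
have E : g_of I u i j =
    (- 3 * I (u 0 ix)) * symprod (omega1 u) (omega1 u) i j
  + 3 * symprod (omega1 u) (omega4 u) i j
  - (10 * I (u 0 ix) * u 0 ip) * symprod (omega1 u) (omega5 u) i j
  - 3 * symprod (omega2 I u) (omega5 u) i j
  - 2 * symprod (omega3 u) (omega3 u) i j.
  rewrite /g_of; move: (symprod _ _) (symprod _ _) (symprod _ _) (symprod _ _) (symprod _ _) => A B C D E.
  by rewrite !mxE.
rewrite {}E !symprodE !o1 !o2 !o3 !o4 !o5 F_of_term /F_term.
elim/ord5_ind: i; elim/ord5_ind: j; rewrite /g_term /=.
all: rewrite ?(devalE, deval_fr, deval_nf) ?fx0 /derive1n /=.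
all: by field.
Qed.

Lemma partial_term k f e u : U u -> (forall v, U v -> f v = deval e v) ->
  partial k f u = deval (dD ix k e) u.
Proof.
move=> Uu fe; rewrite (eq_partial k oU Uu fe).
exact: (partial_deval oU UJ fx_smooth fj_smooth fj0_neq0).
Qed.

Lemma deval_dsum F u : deval (dsum F) u = \sum_(k < 5) deval (F k) u.
Proof. by rewrite sum5. Qed.

Local Notation ghat := (rescale (fj 0) (g_of I)).
Local Notation sigma := (fj 0).

Lemma rescale_term i j u : U u -> ghat u i j = deval (At Rcp * At Rcp * g_term i j)%DT u.
Proof. by move=> Uu; rewrite /rescale mxE g_of_term// !devalE -exprVn expr2. Qed.

(** A one-sided inverse of a square matrix is its inverse, so [ginv_term_check] is enough. *)
Lemma invmx_rescale i j u : U u ->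
  invmx (ghat u) i j = sigma u ^+ 2 * deval (ginv_term i j) u.
Proof.
move=> Uu; pose B : 'M[R]_5 := \matrix_(k, l) (sigma u ^+ 2 * deval (ginv_term k l) u).
have gB : ghat u *m B = 1%:M.
  apply/matrixP => k l; rewrite !mxE.
  have -> : (k == l)%:R = deval (Cst (if k == l then q1 else qz)) u :> R.
    by case: eqP => _; rewrite devalE.
  rewrite -(deval_eq ix fx fj (check2P ginv_term_check k l) u) deval_dsum.
  apply: eq_bigr => m _; rewrite rescale_term// mxE !devalE.
  have s0 := fj0_neq0 Uu; move: (deval _ u) (deval _ u) => a b.
  by field.
have [gU _] := mulmx1_unit gB.
by rewrite -[invmx _]mulmx1 -gB mulKmx// mxE.
Qed.

Lemma christoffel_rescale k i j u : U u ->
  christoffel ghat k i j u = deval (rescaled_christoffel_term k i j) u.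
Proof.
move=> Uu.
have s0 := fj0_neq0 Uu.
have -> : deval (rescaled_christoffel_term k i j) u =
    deval (rescaled_christoffel_def_term k i j) u.
  rewrite (deval_eq ix fx fj (check2P (rescaled_christoffel_check k) i j) u) !devalE.
  by rewrite /=; move: (deval _ u) => a; field.
rewrite /christoffel /rescaled_christoffel_def_term devalE deval_fr mul1r deval_dsum.
congr (_ * _); apply: eq_bigr => l _.
rewrite invmx_rescale// !(partial_term _ Uu (e := (At Rcp * At Rcp * g_term _ _)%DT)
  (fun v => @rescale_term _ _ v)).
move: (ginv_term k l) (dD ix i _) (dD ix j _) (dD ix l _) => a b c d.
by rewrite !devalE /= expr2 mulN1r.
Qed.

(** On [U] every Christoffel symbol is the value of a term, so its partials are values of formal
    derivatives. The definition of [ricci] thereby becomes [ricci_of], which has been compared with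
    the closed formula. *)
Lemma ricci_rescale i j u : U u ->
  ricci ghat u i j = deval (rescaled_ricci_term i j) u.
Proof.
move=> Uu; rewrite -(deval_eq ix fx fj (check2P rescaled_ricci_check i j) u).
rewrite /ricci mxE /ricci_of devalE !deval_dsum; congr (_ + _); apply: eq_bigr => k _.
  rewrite !(partial_term _ Uu (fun v => @christoffel_rescale _ _ _ v)).
  by move: (dD ix k _) (dD ix j _) => a b; rewrite !devalE mulN1r.
rewrite deval_dsum; apply: eq_bigr => l _; rewrite !christoffel_rescale//.
move: (rescaled_christoffel_term k k l) (rescaled_christoffel_term l i j)
  (rescaled_christoffel_term k j l) (rescaled_christoffel_term l i k) => a b c d.
by rewrite !devalE mulN1r.
Qed.

End Links.

(** * Functions on the slab M_I *)

Section Slab.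
Variables (R : realType) (J : set R).
Hypotheses (oJ : open J) (iJ : is_interval J).
Local Notation V := 'rV[R]_5.
Local Notation M := (M_of J).
Implicit Types (f : V -> R) (u : V).

Definition axis (x : R) : V := x *: delta_mx 0 ix.

Lemma open_M_of : open M.
Proof.
have -> : M = (fun u : V => u 0 ix) @^-1` J by [].
by apply: open_comp => // u _; exact: coord_continuous.
Qed.

Lemma axis_ix x : axis x 0 ix = x.
Proof. by rewrite !mxE eqxx mulr1. Qed.

Lemma M_of_axis x : J x -> M (axis x).
Proof. by rewrite /M_of /= axis_ix. Qed.

Lemma cst_along f i (s : R) u : smooth_on M f -> i != ix ->
  (forall u, M u -> partial i f u = 0) -> M u -> f (s *: delta_mx 0 i + u) = f u.
Proof.
move=> sf iN f0 Mu.
have Ms t : M (t *: delta_mx 0 i + u).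
  by rewrite /M_of /= !mxE eqxx /= eq_sym (negbTE iN) mulr0 add0r.
have d0 (t : R) : is_derive t 1 (fun s : R => f (s *: delta_mx 0 i + u)) 0.
  have df : derivable f (t *: delta_mx 0 i + u) (delta_mx 0 i : V).
    by apply: smooth_derivable (Ms t); exact: sf.
  by have := derivable_line df; rewrite -[X in is_derive _ _ _ X]/(partial i f _) f0.
by rewrite (is_derive_0_is_cst s 0 d0) scale0r add0r.
Qed.

(** The domain is a slab: the coordinates y, p, q, z can be moved to 0 one after the other along
    full lines that stay inside it. *)
Lemma only_x f u : smooth_on M f ->
  (forall i, i != ix -> forall u, M u -> partial i f u = 0) -> M u ->
  f u = f (axis (u 0 ix)).
Proof.
move=> sf f0 Mu.
have step i (s : R) v : i != ix -> M v ->
    f (s *: delta_mx 0 i + v) = f v /\ M (s *: delta_mx 0 i + v).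
  move=> iN Mv; split; first exact: (cst_along s sf iN (f0 i iN) Mv).
  by rewrite /M_of /= !mxE eqxx /= eq_sym (negbTE iN) mulr0 add0r.
have [E1 M1] := step iy (- u 0 iy) u isT Mu.
have [E2 M2] := step ip (- u 0 ip) _ isT M1.
have [E3 M3] := step iq (- u 0 iq) _ isT M2.
have [E4 M4] := step iz (- u 0 iz) _ isT M3.
rewrite -E1 -E2 -E3 -E4; congr f; apply/rowP; elim/ord5_ind; rewrite !mxE /=; ring.
Qed.

Lemma is_derive_axis f (x : R) : smooth_on M f -> J x ->
  is_derive x 1 (fun t => f (axis t)) (partial ix f (axis x)).
Proof.
move=> sf Jx.
have E t : axis t = t *: delta_mx 0 ix + 0 by rewrite addr0.
have df : derivable f (x *: delta_mx 0 ix + 0) (delta_mx 0 ix : V).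
  by apply: (@smooth_derivable _ _ M _ _ _ sf); rewrite -E; exact: M_of_axis.
have := derivable_line df; rewrite -E.
by under eq_fun do rewrite -E.
Qed.

(** Turns jets in the direction x, as delivered by the formal calculus, into ordinary derivatives of
    the profile of a function. *)
Lemma derive1n_axis f k x : smooth_on M f -> J x ->
  derive1n k (fun t => f (axis t)) x = partials (nseq k ix) f (axis x).
Proof.
move=> sf; elim: k x => [|k IHk] x Jx //.
rewrite derive1nS derive1E.
rewrite (near_eq_derive (1 : R) (near_J oJ IHk Jx)).
apply: (@derive_val _ _ _ _ _ _ _ (is_derive_axis _ Jx)).
by apply: smooth_partials; exact: sf.
Qed.

Lemma smooth1_axis f : smooth_on M f -> smooth1_on J (fun t => f (axis t)).
Proof.
move=> sf k x Jx.
have d : derivable (fun t => partials (nseq k ix) f (axis t)) x 1.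
  have sp : smooth_on M (partials (nseq k ix) f) by apply: smooth_partials; exact: sf.
  by case: (is_derive_axis sp Jx).
apply: near_eq_derivable d; apply: (near_J oJ _ Jx) => y Jy.
exact: esym (derive1n_axis k sf Jy).
Qed.

End Slab.

Notation "\fx k m" := (At (Fx k m)) (at level 8, k at level 2, m at level 2) : dterm_scope.

(** * Almost Einstein scales *)

Section EinsteinTerms.
Local Open Scope dterm_scope.

(** The scale is function 1 here, so that no reciprocal occurs and the expression makes sense at
    zeros of the scale. *)
Definition einstein_lhs (i j : 'I_5) : dterm5 :=
  fr 3 1 * hessian_term 1 i j + \jet 1 [::] * ricci_term i j.

(* The unknown factor in [einstein_lhs i j = mu * g_term i j] is eliminated by
   means of the component (x, z), where g is the constant -3/2. *)
Definition einstein_eq (i j : 'I_5) : dterm5 :=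
  einstein_lhs i j * g_term ix iz - einstein_lhs ix iz * g_term i j.

Definition index_pairs : seq ('I_5 * 'I_5) :=
  [:: (ix, ix); (ix, iy); (ix, ip); (ix, iq); (ix, iz); (iy, iy); (iy, ip); (iy, iq);
      (iy, iz); (ip, ip); (ip, iq); (ip, iz); (iq, iq); (iq, iz); (iz, iz)].

Definition einstein_eqs : seq dterm5 := [seq einstein_eq t.1 t.2 | t <- index_pairs].

(* Found by completing the system [einstein_eqs] to involution. *)
Definition einstein_lemmas : seq (dterm5 * seq (cert_item 4)) := [::
  ((\jet 1 [:: iz])%DT,
     [:: (fq 2 9, [::], [:: iy], 1);
       (nq 2 9, [::], [:: ix], 5);
       (nq 4 9, [:: Fx 0 0], [:: iz], 0);
       (fq 8 27, [:: Fx 0 0; Crd ip], [:: ix], 8);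
       (nq 4 9, [:: Fx 0 0; Fx 0 0; Fx 0 0; Crd iy; Crd iy], [:: ix], 14);
       (fq 16 27, [:: Fx 0 0; Fx 0 0; Crd ip; Crd ip], [:: ix], 14);
       (fq 4 9, [:: Fx 0 0; Fx 0 2; Crd iy; Crd iy], [:: ix], 14);
       (nq 4 9, [:: Fx 0 0; Crd iy; Crd iy], [:: ix], 14);
       (nq 4 27, [:: Fx 0 0; Crd iq; Crd iq], [:: ix], 14);
       (nq 1 9, [:: Fx 0 0], [::], 6);
       (nq 2 9, [:: Fx 0 1], [::], 7);
       (fq 2 9, [:: Fx 0 0; Fx 0 0; Crd iy], [::], 8);
       (nq 5 27, [:: Fx 0 0; Crd iq], [::], 8);
       (fq 2 9, [:: Fx 0 1; Crd ip], [::], 8);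
       (nq 2 9, [:: Fx 0 2; Crd iy], [::], 8);
       (fq 2 9, [:: Crd iy], [::], 8);
       (nq 4 9, [:: Fx 0 0; Fx 0 0; Crd ip], [::], 11);
       (nq 4 9, [:: Fx 0 0; Fx 0 0; Fx 0 0; Crd iy], [::], 13);
       (nq 8 27, [:: Fx 0 0; Fx 0 0; Crd iq], [::], 13);
       (fq 16 27, [:: Fx 0 0; Fx 0 1; Crd ip], [::], 13);
       (fq 4 9, [:: Fx 0 0; Fx 0 2; Crd iy], [::], 13);
       (nq 4 9, [:: Fx 0 0; Crd iy], [::], 13);
       (fq 4 9, [:: Fx 0 0; Fx 0 0; Fx 0 0; Crd iy; Crd ip], [::], 14);
       (nq 4 9, [:: Fx 0 0; Fx 0 0; Fx 0 1; Crd iy; Crd iy], [::], 14);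
       (fq 28 81, [:: Fx 0 0; Fx 0 0; Crd ip; Crd iq], [::], 14);
       (nq 8 27, [:: Fx 0 0; Fx 0 1; Crd ip; Crd ip], [::], 14);
       (nq 4 9, [:: Fx 0 0; Fx 0 2; Crd iy; Crd ip], [::], 14);
       (fq 2 9, [:: Fx 0 0; Fx 0 3; Crd iy; Crd iy], [::], 14);
       (fq 4 9, [:: Fx 0 0; Crd iy; Crd ip], [::], 14)]);
  ((\jet 1 [:: iq])%DT,
     [:: (fq 2 9, [::], [:: iy], 0);
       (nq 2 9, [::], [:: ix], 1);
       (fq 4 3, [:: Fx 0 0; Crd ip], [:: ix; ix], 15);
       (nq 1 1, [:: Fx 0 0; Fx 0 0; Crd iy; Crd iy], [:: ix; iy], 15);
       (fq 4 3, [:: Fx 0 0; Crd ip; Crd ip], [:: ix; iy], 15);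
       (fq 1 1, [:: Fx 0 2; Crd iy; Crd iy], [:: ix; iy], 15);
       (nq 1 1, [:: Crd iy; Crd iy], [:: ix; iy], 15);
       (nq 1 3, [:: Crd iq; Crd iq], [:: ix; iy], 15);
       (fq 1 9, [:: Fx 0 0], [::], 2);
       (fq 2 9, [:: Fx 0 1], [::], 3);
       (fq 2 27, [:: Crd iq], [::], 5);
       (fq 2 9, [:: Fx 0 0; Crd ip], [::], 6);
       (fq 2 9, [:: Fx 0 0; Fx 0 0; Crd iy], [::], 7);
       (fq 4 27, [:: Fx 0 0; Crd iq], [::], 7);
       (nq 8 27, [:: Fx 0 1; Crd ip], [::], 7);
       (nq 2 9, [:: Fx 0 2; Crd iy], [::], 7);
       (fq 2 9, [:: Crd iy], [::], 7);
       (fq 1 1, [:: Fx 0 0; Fx 0 0; Crd iy; Crd ip], [:: iy], 15);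
       (nq 1 1, [:: Fx 0 0; Fx 0 1; Crd iy; Crd iy], [:: iy], 15);
       (fq 7 9, [:: Fx 0 0; Crd ip; Crd iq], [:: iy], 15);
       (nq 2 3, [:: Fx 0 1; Crd ip; Crd ip], [:: iy], 15);
       (nq 1 1, [:: Fx 0 2; Crd iy; Crd ip], [:: iy], 15);
       (fq 1 2, [:: Fx 0 3; Crd iy; Crd iy], [:: iy], 15);
       (fq 1 1, [:: Crd iy; Crd ip], [:: iy], 15);
       (nq 4 9, [:: Fx 0 0; Fx 0 0; Crd ip], [::], 15);
       (fq 1 1, [:: Crd ip], [::], 15)]);
  ((\jet 1 [:: ip])%DT,
     [:: (nq 4 9, [::], [::], 3);
       (nq 2 1, [::], [:: ix], 16);
       (fq 2 1, [:: Crd ip], [:: ix], 15);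
       (fq 1 3, [:: Crd iq], [::], 15)]);
  ((\jet 1 [:: iy])%DT,
     [:: (nq 1 3, [::], [::], 2);
       (nq 3 2, [::], [:: ix], 17);
       (nq 1 2, [:: Crd iq], [:: ix], 15);
       (nq 3 1, [:: Fx 0 0], [::], 16);
       (fq 7 3, [:: Fx 0 0; Crd ip], [::], 15)])].

(** In the certificates the given equations have the numbers 0 to 14 and the lemmas 15 to 18. The
    first four facts repeat the lemmas; the last one is what the component (x, x) becomes once they
    are known. *)
Definition einstein_facts : seq (dterm5 * seq (cert_item 4)) := [::
  ((\jet 1 [:: iy])%DT,
     [:: (fq 1 1, [::], [::], 18)]);
  ((\jet 1 [:: ip])%DT,
     [:: (fq 1 1, [::], [::], 17)]);
  ((\jet 1 [:: iq])%DT,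
     [:: (fq 1 1, [::], [::], 16)]);
  ((\jet 1 [:: iz])%DT,
     [:: (fq 1 1, [::], [::], 15)]);
  ((\jet 1 [:: ix; ix] + nf 1 3 * \I^ 0 * \jet 1 [::])%DT,
     [:: (nq 2 9, [::], [::], 0);
       (fq 1 1, [:: Fx 0 0; Fx 0 0; Crd iy; Crd iy], [:: ix], 15);
       (nq 4 3, [:: Fx 0 0; Crd ip; Crd ip], [:: ix], 15);
       (nq 1 1, [:: Fx 0 2; Crd iy; Crd iy], [:: ix], 15);
       (fq 1 1, [:: Crd iy; Crd iy], [:: ix], 15);
       (fq 1 3, [:: Crd iq; Crd iq], [:: ix], 15);
       (fq 1 3, [:: Crd iq], [::], 18);
       (fq 1 1, [:: Fx 0 0; Crd ip], [::], 17);
       (fq 1 1, [:: Fx 0 0; Fx 0 0; Crd iy], [::], 16);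
       (fq 2 3, [:: Fx 0 0; Crd iq], [::], 16);
       (nq 4 3, [:: Fx 0 1; Crd ip], [::], 16);
       (nq 1 1, [:: Fx 0 2; Crd iy], [::], 16);
       (fq 1 1, [:: Crd iy], [::], 16);
       (nq 1 1, [:: Fx 0 0; Fx 0 0; Crd iy; Crd ip], [::], 15);
       (fq 1 1, [:: Fx 0 0; Fx 0 1; Crd iy; Crd iy], [::], 15);
       (nq 7 9, [:: Fx 0 0; Crd ip; Crd iq], [::], 15);
       (fq 2 3, [:: Fx 0 1; Crd ip; Crd ip], [::], 15);
       (fq 1 1, [:: Fx 0 2; Crd iy; Crd ip], [::], 15);
       (nq 1 2, [:: Fx 0 3; Crd iy; Crd iy], [::], 15);
       (nq 1 1, [:: Crd iy; Crd ip], [::], 15)])].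


Lemma einstein_derivation :
  derivation ix einstein_eqs (einstein_lemmas ++ einstein_facts).
Proof. by vm_compute. Qed.

(** Describes an open set on which the scale vanishes, function 0 being 1. *)
Definition zero_term (k : nat) : dterm5 := if k is 0%N then Cst q1 else Cst qz.

Lemma einstein_eq_zero :
  check2 (fun i j => deq (jsubst ix zero_term (einstein_eq i j)) (Cst qz)).
Proof. by vm_compute. Qed.

Lemma einstein_eq_jet0_free : check2 (fun i j => jet0_free (einstein_eq i j)).
Proof. by vm_compute. Qed.

Definition profile_term (k : nat) : dterm5 := \fx 1 0.

(** For a scale s(x) the trace term drops out since the (x, x) component of the inverse metric is 0,
    and the Hessian is s'' dx^2. With the Ricci tensor - I dx^2 there remains the single component 3
    s''/s - I. *)
Lemma profile_ricci_check :
  check2 (fun i j => deq (jsubst ix profile_term (rescaled_ricci_term i j))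
    (if (i == ix) && (j == ix) then fr 3 1 * (At Rcp * \fx 1 2) - \I^ 0 else Cst qz)).
Proof. by vm_compute. Qed.

End EinsteinTerms.


Section Evaluation.
Variables (R : realType) (fx : nat -> R -> R) (fj : nat -> 'rV[R]_5 -> R) (u : 'rV[R]_5).
Local Notation deval e := (deval ix fx fj e u).

Lemma rescaled_ricciE i j : deval (rescaled_ricci_term i j) =
  deval (ricci_term i j) + 3 / 1 * ((fj 0 u)^-1 * deval (hessian_term 0 i j))
  + deval conformal_trace_term * deval (g_term i j).
Proof.
rewrite /rescaled_ricci_term.
move: (ricci_term i j) (hessian_term 0 i j) conformal_trace_term (g_term i j) => a b c d.
by rewrite !devalE deval_fr.
Qed.

Lemma einstein_lhsE i j : deval (einstein_lhs i j) =
  3 / 1 * deval (hessian_term 1 i j) + fj 1 u * deval (ricci_term i j).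
Proof.
rewrite /einstein_lhs; move: (ricci_term i j) (hessian_term 1 i j) => a b.
by rewrite !devalE deval_fr.
Qed.

Lemma einstein_eqE i j : deval (einstein_eq i j) =
  deval (einstein_lhs i j) * deval (g_term ix iz)
  - deval (einstein_lhs ix iz) * deval (g_term i j).
Proof.
rewrite /einstein_eq.
move: (einstein_lhs i j) (einstein_lhs ix iz) (g_term ix iz) (g_term i j) => a b c d.
by rewrite !devalE mulN1r.
Qed.

Lemma hessian_jet m k i j : fj m = fj k ->
  deval (hessian_term m i j) = deval (hessian_term k i j).
Proof.
move=> E; rewrite /hessian_term /dsum; move: christoffel_term => G.
by rewrite !devalE E.
Qed.

End Evaluation.

#[local] Opaque ricci_term hessian_term christoffel_term conformal_trace_term g_term.
#[local] Opaque einstein_lhs einstein_eq rescaled_ricci_term.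


Section Einstein.
Variables (R : realType) (J : set R) (I : R -> R).
Hypotheses (oJ : open J) (iJ : is_interval J) (sI : smooth1_on J I).
Local Notation V := 'rV[R]_5.
Local Notation M := (M_of J).
Local Notation g := (g_of I).
Implicit Types (sigma : V -> R) (u : V).

Lemma open_off_zeros (U : set V) (f : V -> R) : open U ->
  (forall u, U u -> {for u, continuous f}) -> open (off_zeros U f).
Proof.
move=> oU cf; rewrite openE => u [Uu fu].
have h1 : \forall v \near u, U v by exact: open_nbhs_nbhs.
have h2 : \forall v \near u, f v != 0.
  have fN : `|f u| > 0 by rewrite normr_gt0.
  have /cvgrPdist_lt/(_ _ fN) := cf u Uu.
  apply: filterS => v; apply: contraTneq => ->.
  by rewrite subr0 ltxx.
by near=> v; split; near: v.
Unshelve. all: by end_near. Qed.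

Lemma smooth_cst (U : set V) (c : R) : open U -> smooth_on U (cst c).
Proof.
move=> oU; apply: (@smooth_coind _ _ U (fun f => exists c, f = cst c)) => //.
- by move=> _ [d ->] u _; exact: cst_continuous.
- move=> _ i [d ->]; split.
    by move=> u _; exact: derivable_cst.
  by exists (cst 0); [exists 0 | move=> u _; rewrite /partial derive_cst].
- by exists c.
Qed.

Let fx (k : nat) : R -> R := I.

(** Multiplying the rescaled Ricci tensor by the scale collects the Einstein constant and the trace
    term in one multiple of [g]; [einstein_eq] is built to vanish whatever this multiple is. *)
Lemma einstein_eq_off_zeros sigma i j u : smooth_on M sigma ->
  einstein_on (off_zeros M sigma) (rescale sigma g) -> off_zeros M sigma u ->
  deval ix fx (fun=> sigma) (einstein_eq i j) u = 0.
Proof.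
move=> ss [l El] Uu; pose U := off_zeros M sigma.
have oU : open U.
  apply: open_off_zeros; first exact: open_M_of.
  by move=> v; apply: smooth_continuous; exact: ss.
have UJ v : U v -> J (v 0 ix) by case.
have sU : smooth_on U sigma by apply: smooth_subset ss => v [].
have sN v : U v -> sigma v != 0 by case.
have Rl a b : deval ix fx (fun=> sigma) (rescaled_ricci_term a b) u
    = l * ((sigma u)^-1 ^+ 2 * deval ix fx (fun=> sigma) (g_term a b) u).
  rewrite -(ricci_rescale oU UJ (fun=> sI) (fun=> sU) sN (erefl : fx 0 = I))//.
  rewrite (El u Uu) mxE; congr (_ * _).
  rewrite (rescale_term oU UJ (fun=> sI) (fun=> sU) sN (erefl : fx 0 = I))//.
have su := sN u Uu.
have {}Rl a b : deval ix fx (fun=> sigma) (einstein_lhs a b) u =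
    (l / sigma u - sigma u * deval ix fx (fun=> sigma) conformal_trace_term u)
    * deval ix fx (fun=> sigma) (g_term a b) u.
  have := Rl a b; rewrite rescaled_ricciE einstein_lhsE.
  rewrite (@hessian_jet _ _ (fun=> sigma) _ 0 1)//.
  move: (deval _ _ _ (ricci_term a b) u) (deval _ _ _ (hessian_term 1 a b) u)
    (deval _ _ _ conformal_trace_term u) (deval _ _ _ (g_term a b) u).
  move=> r h t G E.
  have {}E : r + 3 / 1 * ((sigma u)^-1 * h) = l * ((sigma u)^-1 ^+ 2 * G) - t * G by rewrite -E addrK.
  rewrite [LHS](_ : _ = sigma u * (r + 3 / 1 * ((sigma u)^-1 * h))); last by field.
  by rewrite E; field.
by rewrite einstein_eqE !Rl; ring.
Qed.

(** With function 0 equal to 1 the calculus applies on all of [M], including the zeros of the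
    scale. *)
Let fj sigma (k : nat) : V -> R := if k is 0%N then cst 1 else sigma.

Lemma fj_smooth (U : set V) sigma k : open U -> smooth_on U sigma -> smooth_on U (fj sigma k).
Proof. by case: k => [|k] oU ss; [exact: smooth_cst | exact: ss]. Qed.

Lemma fj0 sigma u : fj sigma 0 u != 0.
Proof. exact: oner_neq0. Qed.

(** Both cases are treated at once. Where the equation fails, on an open set [N], the scale must
    vanish by [einstein_eq_off_zeros]; but then all its jets vanish on [N] and the equation holds
    there. *)
Lemma einstein_eq_holds sigma i j : smooth_on M sigma ->
  einstein_on (off_zeros M sigma) (rescale sigma g) ->
  holds ix fx (fj sigma) M (einstein_eq i j).
Proof.
move=> ss sE u Mu; apply/eqP/negPn/negP => Tu.
pose T := deval ix fx (fj sigma) (einstein_eq i j).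
pose N := off_zeros M T.
have MJ v : M v -> J (v 0 ix) by [].
have oM : open M by exact: open_M_of.
have cT v : M v -> {for v, continuous T}.
  exact: (deval_continuous MJ (fun=> sI) (fun k => fj_smooth k oM ss) (fun v _ => fj0 sigma v)).
have oN : open N by exact: open_off_zeros.
have NJ v : N v -> J (v 0 ix) by case.
have sN : smooth_on N sigma by apply: smooth_subset ss => v [].
have s0 v : N v -> sigma v = 0.
  move=> [Mv Tv]; apply/eqP/negPn/negP => sv; move: Tv.
  rewrite /T (deval_jet0_free ix fx (fj' := fun=> sigma) v _
    (check2P einstein_eq_jet0_free i j)); last by case.
  by rewrite einstein_eq_off_zeros// eqxx.
have zE k v : N v -> fj sigma k v = deval ix fx (fj sigma) (zero_term k) v.
  by case: k => [|k] Nv /=; rewrite devalE//; exact: s0.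
have : T u = 0.
  rewrite /T -(deval_jsubst oN NJ (fun=> sI) (fun k => fj_smooth k oN sN) (fun v _ => fj0 sigma v) _ zE)//.
  by rewrite (deval_eq ix fx (fj sigma) (check2P einstein_eq_zero i j) u) devalE.
by apply/eqP.
Qed.

Lemma einstein_solution sigma : smooth_on M sigma ->
  einstein_on (off_zeros M sigma) (rescale sigma g) -> scale_solutions I J sigma.
Proof.
move=> ss sE.
have MJ v : M v -> J (v 0 ix) by [].
have oM : open M by exact: open_M_of.
have H0 : holds_all ix fx (fj sigma) M einstein_eqs.
  by do 15!(split; first exact: einstein_eq_holds).
have H := holds_derivation oM MJ (fun=> sI) (fun k => fj_smooth k oM ss) (fun v _ => fj0 sigma v)
  H0 einstein_derivation.
(* [H] lists the steps without the given equations, so the four lemmas occupy the positions 0 to 3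
   and the facts begin at 4. *)
have hy : holds ix fx (fj sigma) M (\jet 1 [:: iy])%DT by exact: (holds_nth 4 H).
have hp : holds ix fx (fj sigma) M (\jet 1 [:: ip])%DT by exact: (holds_nth 5 H).
have hq : holds ix fx (fj sigma) M (\jet 1 [:: iq])%DT by exact: (holds_nth 6 H).
have hz : holds ix fx (fj sigma) M (\jet 1 [:: iz])%DT by exact: (holds_nth 7 H).
have hx : holds ix fx (fj sigma) M (\jet 1 [:: ix; ix] + nf 1 3 * \I^ 0 * \jet 1 [::])%DT
  by exact: (holds_nth 8 H).
exists (fun x => sigma (axis x)); split.
- exact: smooth1_axis.
- move=> x Jx; rewrite (derive1n_axis oJ 2 ss Jx).
  have := hx _ (M_of_axis Jx); rewrite !devalE deval_nf axis_ix /=.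
  by rewrite div1r !mulNr.
- move=> u Mu; apply: (only_x ss _ Mu) => i iN v Mv.
  by elim/ord5_ind: i iN => // _; [exact: hy | exact: hp | exact: hq | exact: hz].
Qed.

(** By [profile_ricci_check] the only component of the Ricci tensor that could survive is 3 s''/s -
    I, which the differential equation cancels. *)
Lemma solution_ricci_flat sigma : scale_solutions I J sigma ->
  almost_ricci_flat_scales M g sigma.
Proof.
move=> [s [s_smooth sE sigmaE]].
have MJ v : M v -> J (v 0 ix) by [].
have oM : open M by exact: open_M_of.
pose fs (k : nat) : R -> R := if k is 0%N then I else s.
have fs_smooth k : smooth1_on J (fs k) by case: k.
have ss : smooth_on M sigma.
  apply: (@eq_smooth _ _ M (deval ix fs (fun=> cst 1) (\fx 1 0)%DT)) => //.
    by move=> u Mu; rewrite sigmaE.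
  by apply: (deval_smooth oM MJ fs_smooth (fun=> smooth_cst 1 oM)) => u _; exact: oner_neq0.
split; first exact: ss.
move=> u Uu; pose U := off_zeros M sigma.
have oU : open U.
  apply: open_off_zeros; first exact: open_M_of.
  by move=> v; apply: smooth_continuous; exact: ss.
have UJ v : U v -> J (v 0 ix) by case.
have sU : smooth_on U sigma by apply: smooth_subset ss => v [].
have sN v : U v -> sigma v != 0 by case.
apply/matrixP => i j.
apply: etrans (ricci_rescale oU UJ fs_smooth (fun=> sU) sN (erefl : fs 0 = I) i j Uu) _. rewrite [RHS]mxE.
have pE (k : nat) v : U v -> sigma v = deval ix fs (fun=> sigma) (profile_term k) v.
  by move=> [Mv _]; rewrite devalE sigmaE.
rewrite -(deval_jsubst oU UJ fs_smooth (fun=> sU) sN _ pE)//.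
rewrite (deval_eq ix fs (fun=> sigma) (check2P profile_ricci_check i j) u).
case: ifP => _; rewrite !devalE// deval_fr /=.
have sv : s (u 0 ix) = sigma u by rewrite sigmaE//; case: Uu.
have := sE _ (UJ u Uu); have := sN u Uu; rewrite sv /derive1n/= => h0 h1.
have -> : s^`()^`()%classic (u 0 ix) = 3^-1 * I (u 0 ix) * sigma u.
  by apply/eqP; rewrite -subr_eq0 h1.
by field.
Qed.

Lemma almost_einstein_eq : almost_einstein_scales M g = scale_solutions I J.
Proof.
apply/seteqP; split => sigma; first by case; exact: einstein_solution.
move=> /solution_ricci_flat[ss sR]; split; first exact: ss.
by exists 0 => u Uu; rewrite scale0r; exact: sR.
Qed.

Lemma almost_ricci_flat_eq : almost_ricci_flat_scales M g = scale_solutions I J.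
Proof.
apply/seteqP; split => sigma; last exact: solution_ricci_flat.
move=> [ss sR]; apply: einstein_solution; first exact: ss.
by exists 0 => u Uu; rewrite scale0r; exact: sR.
Qed.

End Einstein.

(** * Conformal Killing fields *)

Section KillingTerms.
Local Open Scope dterm_scope.

(* Functions 1 to 5 are the components of the vector field, function 6 is the
   conformal factor. *)
Definition killing_eq (i j : 'I_5) : dterm5 :=
  dsum (fun k => \jet (nat_of_ord k).+1 [::] * dD ix k (g_term i j)
    + (g_term k j * \jet (nat_of_ord k).+1 [:: i] + g_term i k * \jet (nat_of_ord k).+1 [:: j]))
  - \jet 6 [::] * g_term i j.

Definition killing_eqs : seq dterm5 := [seq killing_eq t.1 t.2 | t <- index_pairs].

(* The functions b, c, d, e1, e2, e3, up to the identification of functions on M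
   that depend on x only with functions of x. *)
Definition reduced_term (k : nat) : dterm5 :=
  match k with
  | 0%N => \jet 2 [::] - fr 1 2 * (\jet 6 [::] * \crd iy)
  | 1%N => \jet 3 [::] - fr 1 2 * (\jet 6 [::] * \crd ip)
  | 2%N => \jet 4 [::] - fr 1 2 * (\jet 6 [::] * \crd iq)
  | 3%N => \jet 5 [:: iy]
  | 4%N => \jet 5 [:: ip]
  | _ => \jet 5 [:: iq]
  end.

(** This is the constant [c2]: the z-component of the field without its homothety part and without
    its part linear in y, p, q. *)
Definition vertical_term : dterm5 :=
  \jet 5 [::] - (\jet 6 [::] * \crd iz + (\jet 5 [:: iy] * \crd iy
    + (\jet 5 [:: ip] * \crd ip + \jet 5 [:: iq] * \crd iq))).

(** Rows 0 to 2 express e3, e2, e1 through b, c, d and their derivatives, so the e's act as momenta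
    and the system is a second-order one for (b, c, d) in first-order form. The argument [Y] lets
    the same formula serve for jets of a given field and for symbols of unknown functions. *)
Definition symmetry_rhs (Y : nat -> dterm5) (k : nat) : dterm5 :=
  match k with
  | 0%N => Y 1%N + Y 5%N
  | 1%N => fr 1 4 * Y 2%N - fr 3 4 * Y 4%N
  | 2%N => Y 3%N + fr 10 3 * \I^ 0 * Y 1%N + fr 2 1 * \I^ 0 * Y 5%N
  | 3%N => (\I^ 2 - fr 1 1 - \I^ 0 * \I^ 0) * Y 0%N
  | 4%N => - (Y 3%N + fr 10 3 * \I^ 0 * Y 1%N + fr 10 3 * \I^ 0 * Y 5%N)
  | _ => - (fr 1 4 * Y 2%N + fr 1 4 * Y 4%N)
  end.

(* Found by completing the system [killing_eqs] to involution. *)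
Definition killing_lemmas : seq (dterm5 * seq (cert_item 4)) := [::
  ((\jet 1 [:: iq; iq])%DT,
     [:: (nq 2 3, [::], [:: iq], 13);
       (fq 1 3, [::], [:: iz], 12)]);
  ((fr 3 2 * \jet 1 [:: ip; ip] + \jet 6 [:: iz])%DT,
     [:: (nq 1 1, [::], [:: ip], 11);
       (fq 1 2, [::], [:: iz], 9)]);
  ((\jet 1 [:: iy; ip])%DT,
     [:: (nq 1 3, [::], [:: ip], 8);
       (fq 1 3, [::], [:: iz], 6);
       (nq 1 3, [::], [:: iy], 11);
       (fq 2 9, [:: Fx 0 0], [::], 14)]);
  ((nf 1 4 * \jet 1 [:: iy; iy] * \crd iq + \jet 3 [:: iy; iy]
    + nf 1 1 * \I^ 0 * \jet 1 [:: iy] + fr 3 4 * \I^ 0 * \jet 6 [:: ip]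
    + nf 3 4 * \I^ 1 * \jet 1 [:: ip])%DT,
     [:: (nq 1 2, [::], [:: iy], 6);
       (fq 1 4, [::], [:: ip], 5)]);
  ((nf 1 1 * \jet 1 [:: iy; iy] * \crd ip + \jet 2 [:: iy; iy]
    + nf 1 1 * \I^ 0 * \jet 6 [:: iq] + \I^ 1 * \jet 1 [:: iq]
    + nf 1 1 * \jet 6 [:: iy])%DT,
     [:: (fq 2 3, [::], [:: iy], 7);
       (nq 1 3, [::], [:: iq], 5)]);
  ((\jet 1 [:: iy; iq] + fr 3 4 * \jet 1 [:: ip; ip])%DT,
     [:: (nq 1 3, [::], [:: iq], 8);
       (fq 1 3, [::], [:: iz], 7);
       (nq 1 3, [::], [:: iy], 13);
       (fq 1 2, [::], [::], 16)]);
  ((nf 3 2 * \I^ 0 * \jet 1 [:: ip; ip] + \jet 1 [:: iy; iy])%DT,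
     [:: (nq 2 3, [::], [:: iy], 8);
       (fq 1 3, [::], [:: iz], 5);
       (nq 1 3, [:: Fx 0 1], [::], 14);
       (nq 1 1, [:: Fx 0 0], [::], 16)]);
  ((\jet 2 [:: iy; ip] + nf 2 3 * \I^ 0 * \jet 1 [:: iq] + nf 2 3 * \jet 1 [:: iy]
    + nf 1 2 * \jet 6 [:: ip])%DT,
     [:: (nq 1 3, [::], [:: iq], 6);
       (fq 1 3, [::], [:: ip], 7);
       (fq 1 1, [:: Crd ip], [::], 17);
       (fq 1 3, [::], [:: iy], 10)]);
  ((nf 2 1 * \jet 1 [:: ix; iq] + fr 3 2 * \jet 1 [:: ip; ip] * \crd ip
    + nf 1 1 * \jet 1 [:: ip] + \jet 6 [:: iq])%DT,
     [:: (fq 2 3, [::], [:: iq], 4);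
       (nq 2 3, [::], [:: iz], 3);
       (fq 2 3, [::], [:: ix], 13);
       (nq 1 9, [:: Crd iq], [::], 14);
       (fq 2 3, [::], [::], 11);
       (fq 1 1, [:: Crd ip], [::], 16)]);
  ((nf 2 1 * \jet 1 [:: ix; ip] + nf 1 2 * \jet 1 [:: ip; ip] * \crd iq
    + nf 4 1 * \I^ 0 * \jet 1 [:: iq] + nf 4 3 * \jet 1 [:: iy] + \jet 6 [:: ip])%DT,
     [:: (fq 2 3, [::], [:: ip], 4);
       (nq 2 3, [::], [:: iz], 2);
       (fq 2 3, [::], [:: ix], 11);
       (nq 28 27, [:: Fx 0 0; Crd ip], [::], 14);
       (fq 8 3, [:: Fx 0 0], [::], 13);
       (fq 8 9, [::], [::], 8);
       (nq 1 3, [:: Crd iq], [::], 16)]);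
  ((fr 1 3 * \jet 1 [:: ix; iq] * \crd iq + \jet 2 [:: ix; ip]
    + fr 4 9 * \I^ 0 * \jet 1 [:: iq] * \crd ip + nf 2 3 * \jet 1 [:: ix]
    + fr 1 3 * \jet 1 [:: ip] * \crd iq + fr 2 3 * \jet 2 [:: iy]
    + nf 1 3 * \jet 6 [::])%DT,
     [:: (nq 1 3, [::], [:: iq], 2);
       (fq 1 3, [::], [:: ip], 3);
       (fq 1 3, [::], [:: ix], 10);
       (fq 2 3, [:: Fx 0 0], [::], 12);
       (nq 1 6, [::], [::], 9);
       (fq 4 9, [::], [::], 7);
       (nq 1 2, [:: Crd ip], [::], 24);
       (nq 1 6, [:: Crd iq], [::], 23)]);
  ((fr 2 1 * \I^ 0 * \jet 1 [:: ip; ip] * \crd ip + nf 2 1 * \jet 1 [:: ix; iy]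
    + nf 1 1 * \I^ 0 * \jet 1 [:: ip] + nf 2 1 * \I^ 1 * \jet 1 [:: iq]
    + \jet 6 [:: iy])%DT,
     [:: (fq 2 3, [::], [:: iy], 4);
       (nq 2 3, [::], [:: iz], 1);
       (fq 2 3, [::], [:: ix], 8);
       (nq 2 3, [:: Fx 0 0; Fx 0 0; Crd iy], [::], 14);
       (fq 1 9, [:: Fx 0 0; Crd iq], [::], 14);
       (nq 2 3, [:: Fx 0 1; Crd ip], [::], 14);
       (fq 2 3, [:: Fx 0 2; Crd iy], [::], 14);
       (nq 2 3, [:: Crd iy], [::], 14);
       (fq 4 3, [:: Fx 0 1], [::], 13);
       (fq 2 3, [:: Fx 0 0], [::], 11);
       (fq 4 3, [:: Fx 0 0; Crd ip], [::], 16)]);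
  ((nf 4 3 * \I^ 0 * \jet 1 [:: ix; iq] * \crd ip + \jet 2 [:: ix; iy]
    + nf 1 1 * \I^ 0 * \I^ 0 * \jet 1 [:: iq] * \crd iy
    + nf 2 3 * \I^ 0 * \jet 1 [:: ip] * \crd ip + fr 1 6 * \I^ 0 * \jet 1 [:: iq] * \crd iq
    + fr 1 2 * \I^ 0 * \jet 2 [:: ip] + \I^ 2 * \jet 1 [:: iq] * \crd iy
    + fr 1 3 * \jet 1 [:: iy] * \crd iq + nf 1 1 * \jet 1 [:: iq] * \crd iy
    + nf 2 3 * \jet 3 [:: iy] + nf 1 2 * \jet 6 [:: ix])%DT,
     [:: (nq 1 3, [::], [:: iq], 1);
       (fq 1 3, [::], [:: iy], 3);
       (fq 1 3, [::], [:: ix], 7);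
       (fq 1 3, [:: Fx 0 1], [::], 12);
       (fq 1 3, [:: Fx 0 0], [::], 10);
       (nq 1 2, [:: Crd ip], [::], 26);
       (fq 2 3, [:: Fx 0 0; Crd ip], [::], 23)]);
  ((\I^ 0 * \jet 1 [:: ix; ip] * \crd ip + \jet 3 [:: ix; iy]
    + fr 3 4 * \I^ 0 * \I^ 0 * \jet 1 [:: ip] * \crd iy
    + fr 2 1 * \I^ 0 * \I^ 0 * \jet 1 [:: iq] * \crd ip + nf 1 2 * \I^ 0 * \jet 1 [:: ix]
    + \I^ 0 * \jet 1 [:: iy] * \crd ip + nf 3 2 * \I^ 0 * \jet 2 [:: iy]
    + fr 1 4 * \I^ 1 * \jet 1 [:: iq] * \crd iq + fr 3 4 * \I^ 1 * \jet 2 [:: ip]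
    + nf 3 4 * \I^ 2 * \jet 1 [:: ip] * \crd iy + fr 3 4 * \jet 1 [:: ip] * \crd iy
    + fr 3 4 * \I^ 0 * \jet 6 [::] + nf 1 1 * \I^ 1 * \jet 1 [::])%DT,
     [:: (fq 1 4, [::], [:: ip], 1);
       (nq 1 4, [::], [:: iy], 2);
       (nq 1 4, [::], [:: ix], 6);
       (nq 1 8, [:: Fx 0 0], [::], 9);
       (fq 1 6, [::], [::], 5);
       (nq 1 8, [:: Crd iq], [::], 26);
       (nq 1 2, [:: Fx 0 0; Crd ip], [::], 24)]);
  ((\jet 1 [:: ix; ix; ip] + fr 4 1 * \I^ 0 * \jet 1 [:: ix; iq]
    + nf 1 1 * \I^ 0 * \jet 1 [:: ip; ip] * \crd ip + fr 4 3 * \jet 1 [:: ix; iy]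
    + \I^ 0 * \jet 1 [:: ip] + fr 8 3 * \I^ 1 * \jet 1 [:: iq])%DT,
     [:: (nq 1 1, [::], [:: ix], 22);
       (fq 1 1, [::], [:: iy], 25);
       (nq 1 3, [:: Crd iq], [:: ix], 20);
       (nq 1 3, [:: Crd iq], [::], 17);
       (nq 4 9, [:: Fx 0 0; Crd ip], [::], 20);
       (nq 2 3, [::], [::], 19);
       (nq 2 3, [:: Crd ip], [::], 21);
       (nq 1 2, [::], [:: ix], 24);
       (nq 1 3, [::], [::], 26);
       (nq 2 3, [:: Fx 0 0], [::], 23)]);
  ((\jet 1 [:: ip])%DT,
     [:: (nq 4 3, [::], [:: ix], 18);
       (fq 4 3, [::], [:: iy], 28);
       (nq 1 3, [:: Crd iq], [:: ix], 21);
       (nq 4 3, [:: Fx 0 0; Crd ip], [:: ix], 17);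
       (fq 2 3, [:: Fx 0 0; Crd ip], [::], 21);
       (nq 1 1, [:: Fx 0 0; Fx 0 0; Crd iy], [::], 17);
       (fq 1 1, [:: Fx 0 2; Crd iy], [::], 17);
       (nq 1 1, [:: Crd iy], [::], 17);
       (nq 8 3, [:: Fx 0 0; Fx 0 0; Crd ip], [::], 20);
       (nq 1 3, [:: Fx 0 1; Crd iq], [::], 20);
       (fq 2 1, [:: Fx 0 0], [::], 19);
       (nq 1 1, [:: Fx 0 1], [::], 22);
       (fq 1 1, [:: Fx 0 0], [:: ix], 24);
       (fq 2 1, [:: Fx 0 0], [::], 29);
       (fq 1 1, [:: Fx 0 0], [::], 26);
       (fq 1 2, [:: Fx 0 1], [::], 24);
       (fq 2 1, [:: Fx 0 0; Fx 0 0], [::], 23)]);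
  ((fr 3 1 * \I^ 0 * \jet 1 [:: ix; iq] + \jet 1 [:: ix; iy]
    + fr 2 1 * \I^ 1 * \jet 1 [:: iq])%DT,
     [:: (fq 3 4, [::], [::], 29);
       (nq 3 4, [::], [:: ix; ix], 30);
       (fq 3 4, [:: Fx 0 0; Crd ip], [:: ip], 30);
       (nq 3 4, [:: Fx 0 0], [::], 30)]);
  ((nf 1 1 * \jet 1 [:: ix; ix] + \I^ 0 * \I^ 0 * \jet 1 [:: iq] * \crd iy
    + fr 2 3 * \I^ 0 * \jet 1 [:: iq] * \crd iq + nf 4 3 * \I^ 1 * \jet 1 [:: iq] * \crd ip
    + nf 1 1 * \I^ 2 * \jet 1 [:: iq] * \crd iy + fr 1 3 * \jet 1 [:: iy] * \crd iq
    + \jet 1 [:: iq] * \crd iy + \jet 6 [:: ix])%DT,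
     [:: (fq 2 3, [::], [:: ix], 4);
       (nq 1 3, [::], [:: iz], 0);
       (fq 1 3, [:: Fx 0 0; Fx 0 0; Crd iy; Crd ip], [::], 14);
       (nq 1 3, [:: Fx 0 0; Fx 0 1; Crd iy; Crd iy], [::], 14);
       (fq 7 27, [:: Fx 0 0; Crd ip; Crd iq], [::], 14);
       (nq 2 9, [:: Fx 0 1; Crd ip; Crd ip], [::], 14);
       (nq 1 3, [:: Fx 0 2; Crd iy; Crd ip], [::], 14);
       (fq 1 6, [:: Fx 0 3; Crd iy; Crd iy], [::], 14);
       (fq 1 3, [:: Crd iy; Crd ip], [::], 14);
       (nq 2 3, [:: Fx 0 0; Fx 0 0; Crd iy], [::], 13);
       (nq 4 9, [:: Fx 0 0; Crd iq], [::], 13);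
       (fq 8 9, [:: Fx 0 1; Crd ip], [::], 13);
       (fq 2 3, [:: Fx 0 2; Crd iy], [::], 13);
       (nq 2 3, [:: Crd iy], [::], 13);
       (nq 2 3, [:: Fx 0 0; Crd ip], [::], 11);
       (nq 1 1, [:: Fx 0 0; Crd ip], [::], 30);
       (nq 2 9, [:: Crd iq], [::], 8);
       (fq 1 2, [:: Fx 0 0; Fx 0 0; Crd iy; Crd iy], [::], 16);
       (nq 2 3, [:: Fx 0 0; Crd ip; Crd ip], [::], 16);
       (nq 1 2, [:: Fx 0 2; Crd iy; Crd iy], [::], 16);
       (fq 1 2, [:: Crd iy; Crd iy], [::], 16);
       (fq 1 6, [:: Crd iq; Crd iq], [::], 16);
       (nq 3 4, [:: Fx 0 0; Fx 0 0; Crd iy; Crd iy], [:: ip], 30);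
       (fq 1 1, [:: Fx 0 0; Crd ip; Crd ip], [:: ip], 30);
       (fq 3 4, [:: Fx 0 2; Crd iy; Crd iy], [:: ip], 30);
       (nq 3 4, [:: Crd iy; Crd iy], [:: ip], 30);
       (nq 1 4, [:: Crd iq; Crd iq], [:: ip], 30)]);
  ((nf 1 1 * \I^ 0 * \I^ 0 * \jet 1 [:: ix; iq] * \crd iy * \crd iy
    + fr 4 3 * \I^ 0 * \jet 1 [:: ix; iq] * \crd ip * \crd ip
    + \I^ 2 * \jet 1 [:: ix; iq] * \crd iy * \crd iy
    + nf 1 1 * \jet 1 [:: ix; iq] * \crd iy * \crd iy
    + nf 1 3 * \jet 1 [:: ix; iq] * \crd iq * \crd iq + \jet 2 [:: ix; ix]
    + nf 1 1 * \I^ 0 * \I^ 1 * \jet 1 [:: iq] * \crd iy * \crd iy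
    + fr 1 9 * \I^ 0 * \jet 1 [:: iq] * \crd ip * \crd iq
    + nf 1 1 * \I^ 0 * \jet 2 [:: ip] * \crd ip
    + fr 2 3 * \I^ 1 * \jet 1 [:: iq] * \crd ip * \crd ip
    + fr 1 2 * \I^ 3 * \jet 1 [:: iq] * \crd iy * \crd iy
    + fr 2 3 * \jet 1 [:: ix] * \crd iq + nf 1 3 * \jet 2 [:: iy] * \crd iq
    + nf 4 3 * \jet 3 [:: ix] + fr 1 3 * \jet 4 [::])%DT,
     [:: (fq 2 3, [::], [:: ix], 3);
       (nq 1 3, [::], [:: iq], 0);
       (nq 1 3, [:: Fx 0 0; Fx 0 0; Crd iy], [::], 12);
       (nq 2 9, [:: Fx 0 0; Crd iq], [::], 12);
       (fq 4 9, [:: Fx 0 1; Crd ip], [::], 12);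
       (fq 1 3, [:: Fx 0 2; Crd iy], [::], 12);
       (nq 1 3, [:: Crd iy], [::], 12);
       (nq 2 3, [:: Fx 0 0; Crd ip], [::], 10);
       (fq 1 2, [:: Fx 0 0; Fx 0 0; Crd iy; Crd iy], [::], 30);
       (nq 5 3, [:: Fx 0 0; Crd ip; Crd ip], [::], 30);
       (nq 1 2, [:: Fx 0 2; Crd iy; Crd iy], [::], 30);
       (fq 1 2, [:: Crd iy; Crd iy], [::], 30);
       (fq 1 6, [:: Crd iq; Crd iq], [::], 30);
       (nq 2 9, [:: Crd iq], [::], 7);
       (nq 1 1, [:: Crd ip], [::], 32);
       (fq 1 2, [:: Fx 0 0; Fx 0 0; Crd iy; Crd iy], [::], 23);
       (nq 2 3, [:: Fx 0 0; Crd ip; Crd ip], [::], 23);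
       (nq 1 2, [:: Fx 0 2; Crd iy; Crd iy], [::], 23);
       (fq 1 2, [:: Crd iy; Crd iy], [::], 23);
       (fq 1 6, [:: Crd iq; Crd iq], [::], 23);
       (nq 3 4, [:: Fx 0 0; Fx 0 0; Crd iy; Crd iy; Crd ip], [:: ip], 30);
       (fq 1 1, [:: Fx 0 0; Crd ip; Crd ip; Crd ip], [:: ip], 30);
       (fq 3 4, [:: Fx 0 2; Crd iy; Crd iy; Crd ip], [:: ip], 30);
       (nq 3 4, [:: Crd iy; Crd iy; Crd ip], [:: ip], 30);
       (nq 1 4, [:: Crd ip; Crd iq; Crd iq], [:: ip], 30)]);
  ((\jet 3 [:: ix; ix] + fr 3 2 * \I^ 0 * \I^ 0 * \I^ 0 * \jet 1 [:: iq] * \crd iy * \crd iy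
    + fr 1 2 * \I^ 0 * \I^ 0 * \jet 1 [:: iy] * \crd iy * \crd iy
    + nf 1 4 * \I^ 0 * \I^ 0 * \jet 1 [:: iq] * \crd iy * \crd iq
    + nf 2 1 * \I^ 0 * \I^ 0 * \jet 1 [:: iq] * \crd ip * \crd ip
    + nf 3 4 * \I^ 0 * \I^ 0 * \jet 2 [:: ip] * \crd iy
    + nf 3 2 * \I^ 0 * \I^ 2 * \jet 1 [:: iq] * \crd iy * \crd iy
    + fr 2 1 * \I^ 0 * \jet 1 [:: ix] * \crd ip
    + nf 2 3 * \I^ 0 * \jet 1 [:: iy] * \crd ip * \crd ip
    + fr 3 2 * \I^ 0 * \jet 1 [:: iq] * \crd iy * \crd iy
    + fr 1 3 * \I^ 0 * \jet 1 [:: iq] * \crd iq * \crd iq + nf 1 1 * \I^ 0 * \jet 2 [:: ix]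
    + nf 1 2 * \I^ 0 * \jet 2 [:: ip] * \crd iq
    + fr 1 3 * \I^ 1 * \jet 1 [:: iq] * \crd ip * \crd iq + \I^ 1 * \jet 2 [:: ip] * \crd ip
    + nf 1 2 * \I^ 2 * \jet 1 [:: iy] * \crd iy * \crd iy
    + fr 1 4 * \I^ 2 * \jet 1 [:: iq] * \crd iy * \crd iq
    + fr 3 4 * \I^ 2 * \jet 2 [:: ip] * \crd iy
    + fr 1 2 * \jet 1 [:: iy] * \crd iy * \crd iy
    + fr 1 6 * \jet 1 [:: iy] * \crd iq * \crd iq
    + nf 1 4 * \jet 1 [:: iq] * \crd iy * \crd iq + nf 3 4 * \jet 2 [:: ip] * \crd iy
    + nf 1 3 * \jet 3 [:: iy] * \crd iq + nf 1 1 * \jet 4 [:: ix] + \I^ 0 * \jet 3 [::]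
    + nf 1 2 * \I^ 0 * \jet 6 [::] * \crd ip + \I^ 1 * \jet 1 [::] * \crd ip)%DT,
     [:: (nq 1 2, [::], [:: ix], 2);
       (fq 1 4, [::], [:: ip], 0);
       (nq 3 4, [:: Fx 0 0; Fx 0 1; Crd iy; Crd iy], [::], 30);
       (fq 1 12, [:: Fx 0 0; Crd ip; Crd iq], [::], 30);
       (fq 1 2, [:: Fx 0 1; Crd ip; Crd ip], [::], 30);
       (fq 3 8, [:: Fx 0 3; Crd iy; Crd iy], [::], 30);
       (fq 1 4, [:: Fx 0 0; Crd ip], [::], 9);
       (fq 1 6, [:: Crd iq], [::], 6);
       (nq 1 4, [:: Crd iq], [::], 32);
       (nq 3 8, [:: Fx 0 0; Fx 0 0; Crd iy; Crd iy], [::], 24);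
       (fq 1 2, [:: Fx 0 0; Crd ip; Crd ip], [::], 24);
       (fq 3 8, [:: Fx 0 2; Crd iy; Crd iy], [::], 24);
       (nq 3 8, [:: Crd iy; Crd iy], [::], 24);
       (nq 1 8, [:: Crd iq; Crd iq], [::], 24);
       (nq 3 4, [:: Fx 0 0; Fx 0 0; Crd iy; Crd iy], [:: ix], 30);
       (fq 1 1, [:: Fx 0 0; Crd ip; Crd ip], [:: ix], 30);
       (fq 3 4, [:: Fx 0 2; Crd iy; Crd iy], [:: ix], 30);
       (nq 3 4, [:: Crd iy; Crd iy], [:: ix], 30);
       (nq 1 4, [:: Crd iq; Crd iq], [:: ix], 30);
       (nq 3 16, [:: Fx 0 0; Fx 0 0; Crd iy; Crd iy; Crd iq], [:: ip], 30);
       (fq 1 4, [:: Fx 0 0; Crd ip; Crd ip; Crd iq], [:: ip], 30);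
       (fq 3 16, [:: Fx 0 2; Crd iy; Crd iy; Crd iq], [:: ip], 30);
       (nq 3 16, [:: Crd iy; Crd iy; Crd iq], [:: ip], 30);
       (nq 1 16, [:: Crd iq; Crd iq; Crd iq], [:: ip], 30)]);
  ((fr 1 3 * \jet 1 [:: iq] * \crd iq + \jet 2 [:: ip])%DT,
     [:: (fq 4 3, [::], [:: ix], 28);
       (nq 4 3, [::], [:: iy], 34);
       (nq 4 3, [:: Fx 0 0; Crd ip], [:: ix; ix], 30);
       (nq 16 9, [:: Fx 0 0; Crd ip], [::], 31);
       (nq 2 1, [:: Fx 0 0; Fx 0 0; Crd iy], [:: ix], 30);
       (fq 2 1, [:: Fx 0 2; Crd iy], [:: ix], 30);
       (nq 2 1, [:: Crd iy], [:: ix], 30);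
       (fq 2 3, [:: Fx 0 0; Fx 0 0; Crd iy; Crd iy], [::], 21);
       (nq 8 9, [:: Fx 0 0; Crd ip; Crd ip], [::], 21);
       (nq 2 3, [:: Fx 0 2; Crd iy; Crd iy], [::], 21);
       (fq 2 3, [:: Crd iy; Crd iy], [::], 21);
       (fq 1 9, [:: Crd iq; Crd iq], [::], 21);
       (fq 2 1, [:: Fx 0 0; Fx 0 0; Fx 0 0; Crd iy; Crd iy], [::], 20);
       (nq 1 3, [:: Fx 0 0; Fx 0 0; Crd iy; Crd iq], [::], 20);
       (nq 8 3, [:: Fx 0 0; Fx 0 0; Crd ip; Crd ip], [::], 20);
       (nq 2 1, [:: Fx 0 0; Fx 0 2; Crd iy; Crd iy], [::], 20);
       (fq 2 1, [:: Fx 0 0; Crd iy; Crd iy], [::], 20);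
       (fq 4 9, [:: Fx 0 0; Crd iq; Crd iq], [::], 20);
       (fq 4 9, [:: Fx 0 1; Crd ip; Crd iq], [::], 20);
       (fq 1 3, [:: Fx 0 2; Crd iy; Crd iq], [::], 20);
       (nq 1 3, [:: Crd iy; Crd iq], [::], 20);
       (nq 1 2, [:: Fx 0 0; Fx 0 0; Fx 0 0; Crd iy; Crd iy], [:: ip], 30);
       (fq 2 1, [:: Fx 0 0; Fx 0 0; Crd ip; Crd ip], [:: ip], 30);
       (fq 1 2, [:: Fx 0 0; Fx 0 2; Crd iy; Crd iy], [:: ip], 30);
       (nq 1 2, [:: Fx 0 0; Crd iy; Crd iy], [:: ip], 30);
       (nq 1 6, [:: Fx 0 0; Crd iq; Crd iq], [:: ip], 30);
       (nq 2 1, [:: Fx 0 0], [::], 27);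
       (nq 1 1, [:: Fx 0 1], [::], 25);
       (nq 1 1, [:: Fx 0 0; Fx 0 0; Crd iy], [::], 22);
       (nq 2 3, [:: Fx 0 0; Crd iq], [::], 22);
       (fq 4 3, [:: Fx 0 1; Crd ip], [::], 22);
       (fq 1 1, [:: Fx 0 2; Crd iy], [::], 22);
       (nq 1 1, [:: Crd iy], [::], 22);
       (nq 4 9, [:: Crd iq], [::], 18);
       (nq 4 9, [::], [:: ix], 5);
       (nq 2 1, [:: Fx 0 0; Fx 0 0; Crd ip], [::], 30);
       (nq 2 1, [:: Fx 0 0; Fx 0 1; Crd iy], [::], 30);
       (fq 1 1, [:: Fx 0 3; Crd iy], [::], 30);
       (nq 2 3, [:: Fx 0 0], [::], 32);
       (nq 2 3, [:: Fx 0 0; Crd ip], [::], 26);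
       (nq 1 2, [:: Fx 0 0; Fx 0 0; Crd iy], [::], 24);
       (fq 2 3, [:: Fx 0 1; Crd ip], [::], 24);
       (fq 1 2, [:: Fx 0 2; Crd iy], [::], 24);
       (nq 1 2, [:: Crd iy], [::], 24)]);
  ((\jet 1 [:: iq])%DT,
     [:: (nq 1 4, [::], [:: ip], 12);
       (fq 3 4, [::], [:: iq], 35);
       (nq 3 4, [:: Crd ip], [:: iq], 30);
       (nq 1 4, [:: Crd iq], [::], 15)]);
  ((nf 1 1 * \jet 1 [:: ix] + \jet 2 [:: iy] + nf 1 2 * \jet 6 [::])%DT,
     [:: (fq 3 2, [::], [::], 25);
       (nq 3 2, [::], [:: ix], 35);
       (nq 1 2, [:: Crd iq], [::], 30);
       (nq 2 3, [:: Fx 0 0; Crd ip], [::], 36)]);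
  ((\jet 1 [:: iy])%DT,
     [:: (nq 3 2, [::], [::], 22);
       (fq 3 2, [::], [:: ip], 37);
       (fq 3 2, [::], [:: ix], 30);
       (nq 1 1, [:: Fx 0 0], [::], 36)]);
  ((\jet 1 [:: ix; ix] + nf 2 3 * \jet 3 [:: iy])%DT,
     [:: (fq 1 1, [::], [::], 27);
       (nq 1 1, [::], [:: ix], 37);
       (fq 4 3, [:: Fx 0 0; Crd ip], [:: ix], 36);
       (nq 1 3, [:: Crd iq], [::], 38);
       (fq 2 3, [:: Fx 0 0; Crd ip], [::], 30);
       (fq 1 1, [:: Fx 0 0; Fx 0 0; Crd iy], [::], 36);
       (nq 1 1, [:: Fx 0 2; Crd iy], [::], 36);
       (fq 1 1, [:: Crd iy], [::], 36);
       (nq 1 2, [:: Fx 0 0], [::], 35)]);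
  ((\jet 4 [:: ix; ix] + fr 3 1 * \I^ 0 * \I^ 0 * \jet 1 [:: ix] * \crd iy
    + fr 4 3 * \I^ 0 * \jet 1 [:: ix] * \crd iq + nf 4 1 * \I^ 0 * \jet 3 [:: ix]
    + nf 4 3 * \I^ 0 * \jet 3 [:: iy] * \crd ip + nf 4 1 * \I^ 1 * \jet 1 [:: ix] * \crd ip
    + nf 2 1 * \I^ 1 * \jet 2 [:: ix] + nf 3 1 * \I^ 2 * \jet 1 [:: ix] * \crd iy
    + fr 3 1 * \jet 1 [:: ix] * \crd iy + \I^ 0 * \I^ 0 * \jet 2 [::]
    + nf 1 2 * \I^ 0 * \I^ 0 * \jet 6 [::] * \crd iy
    + fr 2 1 * \I^ 0 * \I^ 1 * \jet 1 [::] * \crd iy + fr 2 3 * \I^ 0 * \jet 4 [::]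
    + nf 1 3 * \I^ 0 * \jet 6 [::] * \crd iq + fr 1 3 * \I^ 1 * \jet 1 [::] * \crd iq
    + nf 4 3 * \I^ 1 * \jet 3 [::] + fr 2 3 * \I^ 1 * \jet 6 [::] * \crd ip
    + nf 4 3 * \I^ 2 * \jet 1 [::] * \crd ip + nf 1 1 * \I^ 2 * \jet 2 [::]
    + fr 1 2 * \I^ 2 * \jet 6 [::] * \crd iy + nf 1 1 * \I^ 3 * \jet 1 [::] * \crd iy
    + \jet 2 [::] + nf 1 2 * \jet 6 [::] * \crd iy)%DT,
     [:: (fq 2 3, [::], [:: ix], 1);
       (nq 1 3, [::], [:: iy], 0);
       (fq 2 1, [:: Fx 0 0], [::], 33);
       (fq 2 1, [:: Fx 0 0; Fx 0 0; Fx 0 0; Crd iy; Crd iy], [:: ix], 36);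
       (nq 8 3, [:: Fx 0 0; Fx 0 0; Crd ip; Crd ip], [:: ix], 36);
       (nq 2 1, [:: Fx 0 0; Fx 0 2; Crd iy; Crd iy], [:: ix], 36);
       (fq 2 1, [:: Fx 0 0; Crd iy; Crd iy], [:: ix], 36);
       (fq 2 3, [:: Fx 0 0; Crd iq; Crd iq], [:: ix], 36);
       (fq 1 1, [:: Fx 0 0; Fx 0 1; Crd iy; Crd iy], [::], 38);
       (nq 2 3, [:: Fx 0 1; Crd ip; Crd ip], [::], 38);
       (nq 1 2, [:: Fx 0 3; Crd iy; Crd iy], [::], 38);
       (fq 4 3, [:: Fx 0 0; Fx 0 0; Fx 0 0; Crd iy; Crd ip], [::], 36);
       (fq 3 1, [:: Fx 0 0; Fx 0 0; Fx 0 1; Crd iy; Crd iy], [::], 36);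
       (nq 40 9, [:: Fx 0 0; Fx 0 1; Crd ip; Crd ip], [::], 36);
       (nq 4 3, [:: Fx 0 0; Fx 0 2; Crd iy; Crd ip], [::], 36);
       (nq 1 1, [:: Fx 0 0; Fx 0 3; Crd iy; Crd iy], [::], 36);
       (fq 4 3, [:: Fx 0 0; Crd iy; Crd ip], [::], 36);
       (nq 1 1, [:: Fx 0 1; Fx 0 2; Crd iy; Crd iy], [::], 36);
       (fq 1 1, [:: Fx 0 1; Crd iy; Crd iy], [::], 36);
       (fq 1 3, [:: Fx 0 1; Crd iq; Crd iq], [::], 36);
       (nq 1 1, [:: Fx 0 0; Fx 0 0; Crd iy], [::], 37);
       (fq 4 3, [:: Fx 0 1; Crd ip], [::], 37);
       (fq 1 1, [:: Fx 0 2; Crd iy], [::], 37);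
       (nq 1 1, [:: Crd iy], [::], 37);
       (fq 2 1, [:: Fx 0 0; Fx 0 0; Crd ip], [::], 35);
       (nq 1 9, [:: Crd iq], [::], 5);
       (nq 4 3, [:: Fx 0 0; Crd ip], [::], 32);
       (fq 1 2, [:: Fx 0 0; Fx 0 0; Crd iy; Crd iy], [::], 26);
       (nq 2 3, [:: Fx 0 0; Crd ip; Crd ip], [::], 26);
       (nq 1 2, [:: Fx 0 2; Crd iy; Crd iy], [::], 26);
       (fq 1 2, [:: Crd iy; Crd iy], [::], 26);
       (fq 1 6, [:: Crd iq; Crd iq], [::], 26);
       (fq 1 1, [:: Fx 0 0; Fx 0 0; Crd iy; Crd iy], [:: ix], 38);
       (nq 4 3, [:: Fx 0 0; Crd ip; Crd ip], [:: ix], 38);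
       (nq 1 1, [:: Fx 0 2; Crd iy; Crd iy], [:: ix], 38);
       (fq 1 1, [:: Crd iy; Crd iy], [:: ix], 38);
       (fq 1 3, [:: Crd iq; Crd iq], [:: ix], 38);
       (nq 1 1, [:: Fx 0 0; Fx 0 0; Fx 0 0; Crd iy; Crd iy; Crd ip], [:: ip], 30);
       (fq 4 3, [:: Fx 0 0; Fx 0 0; Crd ip; Crd ip; Crd ip], [:: ip], 30);
       (fq 1 1, [:: Fx 0 0; Fx 0 2; Crd iy; Crd iy; Crd ip], [:: ip], 30);
       (nq 1 1, [:: Fx 0 0; Crd iy; Crd iy; Crd ip], [:: ip], 30);
       (nq 1 3, [:: Fx 0 0; Crd ip; Crd iq; Crd iq], [:: ip], 30);
       (fq 1 2, [:: Fx 0 0; Fx 0 0; Fx 0 0; Crd iy; Crd iy], [::], 30);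
       (nq 2 3, [:: Fx 0 0; Fx 0 0; Crd ip; Crd ip], [::], 30);
       (nq 1 2, [:: Fx 0 0; Fx 0 2; Crd iy; Crd iy], [::], 30);
       (fq 1 2, [:: Fx 0 0; Crd iy; Crd iy], [::], 30);
       (fq 1 6, [:: Fx 0 0; Crd iq; Crd iq], [::], 30)]);
  ((\jet 1 [:: ix])%DT,
     [:: (nq 1 12, [::], [:: ix; ix], 5);
       (fq 1 4, [::], [:: iy], 40);
       (nq 1 3, [:: Fx 0 0; Crd ip], [:: iy], 39);
       (nq 1 2, [:: Fx 0 0], [:: ix; ix], 37);
       (nq 1 2, [:: Fx 0 0], [:: ix], 39);
       (nq 1 2, [:: Fx 0 1], [::], 39);
       (nq 1 2, [:: Fx 0 0; Fx 0 0; Crd iy], [:: ix], 38);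
       (nq 1 6, [:: Fx 0 0; Crd iq], [:: ix], 38);
       (fq 1 2, [:: Fx 0 2; Crd iy], [:: ix], 38);
       (nq 1 2, [:: Crd iy], [:: ix], 38);
       (nq 1 2, [:: Fx 0 1], [:: ix], 37);
       (fq 2 3, [:: Fx 0 0], [::], 28);
       (nq 5 6, [:: Fx 0 0; Fx 0 0; Crd ip], [:: ix], 30);
       (fq 1 9, [:: Fx 0 0; Crd ip], [::], 18);
       (fq 1 36, [:: Fx 0 0; Crd ip; Crd iq], [:: iy], 38);
       (nq 8 9, [:: Fx 0 0; Fx 0 0; Crd ip], [::], 38);
       (nq 1 2, [:: Fx 0 0; Fx 0 1; Crd iy], [::], 38);
       (nq 1 6, [:: Fx 0 1; Crd iq], [::], 38);
       (fq 1 4, [:: Fx 0 3; Crd iy], [::], 38);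
       (nq 3 8, [:: Fx 0 0; Fx 0 0; Fx 0 0; Crd iy], [::], 30);
       (fq 1 12, [:: Fx 0 0; Fx 0 0; Crd iq], [::], 30);
       (nq 1 12, [:: Fx 0 0; Fx 0 1; Crd ip], [::], 30);
       (fq 3 8, [:: Fx 0 0; Fx 0 2; Crd iy], [::], 30);
       (nq 3 8, [:: Fx 0 0; Crd iy], [::], 30);
       (nq 5 3, [:: Fx 0 0; Fx 0 0; Fx 0 0; Crd ip], [::], 36);
       (nq 1 4, [::], [::], 37);
       (fq 5 12, [:: Fx 0 0; Fx 0 0], [::], 37);
       (nq 1 4, [:: Fx 0 2], [::], 37);
       (nq 1 2, [:: Fx 0 0; Fx 0 1], [::], 35);
       (nq 1 18, [:: Fx 0 0], [::], 5);
       (fq 1 4, [:: Fx 0 1], [::], 32);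
       (fq 1 8, [:: Fx 0 0; Fx 0 0; Crd iy], [::], 26);
       (fq 1 12, [:: Fx 0 0; Crd iq], [::], 26);
       (nq 1 6, [:: Fx 0 1; Crd ip], [::], 26);
       (nq 1 8, [:: Fx 0 2; Crd iy], [::], 26);
       (fq 1 8, [:: Crd iy], [::], 26);
       (nq 1 4, [:: Fx 0 0; Fx 0 0; Fx 0 0; Crd iy; Crd ip], [:: ip], 30);
       (nq 5 24, [:: Fx 0 0; Fx 0 0; Crd ip; Crd iq], [:: ip], 30);
       (fq 1 3, [:: Fx 0 0; Fx 0 1; Crd ip; Crd ip], [:: ip], 30);
       (fq 1 4, [:: Fx 0 0; Fx 0 2; Crd iy; Crd ip], [:: ip], 30);
       (nq 1 4, [:: Fx 0 0; Crd iy; Crd ip], [:: ip], 30);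
       (nq 1 12, [:: Fx 0 0; Fx 0 0; Crd ip], [::], 24)]);
  ((\jet 3 [:: iy])%DT,
     [:: (nq 3 2, [::], [::], 39);
       (fq 3 2, [::], [:: ix], 41)]);
  ((\I^ 1 * \jet 1 [::])%DT,
     [:: (nq 1 1, [::], [::], 28);
       (fq 1 1, [::], [:: ix], 42);
       (fq 1 1, [:: Fx 0 0; Crd ip], [:: ip], 41);
       (nq 2 1, [:: Fx 0 0], [::], 41);
       (fq 1 1, [:: Fx 0 0; Crd ip], [::], 38);
       (fq 3 4, [:: Fx 0 0; Fx 0 0; Crd iy], [::], 30);
       (nq 3 4, [:: Fx 0 2; Crd iy], [::], 30);
       (fq 3 4, [:: Crd iy], [::], 30);
       (fq 2 1, [:: Fx 0 0; Fx 0 0; Crd ip], [::], 36);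
       (nq 3 2, [:: Fx 0 0], [::], 37);
       (fq 3 4, [:: Fx 0 1], [::], 35)]);
  ((\jet 6 [:: iz])%DT,
     [:: (fq 1 1, [::], [::], 16);
       (nq 3 2, [::], [:: ip], 30)]);
  ((\jet 6 [:: iq])%DT,
     [:: (fq 1 1, [::], [::], 23);
       (fq 2 1, [::], [:: iq], 41);
       (nq 3 2, [:: Crd ip], [:: ip], 30);
       (fq 1 1, [::], [::], 30)]);
  ((\jet 6 [:: ip])%DT,
     [:: (fq 1 1, [::], [::], 24);
       (fq 2 1, [::], [:: ip], 41);
       (fq 1 2, [:: Crd iq], [:: ip], 30);
       (fq 4 3, [::], [::], 38);
       (fq 4 1, [:: Fx 0 0], [::], 36)]);
  ((\jet 6 [:: iy])%DT,
     [:: (fq 1 1, [::], [::], 26);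
       (fq 2 1, [::], [:: iy], 41);
       (nq 2 1, [:: Fx 0 0; Crd ip], [:: ip], 30);
       (fq 1 1, [:: Fx 0 0], [::], 30);
       (fq 2 1, [:: Fx 0 1], [::], 36)]);
  ((\jet 6 [:: ix])%DT,
     [:: (fq 1 1, [::], [::], 32);
       (fq 1 1, [::], [:: ix], 41);
       (nq 1 3, [:: Crd iq], [::], 38);
       (nq 1 1, [:: Fx 0 0; Fx 0 0; Crd iy], [::], 36);
       (nq 2 3, [:: Fx 0 0; Crd iq], [::], 36);
       (fq 4 3, [:: Fx 0 1; Crd ip], [::], 36);
       (fq 1 1, [:: Fx 0 2; Crd iy], [::], 36);
       (nq 1 1, [:: Crd iy], [::], 36)]);
  ((\jet 2 [:: iz])%DT,
     [:: (fq 2 3, [::], [::], 13);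
       (fq 1 1, [::], [::], 36);
       (nq 1 3, [:: Crd ip], [::], 14)]);
  ((\jet 2 [:: iq])%DT,
     [:: (fq 1 3, [::], [::], 12);
       (fq 1 1, [:: Crd ip], [::], 36)]);
  ((\jet 2 [:: ip])%DT,
     [:: (fq 1 1, [::], [::], 35);
       (nq 1 3, [:: Crd iq], [::], 36)]);
  ((\jet 2 [:: iy] + nf 1 2 * \jet 6 [::])%DT,
     [:: (fq 1 1, [::], [::], 37);
       (fq 1 1, [::], [::], 41)]);
  ((\jet 3 [:: iz])%DT,
     [:: (nq 1 2, [::], [::], 11);
       (nq 3 4, [::], [::], 30);
       (nq 1 12, [:: Crd iq], [::], 14)]);
  ((\jet 3 [:: iq])%DT,
     [:: (nq 1 2, [::], [::], 10);
       (nq 3 4, [:: Crd ip], [::], 30);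
       (fq 1 4, [:: Crd iq], [::], 36);
       (fq 3 4, [::], [::], 51)]);
  ((\jet 3 [:: ip] + nf 1 2 * \jet 6 [::])%DT,
     [:: (nq 1 4, [::], [::], 9);
       (fq 1 4, [:: Crd iq], [::], 30)]);
  ((\jet 3 [:: iy])%DT,
     [:: (fq 1 1, [::], [::], 42)]);
  ((\jet 4 [:: iz])%DT,
     [:: (fq 2 3, [::], [::], 8);
       (fq 1 1, [::], [::], 38);
       (nq 4 9, [:: Fx 0 0; Crd ip], [::], 14);
       (fq 2 1, [:: Fx 0 0], [::], 49)]);
  ((\jet 4 [:: iq] + nf 1 2 * \jet 6 [::])%DT,
     [:: (fq 2 3, [::], [::], 7);
       (fq 1 1, [:: Crd ip], [::], 38);
       (fq 4 3, [:: Fx 0 0; Crd ip], [::], 36);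
       (nq 1 1, [::], [::], 52);
       (fq 2 1, [:: Fx 0 0], [::], 50)]);
  ((\jet 4 [:: ip])%DT,
     [:: (fq 2 3, [::], [::], 6);
       (nq 1 3, [:: Crd iq], [::], 38);
       (fq 4 3, [:: Fx 0 0; Crd ip], [::], 30);
       (fq 2 1, [:: Fx 0 0], [::], 51);
       (fq 4 3, [::], [::], 56)]);
  ((\jet 4 [:: iy])%DT,
     [:: (fq 1 3, [::], [::], 5);
       (fq 4 3, [:: Fx 0 0; Crd ip], [::], 38);
       (fq 2 1, [:: Fx 0 0], [::], 52);
       (fq 1 1, [::], [::], 43)]);
  ((\jet 5 [:: iz] + nf 1 1 * \jet 6 [::])%DT,
     [:: (nq 2 3, [::], [::], 4);
       (nq 1 1, [::], [::], 41);
       (fq 1 3, [:: Fx 0 0; Fx 0 0; Crd iy; Crd iy], [::], 14);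
       (nq 4 9, [:: Fx 0 0; Crd ip; Crd ip], [::], 14);
       (nq 1 3, [:: Fx 0 2; Crd iy; Crd iy], [::], 14);
       (fq 1 3, [:: Crd iy; Crd iy], [::], 14);
       (fq 1 9, [:: Crd iq; Crd iq], [::], 14);
       (nq 4 3, [:: Fx 0 0; Crd ip], [::], 49);
       (fq 1 3, [:: Crd iq], [::], 53);
       (nq 1 1, [:: Crd ip], [::], 57)]);
  ((nf 1 1 * \jet 2 [:: ix] + \jet 5 [:: iq] + \jet 3 [::]
    + nf 1 2 * \jet 6 [::] * \crd ip)%DT,
     [:: (nq 2 3, [::], [::], 3);
       (nq 1 1, [:: Crd ip], [::], 41);
       (nq 1 1, [:: Fx 0 0; Fx 0 0; Crd iy; Crd iy], [::], 36);
       (fq 4 3, [:: Fx 0 0; Crd ip; Crd ip], [::], 36);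
       (fq 1 1, [:: Fx 0 2; Crd iy; Crd iy], [::], 36);
       (nq 1 1, [:: Crd iy; Crd iy], [::], 36);
       (nq 1 3, [:: Crd iq; Crd iq], [::], 36);
       (nq 4 3, [:: Fx 0 0; Crd ip], [::], 50);
       (fq 1 3, [:: Crd iq], [::], 54);
       (nq 1 1, [:: Crd ip], [::], 58)]);
  ((fr 4 3 * \jet 3 [:: ix] + \jet 5 [:: ip] + nf 1 3 * \jet 4 [::]
    + fr 1 6 * \jet 6 [::] * \crd iq)%DT,
     [:: (nq 2 3, [::], [::], 2);
       (fq 1 3, [:: Crd iq], [::], 41);
       (nq 1 1, [:: Fx 0 0; Fx 0 0; Crd iy; Crd iy], [::], 30);
       (fq 4 3, [:: Fx 0 0; Crd ip; Crd ip], [::], 30);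
       (fq 1 1, [:: Fx 0 2; Crd iy; Crd iy], [::], 30);
       (nq 1 1, [:: Crd iy; Crd iy], [::], 30);
       (nq 1 3, [:: Crd iq; Crd iq], [::], 30);
       (nq 4 3, [:: Fx 0 0; Crd ip], [::], 51);
       (fq 1 3, [:: Crd iq], [::], 55);
       (nq 1 1, [:: Crd ip], [::], 59)]);
  ((fr 2 1 * \I^ 0 * \jet 2 [:: ix] + nf 1 1 * \jet 4 [:: ix] + \jet 5 [:: iy]
    + fr 4 3 * \I^ 0 * \jet 3 [::] + nf 2 3 * \I^ 0 * \jet 6 [::] * \crd ip)%DT,
     [:: (nq 2 3, [::], [::], 1);
       (nq 4 3, [:: Fx 0 0; Crd ip], [::], 41);
       (nq 1 1, [:: Fx 0 0; Fx 0 0; Crd iy; Crd iy], [::], 38);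
       (fq 4 3, [:: Fx 0 0; Crd ip; Crd ip], [::], 38);
       (fq 1 1, [:: Fx 0 2; Crd iy; Crd iy], [::], 38);
       (nq 1 1, [:: Crd iy; Crd iy], [::], 38);
       (nq 1 3, [:: Crd iq; Crd iq], [::], 38);
       (nq 4 3, [:: Fx 0 0; Crd ip], [::], 52);
       (fq 1 3, [:: Crd iq], [::], 56);
       (nq 1 1, [:: Crd ip], [::], 60);
       (nq 4 3, [:: Crd ip], [::], 43)]);
  ((fr 4 3 * \I^ 0 * \jet 2 [:: ix] * \crd ip + nf 1 3 * \jet 3 [:: ix] * \crd iq
    + \jet 4 [:: ix] * \crd ip + \jet 5 [:: ix] + \I^ 0 * \I^ 0 * \jet 2 [::] * \crd iy
    + nf 1 2 * \I^ 0 * \I^ 0 * \jet 6 [::] * \crd iy * \crd iy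
    + nf 4 3 * \I^ 0 * \jet 3 [::] * \crd ip
    + fr 2 3 * \I^ 0 * \jet 6 [::] * \crd ip * \crd ip
    + nf 1 1 * \I^ 2 * \jet 2 [::] * \crd iy
    + fr 1 2 * \I^ 2 * \jet 6 [::] * \crd iy * \crd iy + \jet 2 [::] * \crd iy
    + fr 1 3 * \jet 4 [::] * \crd iq + nf 1 2 * \jet 6 [::] * \crd iy * \crd iy
    + nf 1 6 * \jet 6 [::] * \crd iq * \crd iq)%DT,
     [:: (nq 1 3, [::], [::], 0);
       (nq 1 1, [:: Fx 0 0; Fx 0 0; Crd iy; Crd iy], [::], 41);
       (fq 4 3, [:: Fx 0 0; Crd ip; Crd ip], [::], 41);
       (nq 1 1, [:: Crd iy; Crd iy], [::], 41);
       (nq 1 3, [:: Crd iq; Crd iq], [::], 41);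
       (fq 1 2, [:: Crd iy; Crd iy], [:: ix; ix], 43);
       (nq 1 2, [:: Fx 0 1; Crd iy; Crd iy], [:: ix], 41);
       (nq 1 1, [:: Fx 0 0; Crd iy; Crd iy], [::], 43);
       (fq 2 3, [:: Crd ip; Crd ip], [::], 43)])].

(** Later proofs select by position: 0 to 4 and 5 to 9 make the x-component and the conformal factor
    constant, 10 is the condition on I', 11 to 34 make the reduced functions depend on x only, 35 to
    39 make [vertical_term] constant, 40 to 45 are the linear system. The lemmas they cite have the
    numbers 15 to 65. *)
Definition killing_facts : seq (dterm5 * seq (cert_item 4)) := [::
  ((\jet 1 [:: ix])%DT,
     [:: (fq 1 1, [::], [::], 41)]);
  ((\jet 1 [:: iy])%DT,
     [:: (fq 1 1, [::], [::], 38)]);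
  ((\jet 1 [:: ip])%DT,
     [:: (fq 1 1, [::], [::], 30)]);
  ((\jet 1 [:: iq])%DT,
     [:: (fq 1 1, [::], [::], 36)]);
  ((\jet 1 [:: iz])%DT,
     [:: (nq 1 3, [::], [::], 14)]);
  ((\jet 6 [:: ix])%DT,
     [:: (fq 1 1, [::], [::], 48)]);
  ((\jet 6 [:: iy])%DT,
     [:: (fq 1 1, [::], [::], 47)]);
  ((\jet 6 [:: ip])%DT,
     [:: (fq 1 1, [::], [::], 46)]);
  ((\jet 6 [:: iq])%DT,
     [:: (fq 1 1, [::], [::], 45)]);
  ((\jet 6 [:: iz])%DT,
     [:: (fq 1 1, [::], [::], 44)]);
  ((\I^ 1 * \jet 1 [::])%DT,
     [:: (fq 1 1, [::], [::], 43)]);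
  ((dD ix iy (reduced_term 0))%DT,
     [:: (fq 1 1, [::], [::], 52);
       (nq 1 2, [:: Crd iy], [::], 47)]);
  ((dD ix ip (reduced_term 0))%DT,
     [:: (fq 1 1, [::], [::], 51);
       (nq 1 2, [:: Crd iy], [::], 46)]);
  ((dD ix iq (reduced_term 0))%DT,
     [:: (fq 1 1, [::], [::], 50);
       (nq 1 2, [:: Crd iy], [::], 45)]);
  ((dD ix iz (reduced_term 0))%DT,
     [:: (fq 1 1, [::], [::], 49);
       (nq 1 2, [:: Crd iy], [::], 44)]);
  ((dD ix iy (reduced_term 1))%DT,
     [:: (fq 1 1, [::], [::], 56);
       (nq 1 2, [:: Crd ip], [::], 47)]);
  ((dD ix ip (reduced_term 1))%DT,
     [:: (fq 1 1, [::], [::], 55);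
       (nq 1 2, [:: Crd ip], [::], 46)]);
  ((dD ix iq (reduced_term 1))%DT,
     [:: (fq 1 1, [::], [::], 54);
       (nq 1 2, [:: Crd ip], [::], 45)]);
  ((dD ix iz (reduced_term 1))%DT,
     [:: (fq 1 1, [::], [::], 53);
       (nq 1 2, [:: Crd ip], [::], 44)]);
  ((dD ix iy (reduced_term 2))%DT,
     [:: (fq 1 1, [::], [::], 60);
       (nq 1 2, [:: Crd iq], [::], 47)]);
  ((dD ix ip (reduced_term 2))%DT,
     [:: (fq 1 1, [::], [::], 59);
       (nq 1 2, [:: Crd iq], [::], 46)]);
  ((dD ix iq (reduced_term 2))%DT,
     [:: (fq 1 1, [::], [::], 58);
       (nq 1 2, [:: Crd iq], [::], 45)]);
  ((dD ix iz (reduced_term 2))%DT,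
     [:: (fq 1 1, [::], [::], 57);
       (nq 1 2, [:: Crd iq], [::], 44)]);
  ((dD ix iy (reduced_term 3))%DT,
     [:: (fq 1 1, [::], [:: iy], 64);
       (nq 2 1, [:: Fx 0 0], [:: ix], 52);
       (fq 1 1, [::], [:: ix], 60);
       (nq 4 3, [:: Fx 0 0], [::], 56);
       (nq 1 1, [:: Fx 0 0], [::], 48);
       (fq 2 3, [:: Fx 0 0; Crd ip], [::], 47)]);
  ((dD ix ip (reduced_term 3))%DT,
     [:: (fq 1 1, [::], [:: ip], 64);
       (nq 2 1, [:: Fx 0 0], [:: ix], 51);
       (fq 1 1, [::], [:: ix], 59);
       (nq 4 3, [:: Fx 0 0], [::], 55);
       (fq 2 3, [:: Fx 0 0; Crd ip], [::], 46)]);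
  ((dD ix iq (reduced_term 3))%DT,
     [:: (fq 1 1, [::], [:: iq], 64);
       (nq 2 1, [:: Fx 0 0], [:: ix], 50);
       (fq 1 1, [::], [:: ix], 58);
       (nq 4 3, [:: Fx 0 0], [::], 54);
       (fq 1 2, [::], [::], 48);
       (fq 2 3, [:: Fx 0 0; Crd ip], [::], 45)]);
  ((dD ix iz (reduced_term 3))%DT,
     [:: (fq 1 1, [::], [:: iz], 64);
       (nq 2 1, [:: Fx 0 0], [:: ix], 49);
       (fq 1 1, [::], [:: ix], 57);
       (nq 4 3, [:: Fx 0 0], [::], 53);
       (fq 2 3, [:: Fx 0 0; Crd ip], [::], 44)]);
  ((dD ix iy (reduced_term 4))%DT,
     [:: (fq 1 1, [::], [:: ip], 64);
       (nq 2 1, [:: Fx 0 0], [:: ix], 51);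
       (fq 1 1, [::], [:: ix], 59);
       (nq 4 3, [:: Fx 0 0], [::], 55);
       (fq 2 3, [:: Fx 0 0; Crd ip], [::], 46)]);
  ((dD ix ip (reduced_term 4))%DT,
     [:: (fq 1 1, [::], [:: ip], 63);
       (nq 4 3, [::], [:: ix], 55);
       (fq 1 3, [::], [::], 59);
       (nq 2 3, [::], [::], 48);
       (nq 1 6, [:: Crd iq], [::], 46)]);
  ((dD ix iq (reduced_term 4))%DT,
     [:: (fq 1 1, [::], [:: iq], 63);
       (nq 4 3, [::], [:: ix], 54);
       (fq 1 3, [::], [::], 58);
       (nq 1 6, [:: Crd iq], [::], 45)]);
  ((dD ix iz (reduced_term 4))%DT,
     [:: (fq 1 1, [::], [:: iz], 63);
       (nq 4 3, [::], [:: ix], 53);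
       (fq 1 3, [::], [::], 57);
       (nq 1 6, [:: Crd iq], [::], 44)]);
  ((dD ix iy (reduced_term 5))%DT,
     [:: (fq 1 1, [::], [:: iq], 64);
       (nq 2 1, [:: Fx 0 0], [:: ix], 50);
       (fq 1 1, [::], [:: ix], 58);
       (nq 4 3, [:: Fx 0 0], [::], 54);
       (fq 1 2, [::], [::], 48);
       (fq 2 3, [:: Fx 0 0; Crd ip], [::], 45)]);
  ((dD ix ip (reduced_term 5))%DT,
     [:: (fq 1 1, [::], [:: iq], 63);
       (nq 4 3, [::], [:: ix], 54);
       (fq 1 3, [::], [::], 58);
       (nq 1 6, [:: Crd iq], [::], 45)]);
  ((dD ix iq (reduced_term 5))%DT,
     [:: (fq 1 1, [::], [:: iq], 62);
       (fq 1 1, [::], [:: ix], 50);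
       (nq 1 1, [::], [::], 54);
       (fq 1 2, [:: Crd ip], [::], 45)]);
  ((dD ix iz (reduced_term 5))%DT,
     [:: (fq 1 1, [::], [:: iz], 62);
       (fq 1 1, [::], [:: ix], 49);
       (nq 1 1, [::], [::], 53);
       (fq 1 2, [:: Crd ip], [::], 44)]);
  ((dD ix ix vertical_term)%DT,
     [:: (nq 1 1, [:: Crd iy], [:: iy], 65);
       (fq 4 3, [:: Fx 0 0; Crd iy; Crd ip], [:: ix], 52);
       (nq 1 3, [:: Crd iy; Crd iq], [:: ix], 56);
       (fq 1 1, [:: Crd iy; Crd ip], [:: ix], 60);
       (nq 1 1, [:: Crd ip], [:: ip], 65);
       (fq 4 3, [:: Fx 0 0; Crd ip; Crd ip], [:: ix], 51);
       (nq 1 3, [:: Crd ip; Crd iq], [:: ix], 55);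
       (fq 1 1, [:: Crd ip; Crd ip], [:: ix], 59);
       (nq 1 1, [:: Crd iq], [:: iq], 65);
       (fq 4 3, [:: Fx 0 0; Crd ip; Crd iq], [:: ix], 50);
       (nq 1 3, [:: Crd iq; Crd iq], [:: ix], 54);
       (fq 1 1, [:: Crd ip; Crd iq], [:: ix], 58);
       (fq 1 1, [:: Fx 0 0; Fx 0 0; Crd iy; Crd iy], [::], 52);
       (nq 1 1, [:: Fx 0 2; Crd iy; Crd iy], [::], 52);
       (fq 1 1, [:: Crd iy; Crd iy], [::], 52);
       (fq 1 1, [:: Fx 0 0; Fx 0 0; Crd iy; Crd ip], [::], 51);
       (nq 1 1, [:: Fx 0 2; Crd iy; Crd ip], [::], 51);
       (fq 1 1, [:: Crd iy; Crd ip], [::], 51);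
       (fq 1 1, [:: Fx 0 0; Fx 0 0; Crd iy; Crd iq], [::], 50);
       (nq 1 1, [:: Fx 0 2; Crd iy; Crd iq], [::], 50);
       (fq 1 1, [:: Crd iy; Crd iq], [::], 50);
       (nq 4 3, [:: Fx 0 0; Crd iy; Crd ip], [::], 56);
       (nq 4 3, [:: Fx 0 0; Crd ip; Crd ip], [::], 55);
       (nq 4 3, [:: Fx 0 0; Crd ip; Crd iq], [::], 54);
       (fq 1 3, [:: Crd iy; Crd iq], [::], 60);
       (fq 1 3, [:: Crd ip; Crd iq], [::], 59);
       (fq 1 3, [:: Crd iq; Crd iq], [::], 58);
       (fq 1 1, [::], [::], 65);
       (fq 2 3, [:: Fx 0 0; Crd iy; Crd ip], [::], 48);
       (fq 1 3, [:: Crd ip; Crd iq], [::], 48);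
       (nq 1 1, [:: Crd iz], [::], 48);
       (nq 1 2, [:: Fx 0 0; Fx 0 0; Crd iy; Crd iy; Crd iy], [::], 47);
       (fq 2 3, [:: Fx 0 0; Crd iy; Crd ip; Crd ip], [::], 47);
       (fq 1 2, [:: Fx 0 2; Crd iy; Crd iy; Crd iy], [::], 47);
       (nq 1 2, [:: Crd iy; Crd iy; Crd iy], [::], 47);
       (nq 1 6, [:: Crd iy; Crd iq; Crd iq], [::], 47);
       (nq 1 2, [:: Fx 0 0; Fx 0 0; Crd iy; Crd iy; Crd ip], [::], 46);
       (fq 2 3, [:: Fx 0 0; Crd ip; Crd ip; Crd ip], [::], 46);
       (fq 1 2, [:: Fx 0 2; Crd iy; Crd iy; Crd ip], [::], 46);
       (nq 1 2, [:: Crd iy; Crd iy; Crd ip], [::], 46);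
       (nq 1 6, [:: Crd ip; Crd iq; Crd iq], [::], 46);
       (nq 1 2, [:: Fx 0 0; Fx 0 0; Crd iy; Crd iy; Crd iq], [::], 45);
       (fq 2 3, [:: Fx 0 0; Crd ip; Crd ip; Crd iq], [::], 45);
       (fq 1 2, [:: Fx 0 2; Crd iy; Crd iy; Crd iq], [::], 45);
       (nq 1 2, [:: Crd iy; Crd iy; Crd iq], [::], 45);
       (nq 1 6, [:: Crd iq; Crd iq; Crd iq], [::], 45)]);
  ((dD ix iy vertical_term)%DT,
     [:: (nq 1 1, [:: Crd iy], [:: iy], 64);
       (fq 2 1, [:: Fx 0 0; Crd iy], [:: ix], 52);
       (nq 1 1, [:: Crd iy], [:: ix], 60);
       (nq 1 1, [:: Crd ip], [:: ip], 64);
       (fq 2 1, [:: Fx 0 0; Crd ip], [:: ix], 51);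
       (nq 1 1, [:: Crd ip], [:: ix], 59);
       (nq 1 1, [:: Crd iq], [:: iq], 64);
       (fq 2 1, [:: Fx 0 0; Crd iq], [:: ix], 50);
       (nq 1 1, [:: Crd iq], [:: ix], 58);
       (fq 4 3, [:: Fx 0 0; Crd iy], [::], 56);
       (fq 4 3, [:: Fx 0 0; Crd ip], [::], 55);
       (fq 4 3, [:: Fx 0 0; Crd iq], [::], 54);
       (fq 1 1, [:: Fx 0 0; Crd iy], [::], 48);
       (nq 1 2, [:: Crd iq], [::], 48);
       (nq 2 3, [:: Fx 0 0; Crd iy; Crd ip], [::], 47);
       (nq 1 1, [:: Crd iz], [::], 47);
       (nq 2 3, [:: Fx 0 0; Crd ip; Crd ip], [::], 46);
       (nq 2 3, [:: Fx 0 0; Crd ip; Crd iq], [::], 45)]);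
  ((dD ix ip vertical_term)%DT,
     [:: (nq 1 1, [:: Crd iy], [:: ip], 64);
       (fq 2 1, [:: Fx 0 0; Crd iy], [:: ix], 51);
       (nq 1 1, [:: Crd iy], [:: ix], 59);
       (nq 1 1, [:: Crd ip], [:: ip], 63);
       (fq 4 3, [:: Crd ip], [:: ix], 55);
       (nq 1 1, [:: Crd iq], [:: iq], 63);
       (fq 4 3, [:: Crd iq], [:: ix], 54);
       (fq 4 3, [:: Fx 0 0; Crd iy], [::], 55);
       (nq 1 3, [:: Crd ip], [::], 59);
       (nq 1 3, [:: Crd iq], [::], 58);
       (fq 2 3, [:: Crd ip], [::], 48);
       (nq 2 3, [:: Fx 0 0; Crd iy; Crd ip], [::], 46);
       (fq 1 6, [:: Crd ip; Crd iq], [::], 46);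
       (nq 1 1, [:: Crd iz], [::], 46);
       (fq 1 6, [:: Crd iq; Crd iq], [::], 45)]);
  ((dD ix iq vertical_term)%DT,
     [:: (nq 1 1, [:: Crd iy], [:: iq], 64);
       (fq 2 1, [:: Fx 0 0; Crd iy], [:: ix], 50);
       (nq 1 1, [:: Crd iq], [:: ix], 50);
       (nq 1 1, [:: Crd iy], [:: ix], 58);
       (nq 1 1, [:: Crd ip], [:: iq], 63);
       (fq 4 3, [:: Crd ip], [:: ix], 54);
       (nq 1 1, [:: Crd iq], [:: iq], 62);
       (fq 4 3, [:: Fx 0 0; Crd iy], [::], 54);
       (fq 1 1, [:: Crd iq], [::], 54);
       (nq 1 3, [:: Crd ip], [::], 58);
       (nq 1 2, [:: Crd iy], [::], 48);
       (nq 2 3, [:: Fx 0 0; Crd iy; Crd ip], [::], 45);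
       (nq 1 3, [:: Crd ip; Crd iq], [::], 45);
       (nq 1 1, [:: Crd iz], [::], 45)]);
  ((dD ix iz vertical_term)%DT,
     [:: (nq 1 1, [:: Crd iy], [:: iz], 64);
       (fq 2 1, [:: Fx 0 0; Crd iy], [:: ix], 49);
       (nq 1 1, [:: Crd iq], [:: ix], 49);
       (nq 1 1, [:: Crd iy], [:: ix], 57);
       (nq 1 1, [:: Crd ip], [:: iz], 63);
       (fq 4 3, [:: Crd ip], [:: ix], 53);
       (nq 1 1, [:: Crd iq], [:: iz], 62);
       (fq 4 3, [:: Fx 0 0; Crd iy], [::], 53);
       (fq 1 1, [:: Crd iq], [::], 53);
       (nq 1 3, [:: Crd ip], [::], 57);
       (fq 1 1, [::], [::], 61);
       (nq 2 3, [:: Fx 0 0; Crd iy; Crd ip], [::], 44);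
       (nq 1 3, [:: Crd ip; Crd iq], [::], 44);
       (nq 1 1, [:: Crd iz], [::], 44)]);
  ((dD ix ix (reduced_term 0) - symmetry_rhs reduced_term 0)%DT,
     [:: (nq 1 1, [::], [::], 62);
       (nq 1 2, [:: Crd iy], [::], 48)]);
  ((dD ix ix (reduced_term 1) - symmetry_rhs reduced_term 1)%DT,
     [:: (fq 3 4, [::], [::], 63);
       (nq 1 2, [:: Crd ip], [::], 48)]);
  ((dD ix ix (reduced_term 2) - symmetry_rhs reduced_term 2)%DT,
     [:: (nq 1 1, [::], [::], 64);
       (nq 2 1, [:: Fx 0 0], [::], 62);
       (nq 1 2, [:: Crd iq], [::], 48)]);
  ((dD ix ix (reduced_term 3) - symmetry_rhs reduced_term 3)%DT,
     [:: (fq 1 1, [::], [:: iy], 65);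
       (nq 4 3, [:: Fx 0 0; Crd ip], [:: ix], 52);
       (fq 1 3, [:: Crd iq], [:: ix], 56);
       (nq 1 1, [:: Crd ip], [:: ix], 60);
       (nq 1 1, [:: Fx 0 0; Fx 0 0; Crd iy], [::], 52);
       (fq 1 1, [:: Fx 0 2; Crd iy], [::], 52);
       (nq 1 1, [:: Crd iy], [::], 52);
       (fq 4 3, [:: Fx 0 0; Crd ip], [::], 56);
       (nq 1 3, [:: Crd iq], [::], 60);
       (nq 2 3, [:: Fx 0 0; Crd ip], [::], 48);
       (fq 1 2, [:: Fx 0 0; Fx 0 0; Crd iy; Crd iy], [::], 47);
       (nq 2 3, [:: Fx 0 0; Crd ip; Crd ip], [::], 47);
       (nq 1 2, [:: Fx 0 2; Crd iy; Crd iy], [::], 47);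
       (fq 1 2, [:: Crd iy; Crd iy], [::], 47);
       (fq 1 6, [:: Crd iq; Crd iq], [::], 47)]);
  ((dD ix ix (reduced_term 4) - symmetry_rhs reduced_term 4)%DT,
     [:: (fq 1 1, [::], [:: ip], 65);
       (nq 4 3, [:: Fx 0 0; Crd ip], [:: ix], 51);
       (fq 1 3, [:: Crd iq], [:: ix], 55);
       (nq 1 1, [:: Crd ip], [:: ix], 59);
       (nq 1 1, [:: Fx 0 0; Fx 0 0; Crd iy], [::], 51);
       (fq 1 1, [:: Fx 0 2; Crd iy], [::], 51);
       (nq 1 1, [:: Crd iy], [::], 51);
       (fq 4 3, [:: Fx 0 0; Crd ip], [::], 55);
       (nq 1 3, [:: Crd iq], [::], 59);
       (fq 1 1, [::], [::], 64);
       (fq 10 3, [:: Fx 0 0], [::], 62);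
       (fq 1 6, [:: Crd iq], [::], 48);
       (fq 1 2, [:: Fx 0 0; Fx 0 0; Crd iy; Crd iy], [::], 46);
       (nq 2 3, [:: Fx 0 0; Crd ip; Crd ip], [::], 46);
       (nq 1 2, [:: Fx 0 2; Crd iy; Crd iy], [::], 46);
       (fq 1 2, [:: Crd iy; Crd iy], [::], 46);
       (fq 1 6, [:: Crd iq; Crd iq], [::], 46)]);
  ((dD ix ix (reduced_term 5) - symmetry_rhs reduced_term 5)%DT,
     [:: (fq 1 1, [::], [:: iq], 65);
       (nq 4 3, [:: Fx 0 0; Crd ip], [:: ix], 50);
       (fq 1 3, [:: Crd iq], [:: ix], 54);
       (nq 1 1, [:: Crd ip], [:: ix], 58);
       (nq 1 1, [:: Fx 0 0; Fx 0 0; Crd iy], [::], 50);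
       (fq 1 1, [:: Fx 0 2; Crd iy], [::], 50);
       (nq 1 1, [:: Crd iy], [::], 50);
       (fq 4 3, [:: Fx 0 0; Crd ip], [::], 54);
       (nq 1 3, [:: Crd iq], [::], 58);
       (fq 1 4, [::], [::], 63);
       (nq 1 2, [:: Crd ip], [::], 48);
       (fq 1 2, [:: Fx 0 0; Fx 0 0; Crd iy; Crd iy], [::], 45);
       (nq 2 3, [:: Fx 0 0; Crd ip; Crd ip], [::], 45);
       (nq 1 2, [:: Fx 0 2; Crd iy; Crd iy], [::], 45);
       (fq 1 2, [:: Crd iy; Crd iy], [::], 45);
       (fq 1 6, [:: Crd iq; Crd iq], [::], 45)])].


Lemma killing_derivation :
  derivation ix killing_eqs (killing_lemmas ++ killing_facts).
Proof. by vm_compute. Qed.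

(* Here the functions of x are, in this order: I; b, c, d, e1, e2, e3; and the
   constants c0, c1, c2. *)
Definition symmetry_term (k : nat) : dterm5 :=
  match k with
  | 0%N => Cst q1
  | 2%N => \fx 8 0 * \crd iy + \fx 1 0
  | 3%N => \fx 8 0 * \crd ip + \fx 2 0
  | 4%N => \fx 8 0 * \crd iq + \fx 3 0
  | 5%N => fr 2 1 * \fx 8 0 * \crd iz + (\fx 4 0 * \crd iy
             + (\fx 5 0 * \crd ip + (\fx 6 0 * \crd iq + \fx 9 0)))
  | 6%N => fr 2 1 * \fx 8 0
  | _ => \fx 7 0
  end.

(** All that is known of the ingredients of a symmetry: the linear system, the constancy of three
    functions, and the condition tying the x-translation to I'. *)
Definition symmetry_eqs : seq dterm5 :=
  [seq \fx k.+1 1 - symmetry_rhs (fun l => \fx l.+1 0) k | k <- iota 0 6]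
  ++ [:: \fx 7 1; \fx 8 1; \fx 9 1; \fx 7 0 * \I^ 1].

(** The converse of [killing_facts]: each Killing equation, after substitution of the general field,
    follows from [symmetry_eqs]. An empty certificate marks an equation that becomes 0
    identically. *)
Definition symmetry_facts : seq (dterm5 * seq (cert_item 4)) := [::
  (jsubst ix symmetry_term (killing_eq ix ix),
     [:: (nq 4 1, [:: Fx 0 0; Crd ip], [::], 0);
       (fq 1 1, [:: Crd iq], [::], 1);
       (nq 3 1, [:: Crd ip], [::], 2);
       (nq 3 1, [:: Crd iy], [::], 3);
       (nq 3 1, [:: Crd ip], [::], 4);
       (nq 3 1, [:: Crd iq], [::], 5);
       (nq 3 1, [:: Fx 0 0; Fx 0 0; Crd iy; Crd iy], [::], 6);
       (fq 4 1, [:: Fx 0 0; Crd ip; Crd ip], [::], 6);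
       (nq 3 1, [:: Crd iy; Crd iy], [::], 6);
       (nq 1 1, [:: Crd iq; Crd iq], [::], 6);
       (nq 4 1, [:: Fx 0 0; Crd iy; Crd ip], [::], 7);
       (nq 2 1, [:: Crd ip; Crd iq], [::], 7);
       (nq 6 1, [:: Crd iz], [::], 7);
       (nq 3 1, [::], [::], 8);
       (fq 3 2, [:: Crd iy; Crd iy], [:: ix; ix], 9);
       (nq 3 2, [:: Fx 0 1; Crd iy; Crd iy], [:: ix], 6);
       (nq 3 1, [:: Fx 0 0; Crd iy; Crd iy], [::], 9);
       (fq 2 1, [:: Crd ip; Crd ip], [::], 9)]);
  (jsubst ix symmetry_term (killing_eq ix iy),
     [:: (nq 3 1, [:: Fx 0 0], [::], 0);
       (fq 3 2, [::], [::], 2);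
       (nq 2 1, [:: Fx 0 0; Crd ip], [::], 6);
       (nq 3 1, [:: Fx 0 0; Crd iy], [::], 7);
       (fq 3 2, [:: Crd iq], [::], 7);
       (nq 2 1, [:: Crd ip], [::], 9)]);
  (jsubst ix symmetry_term (killing_eq ix ip),
     [:: (nq 2 1, [::], [::], 1);
       (fq 1 2, [:: Crd iq], [::], 6);
       (nq 2 1, [:: Crd ip], [::], 7)]);
  (jsubst ix symmetry_term (killing_eq ix iq),
     [:: (fq 3 2, [::], [::], 0);
       (nq 3 2, [:: Crd ip], [::], 6);
       (fq 3 2, [:: Crd iy], [::], 7)]);
  (jsubst ix symmetry_term (killing_eq ix iz),
     [:: (nq 3 2, [::], [::], 6)]);
  (jsubst ix symmetry_term (killing_eq iy iy),
     [:: (nq 3 1, [::], [::], 9)]);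
  (jsubst ix symmetry_term (killing_eq iy ip),
     [::]);
  (jsubst ix symmetry_term (killing_eq iy iq),
     [::]);
  (jsubst ix symmetry_term (killing_eq iy iz),
     [::]);
  (jsubst ix symmetry_term (killing_eq ip ip),
     [::]);
  (jsubst ix symmetry_term (killing_eq ip iq),
     [::]);
  (jsubst ix symmetry_term (killing_eq ip iz),
     [::]);
  (jsubst ix symmetry_term (killing_eq iq iq),
     [::]);
  (jsubst ix symmetry_term (killing_eq iq iz),
     [::]);
  (jsubst ix symmetry_term (killing_eq iz iz),
     [::])].

Lemma symmetry_derivation : derivation ix symmetry_eqs symmetry_facts.
Proof. by vm_compute. Qed.

Lemma killing_eq_sym : check2 (fun i j => deq (killing_eq i j) (killing_eq j i)).
Proof. by vm_compute. Qed.

Lemma index_pairs_mem : check2 (fun i j => ((i, j) \in index_pairs) || ((j, i) \in index_pairs)).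
Proof. by vm_compute. Qed.

End KillingTerms.

Lemma holds_all_map (R : realType) (fx : nat -> R -> R) fj (U : set 'rV[R]_5)
    (T : eqType) (E : T -> dterm5) (s : seq T) :
  holds_all ix fx fj U [seq E t | t <- s] <-> (forall t, t \in s -> holds ix fx fj U (E t)).
Proof.
elim: s => [|t s IHs]; first by split.
split=> [[Ht /IHs Hs] r|H].
  by rewrite inE => /orP[/eqP->//|]; exact: Hs.
split; first by apply: H; rewrite mem_head.
by apply/IHs => r rs; apply: H; rewrite inE rs orbT.
Qed.

Definition o6 (k : nat) : 'I_6 := inord k.

Lemma ord6_ind (P : 'I_6 -> Prop) : P (o6 0) -> P (o6 1) -> P (o6 2) -> P (o6 3) ->
  P (o6 4) -> P (o6 5) -> forall i, P i.
Proof.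
move=> P0 P1 P2 P3 P4 P5 i.
have E : i = o6 i by rewrite /o6 inord_val.
by rewrite E; case: i {E} => [[|[|[|[|[|[|//]]]]]] lt].
Qed.

Lemma sum6 (V : nmodType) (F : 'I_6 -> V) : \sum_(k < 6) F k =
  F (o6 0) + (F (o6 1) + (F (o6 2) + (F (o6 3) + (F (o6 4) + F (o6 5))))).
Proof.
rewrite !big_ord_recl big_ord0 addr0.
by do 5?[congr (_ + _)]; congr F; apply: val_inj; rewrite /= inordK.
Qed.

(** * The form of a conformal Killing field *)

Section Killing.
Variables (R : realType) (J : set R) (I : R -> R) (x0 : R).
Hypotheses (oJ : open J) (iJ : is_interval J) (sI : smooth1_on J I) (Jx0 : J x0).
Local Notation V := 'rV[R]_5.
Local Notation M := (M_of J).
Local Notation g := (g_of I).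

Definition symmetry_matrix (i j : 'I_6) : R -> R :=
  match nat_of_ord i, nat_of_ord j with
  | 0%N, 1%N | 0%N, 5%N | 2%N, 3%N => cst 1
  | 1%N, 2%N => cst (1 / 4)
  | 1%N, 4%N => cst (- (3 / 4))
  | 2%N, 1%N => cst (10 / 3) * I
  | 2%N, 5%N => cst 2 * I
  | 3%N, 0%N => derive1n 2 I + (cst (-1) + cst (-1) * (I * I))
  | 4%N, 3%N => cst (-1)
  | 4%N, 1%N | 4%N, 5%N => cst (- (10 / 3)) * I
  | 5%N, 2%N | 5%N, 4%N => cst (- (1 / 4))
  | _, _ => cst 0
  end.

Lemma symmetry_matrix_smooth i j : smooth1_on J (symmetry_matrix i j).
Proof.
have sc (c : R) : smooth1_on J (cst c) := @smooth1_cst R J oJ c.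
have sM (c : R) f : smooth1_on J f -> smooth1_on J (cst c * f).
  by move=> sf; exact: (smooth1_mul oJ (sc c) sf).
have s3 : smooth1_on J (derive1n 2 I + (cst (-1) + cst (-1) * (I * I))).
  exact: (smooth1_add oJ (smooth1_derive1n (k := 2) sI)
           (smooth1_add oJ (sc (-1)) (sM (-1) _ (smooth1_mul oJ sI sI)))).
rewrite /symmetry_matrix.
move: (nat_of_ord i) (nat_of_ord j) => [|[|[|[|[|[|k]]]]]] [|[|[|[|[|[|l]]]]]];
  lazymatch goal with
  | |- smooth1_on _ (cst ?c) => exact: (sc c)
  | |- smooth1_on _ (cst ?c * I) => exact: (sM c I sI)
  | |- _ => exact: s3
  end.
Qed.

Lemma symmetry_matrix_continuous i j x : J x -> {for x, continuous (symmetry_matrix i j)}.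
Proof. by move=> Jx; exact: (smooth1_continuous (@symmetry_matrix_smooth i j) Jx). Qed.

Local Notation is_sol := (ode_solution J symmetry_matrix).

(** Valid for any terms [S] that evaluate to the unknowns; it is used with the reduced terms of a
    given field and with the function symbols of a given solution. *)
Lemma symmetry_lin (Y : 'I_6 -> R -> R) fx fj (S : nat -> dterm5) u i : fx 0 = I ->
  (forall k, deval ix fx fj (S (nat_of_ord k)) u = Y k (u 0 ix)) ->
  lin symmetry_matrix Y i (u 0 ix) = deval ix fx fj (symmetry_rhs S i) u.
Proof.
move=> fxI SY.
have SE k : (k < 6)%N -> deval ix fx fj (S k) u = Y (o6 k) (u 0 ix).
  by move=> k6; rewrite -SY inordK.
rewrite /lin sum6; elim/ord6_ind: i; rewrite /symmetry_matrix /symmetry_rhs !inordK//=.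
all: rewrite ?(devalE, deval_fr, SE)// ?fxI ?fctE /=.
all: by field.
Qed.

(** The part with [c1] is the homothety: the metric is homogeneous of degree 2 when x, y, p, q, z
    have the weights 0, 1, 1, 1, 2, which also explains the conformal factor [2 * c1]. *)
Definition symmetry_field (c0 c1 c2 : R) (Y : 'I_6 -> R -> R) (u : V) : V :=
  \row_j nth 0 [:: c0; c1 * u 0 iy + Y (o6 0) (u 0 ix); c1 * u 0 ip + Y (o6 1) (u 0 ix);
    c1 * u 0 iq + Y (o6 2) (u 0 ix);
    2 * c1 * u 0 iz + (Y (o6 3) (u 0 ix) * u 0 iy + (Y (o6 4) (u 0 ix) * u 0 ip
      + (Y (o6 5) (u 0 ix) * u 0 iq + c2)))] j.

(** Soundness concerns a family indexed by all of [nat], so past 6 the default [ix] of [nth] repeats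
    the x-component. This agrees with the last case of [symmetry_term]. *)
Definition killing_jets (xi : V -> V) (la : V -> R) (k : nat) : V -> R :=
  match k with
  | 0%N => cst 1
  | 6%N => la
  | k'.+1 => fun u => xi u 0 (nth ix ords5 k')
  end.

Lemma killing_jets_comp xi la (k : 'I_5) : killing_jets xi la (nat_of_ord k).+1 = fun u => xi u 0 k.
Proof. by elim/ord5_ind: k. Qed.

Lemma killing_jets_smooth xi la k : smooth_field_on M xi -> smooth_on M la ->
  smooth_on M (killing_jets xi la k).
Proof.
move=> sx sl; have s1 : smooth_on M (cst (1 : R)) by apply: smooth_cst; exact: open_M_of.
case: k => [|[|[|[|[|[|[|k]]]]]]]; first exact: s1.
- exact: (sx ix).
- exact: (sx iy).
- exact: (sx ip).
- exact: (sx iq).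
- exact: (sx iz).
- exact: sl.
- exact: (sx (nth ix ords5 k.+3.+3)).
Qed.

Lemma lie_term fx xi la i j u : (forall k, smooth1_on J (fx k)) -> fx 0 = I ->
  smooth_field_on M xi -> smooth_on M la -> M u ->
  lie_derivative xi g u i j - la u * g u i j =
  deval ix fx (killing_jets xi la) (killing_eq i j) u.
Proof.
move=> fxs fxI sx sl Mu.
have oM : open M by exact: open_M_of.
have MJ v : M v -> J (v 0 ix) by [].
have js k : smooth_on M (killing_jets xi la k) by exact: killing_jets_smooth.
have j0 v : M v -> killing_jets xi la 0 v != 0 by move=> _; exact: oner_neq0.
have gE a b v : M v -> g v a b = deval ix fx (killing_jets xi la) (g_term a b) v.
  by move=> Mv; exact: (g_of_term oM MJ fxs js j0 fxI).
rewrite mxE /killing_eq.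
have -> : deval ix fx (killing_jets xi la)
   (Add (dsum (fun k => Add (Mul (At (Jet (nat_of_ord k).+1 [::])) (dD ix k (g_term i j)))
      (Add (Mul (g_term k j) (At (Jet (nat_of_ord k).+1 [:: i])))
           (Mul (g_term i k) (At (Jet (nat_of_ord k).+1 [:: j]))))))
     (Mul (Cst qm1) (Mul (At (Jet 6 [::])) (g_term i j)))) u
  = \sum_(k < 5) (xi u 0 k * deval ix fx (killing_jets xi la) (dD ix k (g_term i j)) u
      + (deval ix fx (killing_jets xi la) (g_term k j) u * partial i (fun v => xi v 0 k) u
       + deval ix fx (killing_jets xi la) (g_term i k) u * partial j (fun v => xi v 0 k) u))
    - la u * deval ix fx (killing_jets xi la) (g_term i j) u.
  move: (g_term) => G.
  rewrite devalE (deval_dsum fx) !devalE mulN1r; congr (_ - _); apply: eq_bigr => k _.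
  by move: (dD ix k (G i j)) => dG; rewrite !devalE killing_jets_comp.
rewrite (gE i j u Mu); congr (_ - _); apply: eq_bigr => k _.
rewrite (partial_term oM MJ fxs js j0 k Mu (gE i j)) (gE k j u Mu) (gE i k u Mu).
by rewrite addrA.
Qed.

Let fxI (k : nat) : R -> R := I.

Lemma const_on (f : V -> R) : smooth_on M f -> (forall i u, M u -> partial i f u = 0) ->
  forall u, M u -> f u = f (axis x0).
Proof.
move=> sf f0 u Mu; rewrite (only_x sf (fun i _ => f0 i) Mu).
apply: (derive0_cst (f := fun t => f (axis t)) iJ _ Mu Jx0) => t Jt.
by have := is_derive_axis sf Jt; rewrite f0//; exact: M_of_axis.
Qed.

(** The constants and the functions of x are read off along [axis], on which y, p, q, z vanish; the
    derived facts guarantee that these values determine the field on all of [M]. *)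
Lemma killing_form xi : conformal_killing_fields M g xi ->
  exists c0 c1 c2 Y, [/\ is_sol Y, forall x, J x -> derive1n 1 I x * c0 = 0 &
    forall u, M u -> xi u = symmetry_field c0 c1 c2 Y u].
Proof.
move=> [sx [la sl lieE]].
have oM : open M by exact: open_M_of.
have MJ v : M v -> J (v 0 ix) by [].
have js k : smooth_on M (killing_jets xi la k) by exact: killing_jets_smooth.
have j0 v : M v -> killing_jets xi la 0 v != 0 by move=> _; exact: oner_neq0.
pose fj := killing_jets xi la.
have H0 : holds_all ix fxI fj M killing_eqs.
  apply/holds_all_map => t _ u Mu.
  rewrite -(lie_term t.1 t.2 (fun=> sI) (erefl : fxI 0 = I) sx sl Mu).
  by rewrite lieE// mxE subrr.
have H1 := holds_derivation oM MJ (fun=> sI) js j0 H0 killing_derivation.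
(* Skips the auxiliary lemmas, so that [H] is numbered like [killing_facts]. *)
have H k : holds ix fxI fj M (nth (Cst qz) (map fst killing_facts) k).
  have := holds_nth (size killing_lemmas + k) H1.
  by rewrite map_cat nth_cat size_map ltnNge leq_addr /= addKn.
pose rd k := deval ix fxI fj (reduced_term k).
have srd k : smooth_on M (rd k) by exact: (deval_smooth oM MJ (fun=> sI) js j0).
have sv : smooth_on M (deval ix fxI fj vertical_term).
  exact: (deval_smooth oM MJ (fun=> sI) js j0).
have Pd e i u : M u -> partial i (deval ix fxI fj e) u = deval ix fxI fj (dD ix i e) u.
  by move=> Mu; exact: (partial_deval oM MJ (fun=> sI) js j0).
have al_cst u : M u -> xi u 0 ix = xi (axis x0) 0 ix.
  apply: (const_on (f := fun u => xi u 0 ix) (js 1%N)).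
  by elim/ord5_ind => v Mv; [exact: (H 0%N v Mv)|exact: (H 1%N v Mv)|exact: (H 2%N v Mv)
     |exact: (H 3%N v Mv)|exact: (H 4%N v Mv)].
have la_cst u : M u -> la u = la (axis x0).
  apply: (const_on (f := la) sl).
  by elim/ord5_ind => v Mv; [exact: (H 5%N v Mv)|exact: (H 6%N v Mv)|exact: (H 7%N v Mv)
     |exact: (H 8%N v Mv)|exact: (H 9%N v Mv)].
have ve_cst u : M u -> deval ix fxI fj vertical_term u = deval ix fxI fj vertical_term (axis x0).
  apply: (const_on sv).
  by elim/ord5_ind => v Mv; rewrite Pd//; [exact: (H 35%N v Mv)|exact: (H 36%N v Mv)
     |exact: (H 37%N v Mv)|exact: (H 38%N v Mv)|exact: (H 39%N v Mv)].
have rd_axis (k : 'I_6) u : M u -> rd k u = rd k (axis (u 0 ix)).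
  move=> Mu; apply: (only_x (srd k) _ Mu) => i + v Mv; rewrite Pd//.
  elim/ord6_ind: k; rewrite inordK//; elim/ord5_ind: i => // _;
  [exact: (H 11%N v Mv)|exact: (H 12%N v Mv)|exact: (H 13%N v Mv)|exact: (H 14%N v Mv)
  |exact: (H 15%N v Mv)|exact: (H 16%N v Mv)|exact: (H 17%N v Mv)|exact: (H 18%N v Mv)
  |exact: (H 19%N v Mv)|exact: (H 20%N v Mv)|exact: (H 21%N v Mv)|exact: (H 22%N v Mv)
  |exact: (H 23%N v Mv)|exact: (H 24%N v Mv)|exact: (H 25%N v Mv)|exact: (H 26%N v Mv)
  |exact: (H 27%N v Mv)|exact: (H 28%N v Mv)|exact: (H 29%N v Mv)|exact: (H 30%N v Mv)
  |exact: (H 31%N v Mv)|exact: (H 32%N v Mv)|exact: (H 33%N v Mv)|exact: (H 34%N v Mv)].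
pose Y (k : 'I_6) x := rd k (axis x).
have rdE k u : (k < 6)%N -> M u -> rd k u = Y (o6 k) (u 0 ix).
  by move=> k6 Mu; rewrite /Y -{1}(inordK k6) rd_axis// inordK.
(* The conformal factor of a symmetry is [2 * c1], hence [c1] is half of it. *)
exists (xi (axis x0) 0 ix), (la (axis x0) / 2), (deval ix fxI fj vertical_term (axis x0)), Y.
split.
- move=> k x Jx; have Mx := M_of_axis Jx.
  have := is_derive_axis (srd k) Jx.
  suff -> : partial ix (rd k) (axis x) = lin symmetry_matrix Y k x by [].
  have yE (l : 'I_6) : deval ix fxI fj (reduced_term l) (axis x) = Y l (axis x 0 ix).
    by rewrite /Y axis_ix.
  have := @symmetry_lin Y fxI fj reduced_term (axis x) k erefl yE.
  rewrite axis_ix Pd// => ->.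
  apply/eqP; rewrite -subr_eq0; apply/eqP.
  have E l : deval ix fxI fj (Add (dD ix ix (reduced_term l))
      (Mul (Cst qm1) (symmetry_rhs reduced_term l))) (axis x)
     = deval ix fxI fj (dD ix ix (reduced_term l)) (axis x)
       - deval ix fxI fj (symmetry_rhs reduced_term l) (axis x).
    by move: (dD ix ix (reduced_term l)) (symmetry_rhs reduced_term l) => a b; rewrite !devalE mulN1r.
  rewrite -E; elim/ord6_ind: k; rewrite inordK//.
  + exact: (H 40%N _ Mx).
  + exact: (H 41%N _ Mx).
  + exact: (H 42%N _ Mx).
  + exact: (H 43%N _ Mx).
  + exact: (H 44%N _ Mx).
  + exact: (H 45%N _ Mx).
- move=> x Jx; rewrite -(al_cst (axis x) (M_of_axis Jx)).
  by have := H 10%N _ (M_of_axis Jx); rewrite [nth _ _ _]/= !devalE axis_ix.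
- move=> u Mu; apply/rowP.
  have r0 := rdE 0%N u isT Mu; have r1 := rdE 1%N u isT Mu; have r2 := rdE 2%N u isT Mu.
  have r3 := rdE 3%N u isT Mu; have r4 := rdE 4%N u isT Mu; have r5 := rdE 5%N u isT Mu.
  have l0 := la_cst u Mu.
  have v0 := ve_cst u Mu.
  elim/ord5_ind; rewrite mxE /=.
  + exact: al_cst.
  + by rewrite -r0 /rd /reduced_term !devalE deval_fr /= -l0; field.
  + by rewrite -r1 /rd /reduced_term !devalE deval_fr /= -l0; field.
  + by rewrite -r2 /rd /reduced_term !devalE deval_fr /= -l0; field.
  + rewrite -v0 -r3 -r4 -r5 /rd /reduced_term /vertical_term !devalE /= -l0.
    by field.
Qed.

End Killing.

(** * Fields of the given form are conformal Killing fields *)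

Section Symmetries.
Variables (R : realType) (J : set R) (I : R -> R) (x0 : R).
Hypotheses (oJ : open J) (iJ : is_interval J) (sI : smooth1_on J I) (Jx0 : J x0).
Local Notation V := 'rV[R]_5.
Local Notation M := (M_of J).
Local Notation g := (g_of I).
Local Notation is_sol := (ode_solution J (symmetry_matrix I)).

(** The conformal factor is the constant [2 * c1]. On [M] the components of [f] are values of
    [symmetry_term], so the Killing equations may be checked after substitution, where
    [symmetry_derivation] applies. *)
Lemma symmetry_killing c0 c1 c2 Y (f : V -> V) : is_sol Y ->
  (forall x, J x -> c0 * derive1n 1 I x = 0) ->
  (forall u, M u -> f u = symmetry_field c0 c1 c2 Y u) ->
  conformal_killing_fields M g f.
Proof.
move=> sY c0I fE.
have oM : open M by exact: open_M_of.
have MJ v : M v -> J (v 0 ix) by [].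
have Ys k : smooth1_on J (Y k).
  exact: (ode_solution_smooth oJ (symmetry_matrix_smooth oJ sI) sY).
pose fx (k : nat) : R -> R :=
  match k with
  | 0%N => I | 7%N => cst c0 | 8%N => cst c1 | 9%N => cst c2 | k'.+1 => Y (o6 k')
  end.
have cs (c : R) : smooth1_on J (cst c) := @smooth1_cst R J oJ c.
have fxs k : smooth1_on J (fx k).
  by move: k => [|[|[|[|[|[|[|[|[|[|k]]]]]]]]]];
    [exact: sI|exact: Ys|exact: Ys|exact: Ys|exact: Ys|exact: Ys|exact: Ys
    |exact: cs|exact: cs|exact: cs|exact: Ys].
pose la : V -> R := cst (2 * c1).
have s1 (c : R) : smooth_on M (cst c) by exact: smooth_cst.
have fE' (fj : nat -> V -> R) (i : 'I_5) u : M u ->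
    f u 0 i = deval ix fx fj (symmetry_term (nat_of_ord i).+1) u.
  move=> Mu; rewrite fE// mxE.
  by elim/ord5_ind: i; rewrite /= !devalE ?deval_fr /= ?divr1.
have sf : smooth_field_on M f.
  move=> i; apply: (@eq_smooth _ _ M (deval ix fx (fun=> cst 1) (symmetry_term (nat_of_ord i).+1)) _ oM).
    by move=> u Mu; rewrite (fE' (fun=> cst 1) i u Mu).
  by apply: (deval_smooth oM MJ fxs (fun=> s1 1)) => u _; exact: oner_neq0.
split; first exact: sf.
exists la; first exact: s1.
pose fj := killing_jets f la.
have js k : smooth_on M (fj k) by apply: (killing_jets_smooth oJ); [exact: sf | exact: s1].
have j0 v : M v -> fj 0 v != 0 by move=> _; exact: oner_neq0.
have dY (k : 'I_6) x : J x -> (Y k)^`()%classic x = lin (symmetry_matrix I) Y k x.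
  by move=> Jx; have [_] := sY k x Jx; rewrite derive1E.
have H0 : holds_all ix fx fj M symmetry_eqs.
  have HY (k : 'I_6) : holds ix fx fj M
      (Add (At (Fx k.+1 1)) (Mul (Cst qm1) (symmetry_rhs (fun l => At (Fx l.+1 0)) k))).
    move=> u Mu.
    have yE (l : 'I_6) : deval ix fx fj (At (Fx l.+1 0)) u = Y l (u 0 ix).
      by rewrite devalE; elim/ord6_ind: l; rewrite inordK.
    have := @symmetry_lin R I Y fx fj (fun l => At (Fx l.+1 0)) u k erefl yE.
    move: (symmetry_rhs _ _) => e E; rewrite !devalE -E mulN1r.
    have -> : fx k.+1 = Y k by elim/ord6_ind: k {E}; rewrite inordK.
    by rewrite /derive1n /= dY ?subrr//.
  have D0 (c : R) x : derive1n 1 (cst c : R -> R) x = 0 by rewrite /derive1n/= derive1_cst.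
  split; first by have := HY (o6 0); rewrite inordK.
  split; first by have := HY (o6 1); rewrite inordK.
  split; first by have := HY (o6 2); rewrite inordK.
  split; first by have := HY (o6 3); rewrite inordK.
  split; first by have := HY (o6 4); rewrite inordK.
  split; first by have := HY (o6 5); rewrite inordK.
  split; first by move=> u Mu; rewrite devalE D0.
  split; first by move=> u Mu; rewrite devalE D0.
  split; first by move=> u Mu; rewrite devalE D0.
  split=> // u Mu; rewrite !devalE; exact: c0I.
have H1 := holds_derivation oM MJ fxs js j0 H0 symmetry_derivation.
have zE k v : M v -> fj k v = deval ix fx fj (symmetry_term k) v.
  move=> Mv; move: k => [|[|[|[|[|[|[|k]]]]]]].
  - by rewrite devalE.
  - exact: (fE' fj ix).
  - exact: (fE' fj iy).
  - exact: (fE' fj ip).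
  - exact: (fE' fj iq).
  - exact: (fE' fj iz).
  - by rewrite /= !devalE deval_fr /= divr1.
  - by rewrite -[RHS](fE' fj ix v Mv) /=; case: k.
have H t : t \in index_pairs -> holds ix fx fj M (killing_eq t.1 t.2).
  move=> tI u Mu; rewrite -(deval_jsubst oM MJ fxs js j0 _ zE)//.
  have : holds_all ix fx fj M [seq jsubst ix symmetry_term (killing_eq t.1 t.2) | t <- index_pairs].
    exact: H1.
  by move=> /holds_all_map/(_ t tI); apply.
have Hs i j : holds ix fx fj M (killing_eq i j).
  move=> u Mu; have /orP[ij|ji] := check2P index_pairs_mem i j.
    exact: (@H (i, j) ij u Mu).
  by rewrite (deval_eq ix fx fj (check2P killing_eq_sym i j) u) (@H (j, i) ji u Mu).
move=> u Mu; apply/matrixP => i j; apply/eqP; rewrite [X in _ == X]mxE -subr_eq0; apply/eqP.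
rewrite (lie_term oJ i j fxs erefl sf (s1 (2 * c1)) Mu); exact: (@Hs i j u Mu).
Qed.

End Symmetries.

(** * Dimension of the symmetry algebra *)

Section KillingDimension.
Variables (R : realType) (J : set R) (I : R -> R) (x0 : R).
Hypotheses (oJ : open J) (iJ : is_interval J) (sI : smooth1_on J I) (Jx0 : J x0).
Local Notation V := 'rV[R]_5.
Local Notation M := (M_of J).
Local Notation g := (g_of I).
Local Notation is_sol := (ode_solution J (symmetry_matrix I)).
Local Notation F := (fundamental (symmetry_matrix I) x0).

Lemma symmetry_field_sum d (k a b e : 'I_d -> R) (Y : 'I_d -> 'I_6 -> R -> R) u :
  \sum_i k i *: symmetry_field (a i) (b i) (e i) (Y i) u =
  symmetry_field (\sum_i k i * a i) (\sum_i k i * b i) (\sum_i k i * e i)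
    (fun l x => \sum_i k i * Y i l x) u.
Proof.
apply/rowP; elim/ord5_ind; rewrite summxE mxE /=;
  rewrite ?mulr_sumr ?mulr_suml ?mulr_suml -?big_split; apply: eq_bigr => i _;
  by rewrite !mxE /=; ring.
Qed.

(** The value at [axis x0] yields [c0], [c2] and the first three functions at [x0]; a unit step
    along y, p or q isolates [c1] and the three coefficients of the z-component. *)
Lemma symmetry_field_eq0 c0 c1 c2 (Y : 'I_6 -> R -> R) :
  (forall u, M u -> symmetry_field c0 c1 c2 Y u = 0) ->
  [/\ c0 = 0, c1 = 0, c2 = 0 & forall l, Y l x0 = 0].
Proof.
move=> E0.
have E (i : 'I_5) (v : V) : v 0 ix = x0 -> symmetry_field c0 c1 c2 Y v 0 i = 0.
  by move=> vx; rewrite E0 ?mxE// /M_of /= vx.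
pose pt (j : 'I_5) : V := axis x0 + delta_mx 0 j.
have ptx (j : 'I_5) : j != ix -> pt j 0 ix = x0.
  by move=> jx; rewrite !mxE eqxx /= eq_sym (negbTE jx) mulr1 addr0.
have := E ix _ (axis_ix x0); have := E iy _ (axis_ix x0); have := E ip _ (axis_ix x0).
have := E iq _ (axis_ix x0); have := E iz _ (axis_ix x0).
have := E iy _ (ptx iy isT); have := E iz _ (ptx iy isT).
have := E iz _ (ptx ip isT); have := E iz _ (ptx iq isT).
rewrite !mxE /= ?(mulr0, mulr1, add0r, addr0).
move=> e1 e2 e3 e4 e5 e6 e7 e8 e9.
have c2E : c2 = 0 by [].
move: e1 e2 e3 e4; rewrite c2E e8 !addr0 => e1 e2 e3 e4.
by split=> //; elim/ord6_ind.
Qed.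

Variable m : nat.
Hypotheses (m_ge2 : (1 < m)%N) (m_le3 : (m <= 3)%N).

(** Both cases of the dimension formula are covered by [m], equal to 2 or 3. The extra parameters
    are ordered [c1], [c2], [c0], so that the translation in x has the last index, 2, and is present
    exactly for [m = 3]. *)
Definition translation_coef (t : nat) (i : 'I_(6 + m)) : R :=
  if fintype.split i is inr j then (nat_of_ord j == t)%:R else 0.

Definition solution_part (i : 'I_(6 + m)) : 'I_6 -> R -> R :=
  if fintype.split i is inl k then F k else fun _ _ => 0.

Definition killing_basis (i : 'I_(6 + m)) : V -> V :=
  symmetry_field (translation_coef 2 i) (translation_coef 0 i) (translation_coef 1 i)
    (solution_part i).

Lemma solution_part_sol i : is_sol (solution_part i).
Proof.
rewrite /solution_part; case: (fintype.split i) => [k|_]; last exact: ode_solution0.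
exact: (picard_sol_solution oJ iJ (symmetry_matrix_continuous oJ sI) Jx0).
Qed.

Lemma sum_translation_coef (c : 'I_(6 + m) -> R) t :
  \sum_i c i * translation_coef t i = \sum_(j < m) c (rshift 6 j) * (nat_of_ord j == t)%:R.
Proof.
rewrite big_split_ord /= big1 ?add0r => [|k _]; last first.
  by rewrite /translation_coef (unsplitK (inl k)) mulr0.
by apply: eq_bigr => j _; rewrite /translation_coef (unsplitK (inr j)).
Qed.

Lemma sum_pick (c : 'I_m -> R) (j : 'I_m) :
  \sum_(i < m) c i * (nat_of_ord i == nat_of_ord j)%:R = c j.
Proof.
rewrite (bigD1 j)//= eqxx mulr1 big1 ?addr0// => i ij.
by rewrite (_ : (_ == _) = false) ?mulr0//; apply/negbTE.
Qed.

Lemma sum_solution_part (c : 'I_(6 + m) -> R) l x :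
  \sum_i c i * solution_part i l x = \sum_(k < 6) c (lshift m k) * F k l x.
Proof.
rewrite big_split_ord /= [X in _ + X]big1 ?addr0 => [|j _]; last first.
  by rewrite /solution_part (unsplitK (inr j)) mulr0.
by apply: eq_bigr => k _; rewrite /solution_part (unsplitK (inl k)).
Qed.

Lemma fundamental_x0 k l : F k l x0 = (l == k)%:R.
Proof. exact: (fundamental_init oJ iJ (symmetry_matrix_continuous oJ sI) Jx0). Qed.

Lemma killing_basis_free (c : 'I_(6 + m) -> R) :
  (forall u, M u -> \sum_i c i *: killing_basis i u = 0) -> forall i, c i = 0.
Proof.
move=> c0; have [] := @symmetry_field_eq0 (\sum_i c i * translation_coef 2 i)
  (\sum_i c i * translation_coef 0 i) (\sum_i c i * translation_coef 1 i)
  (fun l x => \sum_i c i * solution_part i l x).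
  by move=> u Mu; rewrite -symmetry_field_sum; exact: c0.
rewrite !sum_translation_coef => t2 t0 t1 Y0 i.
rewrite -[i]splitK; case: (fintype.split i) => [k|j] /=.
  have := Y0 k; rewrite sum_solution_part (bigD1 k)//= big1 ?addr0 => [|l lk].
    by rewrite fundamental_x0 eqxx mulr1; exact.
  by rewrite fundamental_x0 eq_sym (negbTE lk) mulr0.
rewrite -(sum_pick (fun j => c (rshift 6 j)) j).
have : (j < 3)%N by exact: leq_trans (ltn_ord j) m_le3.
by case: (nat_of_ord j) => [|[|[|//]]].
Qed.

Hypothesis translations : forall c0, (forall x, J x -> derive1n 1 I x * c0 = 0) <->
  (m = 2%N -> c0 = 0).

(** The coordinates of a field are the six initial values of its [Y] at [x0] followed by its
    constants; [translations] says when [c0] counts as one of them. *)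
Lemma killing_dim : has_dim_on M (conformal_killing_fields M g) (6 + m).
Proof.
exists killing_basis; split; first exact: killing_basis_free.
move=> f; split=> [/(killing_form oJ iJ sI Jx0)[c0 [c1 [c2 [Y [sY c0I fE]]]]]|[c fE]].
  pose c (i : 'I_(6 + m)) : R := match fintype.split i with
    | inl k => Y k x0 | inr j => nth 0 [:: c1; c2; c0] j end.
  exists c => u Mu; rewrite fE// symmetry_field_sum.
  have cr (j : 'I_m) : c (rshift 6 j) = nth 0 [:: c1; c2; c0] j by rewrite /c (unsplitK (inr j)).
  have cl (k : 'I_6) : c (lshift m k) = Y k x0 by rewrite /c (unsplitK (inl k)).
  have E t : (t < m)%N -> \sum_i c i * translation_coef t i = nth 0 [:: c1; c2; c0] t.
    by move=> tm; rewrite sum_translation_coef (sum_pick (fun j => c (rshift 6 j)) (Ordinal tm)) cr.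
  (* For [m = 2] no index below [m] equals 2, so the sum is 0, and [translations] forces [c0 = 0] as
     well. *)
  have E2 : \sum_i c i * translation_coef 2 i = c0.
    have [m2|m3] := leqP m 2; last exact: E.
    have m2E : m = 2%N by apply/eqP; rewrite eqn_leq m2.
    rewrite ((translations c0).1 c0I m2E) sum_translation_coef big1// => j _.
    have jm : (j < 2)%N by exact: leq_trans (ltn_ord j) m2.
    by rewrite (_ : (_ == _) = false) ?mulr0//; apply/negbTE; rewrite neq_ltn jm.
  rewrite E2 !E//; last by exact: ltnW.
  have YE l : Y l (u 0 ix) = \sum_i c i * solution_part i l (u 0 ix).
    rewrite sum_solution_part.
    rewrite (ode_solution_span oJ iJ (symmetry_matrix_continuous oJ sI) Jx0 sY l Mu).
    by apply: eq_bigr => k _; rewrite cl.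
  by rewrite /symmetry_field !YE.
apply: (symmetry_killing oJ sI (c0 := \sum_i c i * translation_coef 2 i)
  (c1 := \sum_i c i * translation_coef 0 i) (c2 := \sum_i c i * translation_coef 1 i)
  (Y := fun l x => \sum_i c i * solution_part i l x)).
- exact: (ode_solution_sum c solution_part_sol).
- move=> x Jx; rewrite mulrC; apply: (translations _).2 x Jx => m2.
  rewrite sum_translation_coef big1// => j _.
  have jm : (j < 2)%N by rewrite -m2.
  by rewrite (_ : (_ == _) = false) ?mulr0//; apply/negbTE; rewrite neq_ltn jm.
- by move=> u Mu; rewrite fE// symmetry_field_sum.
Qed.

End KillingDimension.

(** * Dimension of the space of scales *)

Section ScaleDimension.
Variables (R : realType) (J : set R) (I : R -> R) (x0 : R).
Hypotheses (oJ : open J) (iJ : is_interval J) (sI : smooth1_on J I) (Jx0 : J x0).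
Local Notation V := 'rV[R]_5.
Local Notation M := (M_of J).

(** Companion matrix of the scale equation, the unknowns being s and s'. *)
Definition scale_matrix (i j : 'I_2) : R -> R :=
  match nat_of_ord i, nat_of_ord j with
  | 0%N, 1%N => cst 1
  | 1%N, 0%N => cst 3^-1 * I
  | _, _ => cst 0
  end.

Local Notation is_sol := (ode_solution J scale_matrix).
Local Notation F := (fundamental scale_matrix x0).

Lemma scale_matrix_smooth i j : smooth1_on J (scale_matrix i j).
Proof.
have sc (c : R) : smooth1_on J (cst c) := @smooth1_cst R J oJ c.
rewrite /scale_matrix; move: (nat_of_ord i) (nat_of_ord j) => [|[|k]] [|[|l]];
  lazymatch goal with
  | |- smooth1_on _ (cst ?c) => exact: (sc c)
  | |- _ => exact: (smooth1_mul oJ (sc _) sI)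
  end.
Qed.

Lemma scale_matrix_continuous i j x : J x -> {for x, continuous (scale_matrix i j)}.
Proof. by move=> Jx; exact: (smooth1_continuous (@scale_matrix_smooth i j) Jx). Qed.

Lemma scale_lin (Y : 'I_2 -> R -> R) x :
  (lin scale_matrix Y ord0 x = Y ord_max x) *
  (lin scale_matrix Y ord_max x = 3^-1 * I x * Y ord0 x).
Proof.
rewrite /lin !big_ord_recl !big_ord0 (_ : lift ord0 ord0 = ord_max); last exact: val_inj.
by rewrite /scale_matrix /= ?fctE !(mul0r, mul1r, add0r, addr0).
Qed.

Lemma ord2_ind (P : 'I_2 -> Prop) : P ord0 -> P ord_max -> forall i, P i.
Proof.
move=> P0 P1 [[|[|//]] lt]; first by rewrite (_ : Ordinal lt = ord0)//; exact: val_inj.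
by rewrite (_ : Ordinal lt = ord_max)//; exact: val_inj.
Qed.

Lemma fundamental_scale_sol k : is_sol (F k).
Proof. exact: (picard_sol_solution oJ iJ scale_matrix_continuous Jx0). Qed.

Lemma scale_dim : has_dim_on (W := R^o) M (scale_solutions I J) 2.
Proof.
exists (fun k u => F k ord0 (u 0 ix)); split=> [c c0|f].
  pose Z (l : 'I_2) x := \sum_k c k * F k l x.
  have sZ : is_sol Z by exact: (ode_solution_sum c fundamental_scale_sol).
  have Z0 x : J x -> Z ord0 x = 0.
    by move=> Jx; have := c0 _ (M_of_axis Jx); rewrite axis_ix.
  (* The relation on [M] only concerns component 0; component 1 is its derivative, hence zero on the
     open set [J] too. *)
  have Z1 x : J x -> Z ord_max x = 0.
    move=> Jx; rewrite -(scale_lin Z x).1 -(@derive_val _ _ _ _ _ _ _ (sZ ord0 x Jx)).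
    rewrite (near_eq_derive (1 : R) (near_J (g := cst 0) oJ Z0 Jx)).
    exact: derive_cst.
  have Zc k : Z k x0 = c k.
    rewrite /Z (bigD1 k)//= (fundamental_init oJ iJ scale_matrix_continuous Jx0) eqxx mulr1.
    rewrite big1 ?addr0// => l lk.
    by rewrite (fundamental_init oJ iJ scale_matrix_continuous Jx0) eq_sym (negbTE lk) mulr0.
  by elim/ord2_ind; rewrite -Zc; [exact: Z0 | exact: Z1].
split=> [[s [ss sE fE]]|[c fE]].
  pose Y (l : 'I_2) : R -> R := if l == ord0 then s else derive1n 1 s.
  have sY : is_sol Y.
    elim/ord2_ind => x Jx; rewrite scale_lin.
      exact: (smooth1_is_derive 0 ss Jx).
    have := smooth1_is_derive 1 ss Jx.
    by rewrite (_ : derive1n 2 s x = 3^-1 * I x * s x)//; apply/eqP; rewrite -subr_eq0 sE.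
  exists (fun k => Y k x0) => u Mu; rewrite fE//.
  exact: (ode_solution_span oJ iJ scale_matrix_continuous Jx0 sY ord0 Mu).
pose Z (l : 'I_2) x := \sum_k c k * F k l x.
have sZ : is_sol Z by exact: (ode_solution_sum c fundamental_scale_sol).
exists (Z ord0); split.
- exact: (ode_solution_smooth oJ scale_matrix_smooth sZ).
- move=> x Jx; rewrite -(scale_lin Z x).2 -(@derive_val _ _ _ _ _ _ _ (sZ ord_max x Jx)).
  rewrite derive1nS derive1E.
  have dZ y : J y -> derive1n 1 (Z ord0) y = Z ord_max y.
    move=> Jy; rewrite /derive1n /= derive1E (@derive_val _ _ _ _ _ _ _ (sZ ord0 y Jy)).
    by rewrite scale_lin.
  by rewrite (near_eq_derive (1 : R) (near_J oJ dZ Jx)) subrr.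
- by move=> u Mu; rewrite fE.
Qed.

End ScaleDimension.

(** * Open intervals with extended real endpoints *)

Section OpenInterval.
Variables (R : realType) (a b : \bar R).
Local Notation J := [set x : R | (a < x%:E < b)%E].

Lemma open_ereal_itv : open J.
Proof.
have -> : J = [set x : R | (a < x%:E)%E] `&` [set x : R | (x%:E < b)%E].
  by apply/seteqP; split=> x /= => [/andP[]|[-> ->]].
apply: openI.
  case: a => [r| |].
  - rewrite (_ : [set _ | _] = [set x | r < x]); first exact: open_gt.
    by apply/seteqP; split => x /=; rewrite lte_fin.
  - by rewrite (_ : [set _ | _] = set0); [exact: open0 | apply/seteqP; split].
  - rewrite (_ : [set _ | _] = setT); first exact: openT.
    by apply/seteqP; split => x //= _; rewrite ltNyr.
case: b => [r| |].
- rewrite (_ : [set _ | _] = [set x | x < r]); first exact: open_lt.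
  by apply/seteqP; split => x /=; rewrite lte_fin.
- rewrite (_ : [set _ | _] = setT); first exact: openT.
  by apply/seteqP; split => x //= _; rewrite ltry.
- by rewrite (_ : [set _ | _] = set0); [exact: open0 | apply/seteqP; split].
Qed.

Lemma is_interval_ereal_itv : is_interval J.
Proof.
move=> x y /= /andP[ax _] /andP[_ yb] z /andP[xz zy]; apply/andP; split.
  by apply: lt_le_trans ax _; rewrite lee_fin.
by apply: le_lt_trans yb; rewrite lee_fin.
Qed.

Lemma ereal_itv_nonempty : (a < b)%E -> exists x, J x.
Proof.
case: a b => [r| |] [s| |]//= ab.
- rewrite lte_fin in ab; exists ((r + s) / 2); rewrite !lte_fin.
  by rewrite midf_lt// midf_lt.
- by exists (r + 1); rewrite lte_fin ltrDl ltr01 ltry.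
- by exists (s - 1); rewrite lte_fin ltNyr ltrBlDr ltrDl ltr01.
- by exists 0; rewrite ltNyr ltry.
Qed.

End OpenInterval.

Theorem corollary30 (R : realType) (a b : \bar R) (I : R -> R) :
  let J := [set x : R | (a < x%:E < b)%E] in
  let M := M_of J in
  let g := g_of I in
  let S := scale_solutions I J in
  let I_constant := exists c : R, forall x : R, J x -> I x = c in
  (a < b)%E ->
  smooth1_on J I ->
  [/\ almost_einstein_scales M g = S,
      almost_ricci_flat_scales M g = S,
      has_dim_on (W := R^o) M S 2,
      (~ I_constant -> has_dim_on M (conformal_killing_fields M g) 8) &
      (I_constant -> has_dim_on M (conformal_killing_fields M g) 9)].
Proof.
move=> J M g S I_constant ab sI.
have oJ : open J by exact: open_ereal_itv.
have iJ : is_interval J by exact: is_interval_ereal_itv.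
have [x0 Jx0] := ereal_itv_nonempty ab.
split.
- exact: almost_einstein_eq.
- exact: almost_ricci_flat_eq.
- exact: (scale_dim oJ iJ sI Jx0).
- move=> nI; apply: (killing_dim oJ iJ sI Jx0 (m := 2)) => // c0.
  split=> [c0I _|-> // x _]; last by rewrite mulr0.
  (* A nonzero [c0] would force I' = 0 on the interval, hence a constant I. *)
  apply/eqP/negPn/negP => c0N; apply: nI; exists (I x0) => x Jx.
  apply: (derive0_cst iJ _ Jx Jx0) => z Jz.
  have := smooth1_is_derive 0 sI Jz.
  by have := c0I z Jz => /eqP; rewrite mulf_eq0 (negbTE c0N) orbF => /eqP ->.
- move=> [c Ic]; apply: (killing_dim oJ iJ sI Jx0 (m := 3)) => // c0.
  split=> // _ x Jx.
  (* I equals the constant only on [J], which is open, so its derivative there is still 0. *)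
  rewrite (@eq_derive1n R J oJ I (cst c) 1 x Ic Jx) /derive1n /= derive1_cst mul0r//.
Qed.
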